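(* Let $H\in M(p,\mathbb{R})$ satisfy $\Re\,\mathrm{eig}(H)\subseteq(0,1)\setminus\{1/2\}$. Let $X_H=\{X_H(t)\}_{t\in\mathbb{R}}$ be a maofLm with Hurst matrix $H$, parameters $M_+,M_-$, integrands $g_t$ and Lévy measure $\mu$ on $\mathbb{R}^p$. Assume that $M_+,M_-\in GL(p,\mathbb{R})$ and that $\{f_t\}_{t\in\mathbb{R}}$, $f_t(s,\mathbf{z})=g_t(s)\mathbf{z}$, is a minimal representation of $X_H$ with respect to $\mathcal{B}(\mathbb{R}^{p+1})\bmod\kappa$, where $\kappa(ds,d\mathbf{z})=ds\otimes\mu(d\mathbf{z})$. Then the following conditions are equivalent. (i) $X_H$ is time-reversible, i.e. $\{X_H(-t)\}_{t\in\mathbb{R}}\stackrel{\mathrm{f.d.d.}}{=}\{X_H(t)\}_{t\in\mathbb{R}}$. (ii) The following two conditions hold: (a) $(M_-^{-1}M_+)|_{\mathrm{supp}(\mu)}$ is an involution, i.e. $M_-^{-1}M_+\mathbf{z}=M_+^{-1}M_-\mathbf{z}$ for $\mu$-a.e. $\mathbf{z}$; (b) the map $\mathbf{z}\mapsto M_+^{-1}M_-\mathbf{z}$ preserves the measure $\mu$, i.e. $\mu\big((M_-^{-1}M_+)d\mathbf{z}\big)=\mu(d\mathbf{z})$, meaning $\mu((M_-^{-1}M_+)C)=\mu(C)$ for every Borel $C\subseteq\mathbb{R}^p$. Moreover, in (ii) condition (a) can be replaced by (a') for each $t\in\mathbb{R}$, $g_{-t}(s)\mathbf{z}=g_t(-s)M_-^{-1}M_+\mathbf{z}=g_t(-s)M_+^{-1}M_-\mathbf{z}$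 for $\kappa$-a.e. $(s,\mathbf{z})$.
   Context: Notation. $M(p,\mathbb{R})$: $p\times p$ real matrices; $GL(p,\mathbb{R})$: invertible ones; $\Re\,\mathrm{eig}(M)$: set of real parts of eigenvalues; $c^M=\exp\{M\log c\}$, $c>0$; $x_+^{D}=x^{D}$ if $x>0$ and $0$ otherwise; $x_-^{D}=|x|^{D}$ if $x<0$ and $0$ otherwise; $D=H-(1/2)I$. f.d.d. = finite-dimensional distributions. maofLm. Under $\Re\,\mathrm{eig}(H)\subseteq(0,1)\setminus\{1/2\}$, let $g_t(s)=\{(t-s)_+^D-(-s)_+^D\}M_++\{(t-s)_-^D-(-s)_-^D\}M_-$ with $M_+,M_-\in M(p,\mathbb{R})$; this is the form of the integrand (it lies in $L^2(\mathbb{R},M(p,\mathbb{R}))$). Let $\mu$ be a Lévy measure on $\mathcal{B}(\mathbb{R}^p)$ with $\int_{\mathbb{R}^p}\mathbf{z}^*\mathbf{z}\,\mu(d\mathbf{z})<\infty$, $\mu(\{\mathbf{0}\})=0$, and let $\widetilde N(ds,d\mathbf{z})$ be the compensated Poisson random measure on $\mathbb{R}\times\mathbb{R}^p$ with intensity $ds\,\mu(d\mathbf{z})$ (integrals of square-integrable functions being $L^2(\mathbb{P})$-limits of integrals of elementary functions). A maofLm (moving average operator fractional Lévy motion) is a process with the f.d.d. of $X_H(t)=\int_{\mathbb{R}\times\mathbb{R}^p}g_t(s)\mathbf{z}\,\widetilde N(ds,d\mathbf{z})$ such that, for each $t\ne0$, the distribution of $X_H(t)$ is not concentrated on a proper subspace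 of $\mathbb{R}^p$. Minimality. For a process $X(t)=\int f_t\,d\widetilde N$, $t\in T$, with $\widetilde N$ a compensated Poisson random measure of intensity $\kappa$ on a measurable space $(\overline\Omega,\mathcal{B})$, $\{f_t\}_{t\in T}$ is a minimal representation of $X$ with respect to $\mathcal{B}\bmod\kappa$ if: (1) for every $C\in\mathcal{B}$ there is $C'\in\sigma(\{f_t\}_{t\in T})$ with $\kappa(C\Delta C')=0$; and (2) there is no $C\in\mathcal{B}$ with $\kappa(C)>0$ such that for every $t\in T$, $f_t=0$ a.e. on $C$. *)

(* Defs.v *)
From HB Require Import structures.
From mathcomp Require Import all_boot all_order all_algebra.
From mathcomp Require Import complex.
From mathcomp Require Import all_classical all_reals all_analysis measurable_realfun.

Set Implicit Arguments.
Unset Strict Implicit.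
Unset Printing Implicit Defensive.

Import Order.TTheory GRing.Theory Num.Theory.
Import numFieldNormedType.Exports.

Local Open Scope classical_set_scope.
Local Open Scope ring_scope.

(* R^p (column vectors) with its Borel sigma-algebra. *)
Definition borel_cV (R : realType) (p : nat) :=
  g_sigma_algebraType (@open 'cV[R]_p).

Section matrix_functions.
Context {R : realType} {p : nat}.
Implicit Types (A H Mp Mm : 'M[R]_p) (v : 'cV[R]_p) (c x t s : R).

Definition sqnorm v : R := (v^T *m v) ord0 ord0.

Definition Re_eig H : set R :=
  [set complex.Re l | l in [set l : R[i] | eigenvalue (map_mx (real_complex R) H) l]].

Definition expmx A : 'M[R]_p :=
  lim (series (fun n => (n`!%:R)^-1 *: A ^+ n) @ \oo).

(* c ^ A; only meaningful for 0 < c *)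
Definition powmx c A : 'M[R]_p := expmx (ln c *: A).

Definition pos_powmx x A : 'M[R]_p := if 0 < x then powmx x A else 0.
Definition neg_powmx x A : 'M[R]_p := if x < 0 then powmx `|x| A else 0.

Definition maofLm_kernel H Mp Mm t s : 'M[R]_p :=
  let D := H - (2^-1)%:M in
  (pos_powmx (t - s) D - pos_powmx (- s) D) *m Mp +
  (neg_powmx (t - s) D - neg_powmx (- s) D) *m Mm.

End matrix_functions.

Section poisson_integral.
Context {R : realType} {dE : measure_display} {E : measurableType dE}.
Context {d : measure_display} {Omega : measurableType d}.
Variables (P : probability Omega R) (kappa : {measure set E -> \bar R}).

(* [poisson_prob r k0] does not depend on its dummy argument [k0]. *)
Record poisson_random_measure (N : Omega -> {measure set E -> \bar R}) : Prop :=
  PoissonRandomMeasure {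
    prm_measurable : forall A, measurable A ->
      measurable_fun [set: Omega] (fun w => N w A);
    prm_poisson : forall A, measurable A -> (kappa A < +oo)%E ->
      forall k : nat, P [set w | N w A = k%:R%:E] =
                      poisson_prob (fine (kappa A)) 0 [set k];
    prm_infinite : forall A, measurable A -> kappa A = +oo%E ->
      {ae P, forall w, N w A = +oo%E};
    prm_independent : forall (n : nat) (A : 'I_n -> set E),
      (forall i, measurable (A i)) -> trivIset [set: 'I_n] A ->
      forall B : 'I_n -> set (\bar R), (forall i, measurable (B i)) ->
      P [set w | forall i, B i (N w (A i))] =
      (\prod_(i < n) fine (P [set w | B i (N w (A i))]))%:E }.

Variable p : nat.

Record elementary_fun := ElementaryFun {
  ef_size : nat;
  ef_set : 'I_ef_size -> set E;
  ef_val : 'I_ef_size -> 'cV[R]_p;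
  ef_measurable : forall i, measurable (ef_set i);
  ef_finite : forall i, (kappa (ef_set i) < +oo)%E }.

Definition ef_eval (e : elementary_fun) (x : E) : 'cV[R]_p :=
  \sum_i (\1_(ef_set (e := e) i) x : R) *: ef_val i.

(* Integral against the compensated measure N - kappa. *)
Definition ef_integral (N : Omega -> {measure set E -> \bar R})
    (e : elementary_fun) (w : Omega) : 'cV[R]_p :=
  \sum_i (fine (N w (ef_set (e := e) i)) - fine (kappa (ef_set i))) *: ef_val i.

(* [Y] is (a version of) the integral of the square-integrable [f] against
   N - kappa. *)
Definition is_compensated_integral (N : Omega -> {measure set E -> \bar R})
    (f : E -> 'cV[R]_p) (Y : Omega -> 'cV[R]_p) : Prop :=
  exists e : nat -> elementary_fun,
    (fun n => \int[kappa]_x (sqnorm (ef_eval (e n) x - f x))%:E)%E @ \oo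
      --> 0%E /\
    (fun n => \int[P]_w (sqnorm (ef_integral N (e n) w - Y w))%:E)%E @ \oo
      --> 0%E.

End poisson_integral.

(* Equality of the laws of (X t_1, ..., X t_n) and (Y t_1, ..., Y t_n), on the
   product sigma-algebra, for all n and t_1, ..., t_n. *)
Definition eq_fdd {R : realType} {I : Type} {dS : measure_display}
    {S : measurableType dS} {d d' : measure_display} {Omega : measurableType d}
    {Omega' : measurableType d'} (P : probability Omega R)
    (P' : probability Omega' R) (X : I -> Omega -> S) (Y : I -> Omega' -> S) :=
  forall (n : nat) (t : 'I_n -> I) (B : set (n.-tuple S)), measurable B ->
    P [set w | B [tuple X (t i) w | i < n]] =
    P' [set w | B [tuple Y (t i) w | i < n]].

(* Under these conditions the usual requirement that min(1, |z|^2) be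
   mu-integrable is automatic. *)
Definition L2_levy_measure {R : realType} {p : nat}
    (mu : {measure set (borel_cV R p) -> \bar R}) : Prop :=
  mu [set (0 : 'cV[R]_p)] = 0%E /\ (\int[mu]_z (sqnorm z)%:E < +oo)%E.

(* ds (x) mu(dz). The product [\x^] does not require mu to be bundled as a
   sigma-finite measure. *)
Definition intensity {R : realType} {p : nat}
    (mu : {measure set (borel_cV R p) -> \bar R}) :
    {measure set (measurableTypeR R * borel_cV R p) -> \bar R} :=
  [the measure _ _ of (@lebesgue_measure R \x^ mu)%E].

Definition maofLm_integrand {R : realType} {p : nat} (H Mp Mm : 'M[R]_p)
    (t : R) (x : measurableTypeR R * borel_cV R p) : borel_cV R p :=
  maofLm_kernel H Mp Mm t x.1 *m (x.2 : 'cV[R]_p).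

Definition is_maofLm {R : realType} {p : nat} {d : measure_display}
    {Omega : measurableType d} (P : probability Omega R)
    (H Mp Mm : 'M[R]_p) (mu : {measure set (borel_cV R p) -> \bar R})
    (X : R -> {RV P >-> borel_cV R p}) : Prop :=
  (exists (d' : measure_display) (Omega' : measurableType d')
      (P' : probability Omega' R)
      (N : Omega' -> {measure set (measurableTypeR R * borel_cV R p) -> \bar R})
      (Y : R -> {RV P' >-> borel_cV R p}),
    [/\ poisson_random_measure P' (intensity mu) N,
        forall t, is_compensated_integral P' (intensity mu) N
                    (maofLm_integrand H Mp Mm t) (Y t) &
        eq_fdd P P' X Y]) /\
  (forall t : R, t != 0 -> forall V : {vspace 'cV[R]_p},
    V != fullv -> P [set w | (X t w : 'cV[R]_p) \in V] != 1%E).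

Definition time_reversible {R : realType} {dS : measure_display}
    {S : measurableType dS} {d : measure_display} {Omega : measurableType d}
    (P : probability Omega R) (X : R -> Omega -> S) : Prop :=
  eq_fdd P P (fun t => X (- t)) X.

(* The two conditions bearing on the integrands of a representation
   X t = \int f t d(N - kappa) for it to be minimal. *)
Definition minimal_integrands {R : realType} {T : Type} {dE : measure_display}
    {E : measurableType dE} (kappa : {measure set E -> \bar R}) {p : nat}
    (f : T -> E -> borel_cV R p) : Prop :=
  (forall C : set E, measurable C ->
     exists2 C', <<s [set A | exists t, exists2 B, measurable B & A = f t @^-1` B] >> C' &
       kappa (C `+` C') = 0%E) /\
  ~ (exists C : set E, [/\ measurable C, (0 < kappa C)%E &
       forall t, {ae kappa, forall x, C x -> f t x = (0 : 'cV[R]_p)}]).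

(* Main.v *)
(** A compensated Poisson integral of [h] has characteristic function
    [exp (\int (cos h - 1) + i \int (sin h - h)) dkappa], so the finite-dimensional
    laws of [X] determine the integrals [\int (cos l - 1)] and [\int (sin l - l)]
    for every linear form [l] in the values of the path [t |-> f t x], and hence
    the image of [kappa] under the map sending [x] to its path.  Time reversibility
    therefore says that the paths [t |-> f t x] and [t |-> f (- t) x] have the same
    image measure.

    If it holds, minimality gives a measurable left inverse [phi] of the path map,
    and equality of the images forces almost every path [t |-> f (- t) (s, z)] to
    be the path of some [(s', z')].  A path determines [s] and the vectors
    [Mp z], [Mm z] through the differential equation [(t - s) y' = D y]; since
    reversal exchanges [Mp z] and [Mm z] and changes [s] to [- s], this yields
    [s' = - s], [Mp z' = Mm z], [Mm z' = Mp z], whence the involution, and then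
    the invariance of [mu] from that of [kappa] on sets [[0, 1] x C].
    Conversely, under the two conditions the map [(s, z) |-> (- s, Mm^-1 Mp z)]
    preserves [kappa] and exchanges the two families of integrands. *)

Require Import Defs.
From HB Require Import structures.
From mathcomp Require Import all_boot all_order all_algebra.
From mathcomp Require Import complex.
From mathcomp Require Import all_classical all_reals all_analysis measurable_realfun.
From mathcomp Require Import ring lra.

Set Implicit Arguments.
Unset Strict Implicit.
Unset Printing Implicit Defensive.

Import Order.TTheory GRing.Theory Num.Theory.
Import numFieldNormedType.Exports.

Local Open Scope classical_set_scope.
Local Open Scope ring_scope.

(** * Matrix powers and their differential equation *)

(** [kappa] may be infinite, and for a linear form only [cos - 1] and [sin - id] are known to be
    integrable, so uniqueness of characteristic functions of finite measures does not apply to the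
    image measures directly. Multiplying by [1 - cos l0] gives an integrable weight, and product
    formulas express the weighted integrals through the exponents of [l], [l + l0] and [l - l0]. The
    weight is divided out where [cos l0 != 1]; countably many such sets, built at rational times,
    cover almost every path because [mu] does not charge [0]. The exponent is read off a
    characteristic function only modulo [2 pi] in its imaginary part; scaling the form by a real [r]
    and continuity in [r] remove the ambiguity. The spectral condition makes paths determine their
    data: if [1/2] is not an eigenvalue of [H], then [D] has no kernel and an additive constant
    hides nothing; if [3/2] is not one, then [D] fixes no vector, which rules out solutions affine
    in [t]. Each identity between paths holds outside a null set that depends on [t]; it is
    therefore used at rational times, and continuity away from the singularity restores the rest. *)

Section exponential_series.
Context {R : realType}.
Implicit Types (a : nat -> R) (K x : R).

(** The exponential generating function of [a]. It serves twice: for the entries of a matrix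
    exponential, and, with [cos (n c)] and [sin (n c)], for the characteristic function of a Poisson
    variable. *)
Definition egf a x : R := limn (pseries (fun n => a n / n`!%:R) x).

Lemma is_cvg_egf a C K x : (forall n, `|a n| <= C * K ^+ n) ->
  cvgn (pseries (fun n => a n / n`!%:R) x).
Proof.
move=> aK; apply: normed_cvg.
have C0 : 0 <= C by have := aK 0%N; rewrite expr0 mulr1; apply: le_trans.
have Kx : cvgn (series (fun n => C * exp_coeff (`|K| * `|x|) n)).
  exact: is_cvg_seriesZ (is_cvg_series_exp_coeff _).
apply: series_le_cvg Kx => [n|n|n] //=.
  by rewrite mulr_ge0// exp_coeff_ge0// mulr_ge0.
have n0 : `|(n`!%:R : R)^-1| = n`!%:R^-1 by rewrite ger0_norm.
rewrite /exp_coeff/= 2!normrM normrX n0 exprMn.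
rewrite [leRHS](_ : _ = C * `|K| ^+ n / n`!%:R * `|x| ^+ n); last by ring.
rewrite ler_wpM2r ?exprn_ge0// ler_wpM2r//.
by apply: (le_trans (aK n)); rewrite ler_wpM2l// -normrX ler_norm.
Qed.

Lemma pseries_diffs_egf a : pseries_diffs (fun n => a n / n`!%:R) =
  (fun n => a n.+1 / n`!%:R).
Proof.
apply/funext => n; rewrite /pseries_diffs factS natrM invfM.
by rewrite mulrCA mulVKf ?pnatr_eq0.
Qed.

(** Termwise differentiation shifts the coefficients, and a shifted sequence keeps the ratio [K]
    while [C] is multiplied by [K]; so both derived series converge at the auxiliary point [|x| + 1]
    too. *)
Lemma is_derive_egf a C K x : (forall n, `|a n| <= C * K ^+ n) ->
  is_derive x (1 : R) (egf a) (egf (fun n => a n.+1) x).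
Proof.
move=> aK.
have shiftb (b : nat -> R) C' : (forall n, `|b n| <= C' * K ^+ n) ->
    forall n, `|b n.+1| <= (C' * K) * K ^+ n.
  by move=> bK n; rewrite -mulrA -exprS.
rewrite /egf -[X in limn (pseries X x)]pseries_diffs_egf.
apply: (@pseries_snd_diffs _ _ (`|x| + 1)).
- exact: is_cvg_egf aK.
- rewrite pseries_diffs_egf; exact: is_cvg_egf (shiftb _ _ aK).
- rewrite !pseries_diffs_egf; exact: is_cvg_egf (shiftb _ _ (shiftb _ _ aK)).
- by rewrite [ltRHS]ger0_norm// addrC -subr_gt0 addrK.
Qed.

Lemma egf0 a : egf a 0 = a 0%N.
Proof.
rewrite /egf; apply: (@lim_near_cst R^o) => //; near=> m.
rewrite -[m]prednK; last by near: m.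
rewrite /pseries /series/= big_nat_recl//= expr0 mulr1 fact0 divr1.
by rewrite big1 ?addr0// => i _; rewrite exprS mul0r mulr0.
Unshelve. all: by end_near. Qed.

Lemma egf_sum (I : Type) (r : seq I) (c : I -> R) (b : I -> nat -> R) C K x :
  (forall i n, `|b i n| <= C * K ^+ n) ->
  egf (fun n => \sum_(i <- r) c i * b i n) x = \sum_(i <- r) c i * egf (b i) x.
Proof.
move=> bK; rewrite /egf; apply: cvg_lim => //.
rewrite (_ : pseries _ x =
    (fun k => \sum_(i <- r) c i * pseries (fun n => b i n / n`!%:R) x k)).
  elim: r => [|i r IH].
    by rewrite big_nil; under eq_fun do rewrite big_nil; exact: cvg_cst.
  rewrite big_cons; under eq_fun do rewrite big_cons.
  apply: cvgD => //; apply: cvgM; first exact: cvg_cst.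
  exact: is_cvg_egf (bK i).
apply/funext => k; rewrite /pseries/series/=.
under [RHS]eq_bigr do rewrite mulr_sumr.
rewrite exchange_big/=; apply: eq_bigr => j _.
by rewrite !mulr_suml; apply: eq_bigr => i _; rewrite !mulrA.
Qed.

End exponential_series.

Section matrix_power.
Context {R : realType}.

Lemma cvg_mx_entries m n (I : Type) (F : set_system I) (FF : Filter F)
    (u : I -> 'M[R]_(m, n)) (M : 'M[R]_(m, n)) :
  (forall i j, u x i j @[x --> F] --> M i j) -> u @ F --> M.
Proof.
move=> uM A [P MP PA]; rewrite /nbhs/=.
have : \forall x \near F, forall ij : 'I_m * 'I_n, P ij.1 ij.2 (u x ij.1 ij.2).
  by apply: filter_forall => -[i j]; apply: uM; exact: MP.
by apply: filterS => x Px; apply: PA => i j; exact: (Px (i, j)).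
Qed.

Context {p : nat}.
Implicit Types (D : 'M[R]_p).

Definition entry_bound D : R := \sum_i \sum_j `|D i j|.

Lemma entry_bound_ge0 D : 0 <= entry_bound D.
Proof. by apply: sumr_ge0 => i _; apply: sumr_ge0. Qed.

(** The sum of all absolute entries is a crude submultiplicative bound; the factor [1] matches the
    shape [C * K ^+ n] of the series lemmas. *)
Lemma exprmx_entry_le D n i j :
  `|(D ^+ n) i j| <= 1 * entry_bound D ^+ n.
Proof.
rewrite mul1r; elim: n i j => [|n IH] i j.
  by rewrite !expr0 mxE; case: (i == j); rewrite ?normr1 ?normr0.
rewrite !exprS mxE (le_trans (ler_norm_sum _ _ _))//.
apply: (@le_trans _ _ (\sum_k `|D i k| * entry_bound D ^+ n)).
  by apply: ler_sum => k _; rewrite normrM ler_wpM2l.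
rewrite -mulr_suml ler_wpM2r ?exprn_ge0 ?entry_bound_ge0//.
rewrite /entry_bound [leRHS](bigD1 i)//= lerDl.
by apply: sumr_ge0 => k _; apply: sumr_ge0.
Qed.

Lemma scale_exprmx (t : R) D n : (t *: D) ^+ n = t ^+ n *: D ^+ n.
Proof.
elim: n => [|n IH]; first by rewrite !expr0 scale1r.
by rewrite !exprS IH -!mulmxE -scalemxAl -scalemxAr scalerA.
Qed.

Lemma expmx_entry (t : R) D i j :
  expmx (t *: D) i j = egf (fun n => (D ^+ n) i j) t.
Proof.
suff -> : expmx (t *: D) = \matrix_(i, j) egf (fun n => (D ^+ n) i j) t.
  by rewrite mxE.
apply: cvg_lim; first exact: norm_hausdorff.
apply: cvg_mx_entries => {}i {}j; rewrite mxE.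
rewrite (_ : (fun _ => _) = pseries (fun n => (D ^+ n) i j / n`!%:R) t).
  exact: is_cvg_egf (fun n => exprmx_entry_le D n i j).
apply/funext => k; rewrite /pseries /series/= summxE.
apply: eq_bigr => n _; rewrite !mxE scale_exprmx mxE.
ring.
Qed.

Lemma powmx1 D : powmx 1 D = 1%:M.
Proof. by apply/matrixP => i j; rewrite /powmx ln1 expmx_entry egf0 expr0. Qed.

Lemma is_derive_expmx_mulV (t : R) D m (v : 'M[R]_(p, m)) i j :
  is_derive t (1 : R) (fun t => (expmx (t *: D) *m v) i j)
    ((D *m (expmx (t *: D) *m v)) i j).
Proof.
rewrite mulmxA mxE.
rewrite (_ : (fun _ => _) =
    \sum_k (fun t => egf (fun n => (D ^+ n) i k) t * v k j)); last first.
  apply/funext => r; rewrite mxE fct_sumE; apply: eq_bigr => k _.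
  by rewrite expmx_entry.
apply: is_derive_sum => k.
have Dexp : (D *m expmx (t *: D)) i k = egf (fun n => (D ^+ n.+1) i k) t.
  rewrite mxE; under eq_bigr do rewrite expmx_entry.
  rewrite -(egf_sum _ _ _ (fun l n => exprmx_entry_le D n l k)).
  by congr egf; apply/funext => n; rewrite exprS mxE.
rewrite Dexp.
have H := is_derive_egf (K := entry_bound D) t
  (fun n => exprmx_entry_le D n i k).
rewrite (_ : (fun _ => _) =
    egf (fun n => (D ^+ n) i k) \* cst (v k j)); last by [].
apply: is_derive_eq.
by rewrite /= scaler0 add0r /GRing.scale/= mulrC.
Qed.

End matrix_power.

Section identification.
Context {R : realType} {p : nat}.
Implicit Types (D H : 'M[R]_p) (s t : R) (u v w : 'cV[R]_p).

(** The equation [(t - s) y' = D y] for [y = (t - s)^D v], by the chain rule through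
    [ln (t - s)]. *)
Lemma is_derive_powmx_mulV s t D v i : s < t ->
  is_derive t (1 : R) (fun t => (powmx (t - s) D *m v) i ord0)
    ((t - s)^-1 * (D *m (powmx (t - s) D *m v)) i ord0).
Proof.
move=> st; have ts0 : 0 < t - s by rewrite subr_gt0.
have H4 : is_derive t (1 : R) (fun t => t - s) 1.
  by apply: is_derive_eq; rewrite subr0.
have H2 : is_derive t (1 : R) (fun t => ln (t - s)) ((t - s)^-1 * 1).
  exact: (@is_derive1_comp _ (@ln R) (fun t : R => t - s) t _ _
    (is_derive1_ln ts0) H4).
rewrite mulr1 in H2; rewrite mulrC.
exact: (@is_derive1_comp _ (fun r => (expmx (r *: D) *m v) i ord0)
  (fun t : R => ln (t - s)) t _ _ (is_derive_expmx_mulV _ D v i ord0) H2).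
Qed.

Lemma eq_on_rationals (f : R -> R) c0 a :
  (forall x, a < x -> {for x, continuous f}) ->
  (forall q : rat, a < ratr q -> f (ratr q) = c0) ->
  forall x, a < x -> f x = c0.
Proof.
move=> fc fq x ax; apply/eqP; apply/negPn/negP => fx.
have : \forall y \near x, a < y /\ f y != c0.
  near=> y; split; first by near: y; exact: lt_nbhsr.
  near: y; apply: (fc _ ax [set y | y != c0]).
  by apply: open_nbhs_nbhs; split => //; exact: open_neq.
rewrite /prop_near1 nbhsE => -[U [oU Ux] Ua].
have [y [Uy [q _ qy]]] := dense_rat (ex_intro _ x Ux) oU.
by have := Ua _ Uy; rewrite /= -qy => -[/fq ->]; rewrite eqxx.
Unshelve. all: by end_near. Qed.

Lemma continuous_powmx_mulV s t D v i : s < t ->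
  {for t, continuous (fun t => (powmx (t - s) D *m v) i ord0)}.
Proof.
move=> st; apply/differentiable_continuous/derivable1_diffP.
by have [] := is_derive_powmx_mulV D v i st.
Qed.

Lemma powmx_diff_const D s s' v v' w :
  (forall q : rat, Num.max s s' < ratr q ->
    powmx (ratr q - s) D *m v - powmx (ratr q - s') D *m v' = w) ->
  forall t, Num.max s s' < t ->
    powmx (t - s) D *m v - powmx (t - s') D *m v' = w.
Proof.
move=> hq t st; apply/matrixP => i j; rewrite ord1 !mxE.
pose f i v s := fun t => (powmx (t - s) D *m v) i ord0.
have fE k u r x : (powmx (x - r) D *m u) k ord0 =
    \sum_j powmx (x - r) D k j * u j ord0 by rewrite mxE.
rewrite -!fE; apply: (@eq_on_rationals (f i v s - f i v' s') _ (Num.max s s')).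
- move=> x; rewrite gt_max => /andP[sx s'x].
  by apply: cvgB; exact: continuous_powmx_mulV.
- by move=> q /hq <-; rewrite [RHS]mxE [X in _ = _ + X]mxE.
- by [].
Qed.

Lemma powmx_diff_const_derive D s s' v v' w t :
  (forall t, Num.max s s' < t ->
    powmx (t - s) D *m v - powmx (t - s') D *m v' = w) -> Num.max s s' < t ->
  (t - s)^-1 *: (D *m (powmx (t - s) D *m v)) =
  (t - s')^-1 *: (D *m (powmx (t - s') D *m v')).
Proof.
move=> hw st; have := st; rewrite gt_max => /andP[stt s'tt].
apply/matrixP => i j; rewrite ord1 [LHS]mxE [RHS]mxE.
apply/eqP; rewrite -subr_eq0; apply/eqP.
have H1 := is_derive_powmx_mulV D v i stt.
have H2 := is_derive_powmx_mulV D v' i s'tt.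
have := is_deriveB H1 H2.
set f := (X in is_derive t _ X _) => H3.
have H4 : is_derive t (1 : R) f 0.
  apply: (@near_eq_is_derive _ _ _ (cst (w i ord0))).
  near=> x; have sx : Num.max s s' < x by near: x; exact: lt_nbhsr.
  by rewrite /cst -(hw _ sx) [LHS]mxE [X in _ + X]mxE.
by rewrite -(@derive_val _ _ _ _ _ _ _ H3) (@derive_val _ _ _ _ _ _ _ H4).
Unshelve. all: by end_near. Qed.

Lemma powmx_diff_const_eq D s v v' w : (forall u, D *m u = 0 -> u = 0) ->
  (forall q : rat, s < ratr q ->
    powmx (ratr q - s) D *m v - powmx (ratr q - s) D *m v' = w) -> v = v'.
Proof.
move=> D0 hq; have := @powmx_diff_const D s s v v' w.
rewrite maxxx => /(_ hq) hw.
(* At [t = s + 1] both powers are the identity, so the differentiated relation reads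
   [D v = D v']. *)
have := @powmx_diff_const_derive D s s v v' w (s + 1).
rewrite maxxx => /(_ hw); rewrite ltrDl => /(_ ltr01).
have := hw (s + 1); rewrite ltrDl => /(_ ltr01).
rewrite (addrC s) addrK invr1 !scale1r powmx1 !mul1mx => vv' Dvv'.
by apply/eqP; rewrite -subr_eq0; apply/eqP/D0; rewrite mulmxBr Dvv' subrr.
Qed.

(* Differentiating the constant difference gives [D y' / (t - s')] constant, say
   [e]; then [t |-> (t - s') e] also solves the equation of [D y'], so [D e = e]. *)
Lemma powmx_diff_const_lt D s s' v v' w : (forall u, D *m u = 0 -> u = 0) ->
  (forall u, D *m u = u -> u = 0) -> s < s' ->
  (forall q : rat, s' < ratr q ->
    powmx (ratr q - s) D *m v - powmx (ratr q - s') D *m v' = w) -> v' = 0.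
Proof.
move=> D0 D1 ss' hq; have maxss' : Num.max s s' = s' by exact/max_r/ltW.
have := @powmx_diff_const D s s' v v' w; rewrite maxss' => /(_ hq) hw.
have := @powmx_diff_const_derive D s s' v v' w; rewrite maxss'.
(* With [y - y' = w] and [D y / (t - s) = D y' / (t - s')], one gets
   [D w = (s' - s) / (t - s') D y']; hence this value of the constant. *)
pose e := (s' - s)^-1 *: (D *m w).
have ss'0 : s' - s != 0 by rewrite subr_eq0 gt_eqF.
move=> hd; have Dy' t : s' < t -> (t - s')^-1 *: (D *m (powmx (t - s') D *m v')) = e.
  move=> s't; have st := lt_trans ss' s't.
  have ts0 : t - s != 0 by rewrite subr_eq0 gt_eqF.
  have ts'0 : t - s' != 0 by rewrite subr_eq0 gt_eqF.
  have eE := hd _ hw s't.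
  have Dy : D *m (powmx (t - s) D *m v) =
      (t - s) / (t - s') *: (D *m (powmx (t - s') D *m v')).
    by rewrite -scalerA -eE scalerA divff// scale1r.
  rewrite /e -(hw _ s't) mulmxBr Dy -[X in _ = _ *: (_ - X)]scale1r -scalerBl.
  by rewrite scalerA; congr (_ *: _); field; rewrite ts'0 ss'0.
have De : D *m e = e.
  apply/matrixP => i j; rewrite ord1.
  have s'1 : s' < s' + 1 by rewrite ltrDl.
  have H1 : is_derive (s' + 1) (1 : R)
      (fun t => (D *m (powmx (t - s') D *m v')) i ord0) ((D *m e) i ord0).
    rewrite (_ : (fun _ => _) =
        \sum_k (fun t => D i k * (powmx (t - s') D *m v') k ord0)); last first.
      by apply/funext => t; rewrite mxE fct_sumE.
    rewrite [in X in is_derive _ _ _ X]mxE; apply: is_derive_sum => k.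
    have H2 := is_derive_powmx_mulV D v' k s'1.
    have := Dy' _ s'1 => /(congr1 (fun M : 'cV_p => M k ord0)).
    rewrite mxE => <-.
    exact: (@is_deriveZ _ _ _ (fun t => (powmx (t - s') D *m v') k ord0)).
  have H3 : is_derive (s' + 1) (1 : R)
      (fun t => (D *m (powmx (t - s') D *m v')) i ord0) (e i ord0).
    apply: (@near_eq_is_derive _ _ _ (fun t => e i ord0 * (t - s'))).
      near=> t; have s't : s' < t by near: t; exact: lt_nbhsr.
      have := Dy' _ s't => /(congr1 (fun M => (t - s') *: M)).
      rewrite scalerA divff ?subr_eq0 ?gt_eqF// scale1r => ->.
      by rewrite [RHS]mxE mulrC.
    have H2 : is_derive (s' + 1) (1 : R) (fun t => t - s') 1.
      by apply: is_derive_eq; rewrite subr0.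
    have := @is_deriveZ _ _ _ (fun t => t - s') (e i ord0) _ _ _ H2.
    by rewrite [X in is_derive _ _ _ X]mulr1.
  by rewrite -(@derive_val _ _ _ _ _ _ _ H3) (@derive_val _ _ _ _ _ _ _ H1).
(* At [t = s' + 1] the power is the identity, so [D v' = e = 0]. *)
have e0 := D1 _ De.
have := Dy' (s' + 1); rewrite ltrDl => /(_ ltr01).
by rewrite (addrC s') addrK invr1 scale1r powmx1 mul1mx e0 => /D0.
Unshelve. all: by end_near. Qed.

End identification.

(** * Time reversal and injectivity of the kernel paths *)

Section kernel.
Context {R : realType} {p : nat}.
Implicit Types (D H : 'M[R]_p) (s t : R) (u v w : 'cV[R]_p).

(* The integrand is [kern (H - 1/2) t s (Mp z) (Mm z)]; keeping the two
   coefficient vectors apart turns time reversal into [s |-> - s] together with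
   the exchange of the vectors. *)
Definition kern D t s v w : 'cV[R]_p :=
  (pos_powmx (t - s) D - pos_powmx (- s) D) *m v +
  (neg_powmx (t - s) D - neg_powmx (- s) D) *m w.

Lemma pos_powmxN s D : pos_powmx (- s) D = neg_powmx s D.
Proof.
rewrite /pos_powmx /neg_powmx oppr_gt0; case: ifP => // s0.
by rewrite ltr0_norm.
Qed.

Lemma neg_powmxN s D : neg_powmx (- s) D = pos_powmx s D.
Proof. by rewrite -pos_powmxN opprK. Qed.

Lemma kernN D t s v w : kern D (- t) s v w = kern D t (- s) w v.
Proof.
by rewrite /kern -opprD !opprK !pos_powmxN !neg_powmxN addrC.
Qed.

Lemma maofLm_kernelE H Mp Mm t s z :
  maofLm_kernel H Mp Mm t s *m z = kern (H - (2^-1)%:M) t s (Mp *m z) (Mm *m z).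
Proof. by rewrite /maofLm_kernel /kern mulmxDl !mulmxA. Qed.

(** Right of [s] only one power moves with [t]; everything else is a constant that differentiation
    removes. *)
Lemma kern_right D t s v w : s < t ->
  kern D t s v w = powmx (t - s) D *m v -
                   (pos_powmx (- s) D *m v + neg_powmx (- s) D *m w).
Proof.
move=> st; rewrite /kern {1}/pos_powmx {1}/neg_powmx subr_gt0 subr_lt0 st.
by rewrite ltNge (ltW st)/= sub0r mulmxBl mulNmx opprD addrA.
Qed.

(* Rational times suffice, which keeps the exceptional null sets countable. *)
Definition kern_determined D s s' v v' w w' :=
  forall q : rat, kern D (ratr q) s v w = kern D (ratr q) s' v' w'.

(** Reflection trades times right of the singularities for times left of them, so each fact about
    the first coefficients yields one about the second. *)
Lemma kern_determinedN D s s' v v' w w' : kern_determined D s s' v v' w w' ->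
  kern_determined D (- s) (- s') w w' v v'.
Proof. by move=> h q; rewrite -!kernN; have := h (- q); rewrite rmorphN. Qed.

Lemma kern_determined_right D s s' v v' w w' : kern_determined D s s' v v' w w' ->
  exists u, forall q : rat, s < ratr q -> s' < ratr q ->
    powmx (ratr q - s) D *m v - powmx (ratr q - s') D *m v' = u.
Proof.
move=> h; exists (pos_powmx (- s) D *m v + neg_powmx (- s) D *m w -
                  (pos_powmx (- s') D *m v' + neg_powmx (- s') D *m w')).
move=> q sq s'q; have := h q; rewrite !kern_right// => /(canRL (subrK _)) ->.
by rewrite [LHS]addrC -addrA addKr addrC.
Qed.

Section nondegenerate.
Variable D : 'M[R]_p.
Hypothesis D0 : forall u, D *m u = 0 -> u = 0.
Hypothesis D1 : forall u, D *m u = u -> u = 0.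

(** Seen from the right of both singularities, the nearer one is [s'], and its coefficient [v'] must
    vanish; seen from the left the nearer one is [s], with coefficient [w]. *)
Lemma kern_determined_lt s s' v v' w w' : kern_determined D s s' v v' w w' ->
  s < s' -> v' = 0 /\ w = 0.
Proof.
move=> h ss'; split.
  have [u hu] := kern_determined_right h.
  apply: (powmx_diff_const_lt D0 D1 ss' (v := v) (w := u)) => q s'q.
  by apply: hu => //; exact: lt_trans ss' s'q.
have [u hu] := kern_determined_right (kern_determinedN h).
have s's : - s' < - s by rewrite ltrN2.
apply: (powmx_diff_const_lt D0 D1 s's (v := w') (w := - u)) => q sq.
by rewrite -(hu q sq (lt_trans s's sq)) opprB.
Qed.

Lemma kern_determined_eq s v v' w w' : kern_determined D s s v v' w w' ->
  v = v' /\ w = w'.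
Proof.
move=> h; split.
  have [u hu] := kern_determined_right h.
  by apply: (powmx_diff_const_eq D0 (s := s) (w := u)) => q sq; exact: hu.
have [u hu] := kern_determined_right (kern_determinedN h).
by apply: (powmx_diff_const_eq D0 (s := - s) (w := u)) => q sq; exact: hu.
Qed.

(** Distinct singularities would annihilate [w] or [v], according to their order. Invertibility of
    [Mp] and [Mm] will supply both nonvanishing conditions. *)
Lemma kern_determined_id s s' v v' w w' : kern_determined D s s' v v' w w' ->
  v != 0 -> w != 0 -> [/\ s = s', v = v' & w = w'].
Proof.
move=> h v0 w0; have [ss'|s's|ss'] := ltgtP s s'.
- by have [_ /eqP] := kern_determined_lt h ss'; rewrite (negbTE w0).
- have h' : kern_determined D s' s v' v w' w by move=> q; rewrite h.
  by have [/eqP] := kern_determined_lt h' s's; rewrite (negbTE v0).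
- by move: h; rewrite -ss' => /kern_determined_eq[].
Qed.

End nondegenerate.

(** [eigenvalue] speaks of row vectors and [u] is a column, so the argument passes through the
    singularity of [H - a]. *)
Lemma Re_eig_kernel H (a : R) u : H *m u = a *: u -> u != 0 -> Re_eig H a.
Proof.
move=> Hu u0; exists (real_complex R a) => //=.
rewrite eigenvalue_map /eigenvalue /eigenspace kermx_eq0 row_free_unit.
apply/negP => HU; move/negP: u0; apply; apply/eqP.
by rewrite -(mulKmx HU u) mulmxBl Hu mul_scalar_mx subrr mulmx0.
Qed.

End kernel.

(** * Borel structure of column vectors and measurability of the integrands *)

Section borel_vectors.
Context {R : realType} {p : nat}.

Lemma measurable_borel_cV_open (U : set (borel_cV R p)) :
  open (U : set 'cV[R]_p) -> measurable U.
Proof. exact: sub_sigma_algebra. Qed.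

Lemma continuous_measurable_cV (f : 'cV[R]_p -> R) : continuous f ->
  measurable_fun [set: borel_cV R p] (f : borel_cV R p -> measurableTypeR R).
Proof.
move=> cf; apply: (measurability _ (RGenOInfty.measurableE R)).
move=> _ [_ [x ->] <-]; rewrite setTI; apply: measurable_borel_cV_open.
by apply: (@open_comp _ _ f) => // ? _; exact: cf.
Qed.

Lemma measurable_cV_coord i :
  measurable_fun [set: borel_cV R p] (fun z : borel_cV R p => (z : 'cV[R]_p) i ord0).
Proof. by apply: continuous_measurable_cV; exact: coord_continuous. Qed.

Definition rat_box (c : 'cV[rat]_p * rat) : set 'cV[R]_p :=
  [set z | forall i, `|z i ord0 - ratr (c.1 i ord0)| < ratr c.2].

Lemma open_bigcup_rat_box (U : set 'cV[R]_p) : open U ->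
  U = \bigcup_(c in [set c | rat_box c `<=` U]) rat_box c.
Proof.
move=> oU; apply/seteqP; split=> [x Ux|x [c /= cU cx]]; last exact: cU.
have /nbhs_ballP[e /= e0 eU] : nbhs x U by exact: open_nbhs_nbhs.
(* Two points of a box are each within [r] of its centre, hence the bound by half the radius. *)
have [r /andP[r0 re]] : exists q : rat, 0 < (ratr q : R) < e / 2.
  have [r] := rat_in_itvoo (divr_gt0 e0 (ltr0Sn R 1)).
  by rewrite in_itv/= => re; exists r.
have /choice[q hq] : forall i, exists q : rat, `|x i ord0 - ratr q| < ratr r.
  move=> i; have xr : x i ord0 - ratr r < x i ord0 + ratr r by lra.
  have [q] := rat_in_itvoo xr.
  by rewrite in_itv/= => /andP[qr rq]; exists q; rewrite ltr_distlC; apply/andP; split; lra.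
exists (\col_i q i, r); last by move=> i; rewrite mxE.
move=> y /= hy; apply: eU; split => // i j; rewrite ord1.
have := hy i; rewrite mxE; have := hq i => /= h1 h2.
change (`|x i ord0 - y i ord0| < e).
rewrite (_ : x i ord0 - y i ord0 = (x i ord0 - ratr (q i)) - (y i ord0 - ratr (q i))); last by ring.
by rewrite (le_lt_trans (ler_normB _ _))// [ltRHS](splitr e) ltrD// (lt_trans _ re).
Qed.

(** Rational boxes form a countable base, and a box is a finite conjunction of conditions on
    coordinates; so coordinates generate the Borel sigma-algebra. *)
Lemma measurable_cV_coordP d (T : measurableType d) (f : T -> borel_cV R p) :
  (forall i, measurable_fun setT (fun x => (f x : 'cV[R]_p) i ord0)) ->
  measurable_fun setT f.
Proof.
move=> fi; apply: (@measurability _ _ T (borel_cV R p) setT f (@open 'cV[R]_p) erefl).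
move=> _ [U oU <-]; rewrite setTI (open_bigcup_rat_box oU) preimage_bigcup.
rewrite bigcup_mkcond; apply: countable_bigcupT_measurable => // c.
case: ifP => // _.
rewrite (_ : _ @^-1` _ = \bigcap_(i in [set: 'I_p])
  ((fun x => `|(f x : 'cV[R]_p) i ord0 - ratr (c.1 i ord0)|) @^-1` `]-oo, (ratr c.2)[)).
  apply: fin_bigcap_measurable => // i _; rewrite -[_ @^-1` _]setTI.
  apply: (measurableT_comp (f := fun y : R => `|y - ratr (c.1 i ord0)|)) => //.
  by apply: measurableT_comp => //; exact: measurable_funB.
apply/seteqP; split=> [x h i _|x h i] /=; first by rewrite in_itv/=; exact: h.
by have := h i Logic.I; rewrite /= in_itv.
Qed.

Lemma measurable_mulmx_cV (A : 'M[R]_p) : measurable_fun [set: borel_cV R p]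
  ((fun z => A *m (z : 'cV[R]_p)) : borel_cV R p -> borel_cV R p).
Proof.
apply: measurable_cV_coordP => i; under eq_fun do rewrite mxE.
apply: measurable_sum => k; apply: measurable_funM => //.
exact: measurable_cV_coord.
Qed.

Lemma continuous_egf (a : nat -> R) C K : (forall n, `|a n| <= C * K ^+ n) ->
  continuous (egf a).
Proof.
move=> aK x; apply/differentiable_continuous/derivable1_diffP.
by have [] := is_derive_egf x aK.
Qed.

Lemma measurable_pos_powmx (D : 'M[R]_p) i j :
  measurable_fun setT (fun x : R => pos_powmx x D i j).
Proof.
rewrite (_ : (fun _ => _) = fun x => if 0 < x then
    egf (fun n => (D ^+ n) i j) (ln x) else 0); last first.
  by apply/funext => x; rewrite /pos_powmx; case: ifP => _;
     rewrite ?expmx_entry ?mxE.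
apply: measurable_fun_ifT => //; first exact: measurable_fun_ltr.
apply: measurableT_comp; last exact: measurable_ln.
apply: continuous_measurable_fun.
exact: continuous_egf (fun n => exprmx_entry_le D n i j).
Qed.

Lemma measurable_neg_powmx (D : 'M[R]_p) i j :
  measurable_fun setT (fun x : R => neg_powmx x D i j).
Proof.
under eq_fun do rewrite -pos_powmxN.
exact: (measurableT_comp (measurable_pos_powmx D i j) (@oppr_measurable R setT)).
Qed.

Lemma measurable_maofLm_integrand (H Mp Mm : 'M[R]_p) t :
  measurable_fun setT (maofLm_integrand H Mp Mm t).
Proof.
apply: measurable_cV_coordP => i.
rewrite /maofLm_integrand; under eq_fun do rewrite mxE.
apply: measurable_sum => k; apply: measurable_funM; last first.
  by apply: (measurableT_comp (measurable_cV_coord k)); exact: measurable_snd.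
apply: (measurableT_comp (f := fun s : R => maofLm_kernel H Mp Mm t s i k)); last first.
  exact: measurable_fst.
rewrite /maofLm_kernel; under eq_fun do rewrite !mxE.
have mts : measurable_fun setT (fun s : R => t - s) by exact: measurable_funB.
apply: measurable_funD; apply: measurable_sum => l; apply: measurable_funM => //;
  under eq_fun do rewrite !mxE.
- apply: measurable_funB; apply: (measurableT_comp (measurable_pos_powmx _ _ _)) => //.
- apply: measurable_funB; apply: (measurableT_comp (measurable_neg_powmx _ _ _)) => //.
Qed.

End borel_vectors.

(** * Trigonometric integrals determine measures *)

Lemma measurable_cos {R : realType} : measurable_fun setT (cos : R -> R).
Proof. by apply: continuous_measurable_fun; exact: continuous_cos. Qed.

Lemma measurable_sin {R : realType} : measurable_fun setT (sin : R -> R).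
Proof. by apply: continuous_measurable_fun; exact: continuous_sin. Qed.

Lemma bounded_probability_integrable {R : realType} {d : measure_display}
    {Omega : measurableType d} (P : probability Omega R) (f : Omega -> R) :
  measurable_fun setT f -> (forall w, `|f w| <= 1) -> P.-integrable setT (EFin \o f).
Proof.
move=> mf f1; apply: measurable_bounded_integrable => //.
  by rewrite (le_lt_trans (probability_le1 _ _)) ?ltry.
by exists 1; split => // M M1 w _; exact: (le_trans (f1 w) (ltW M1)).
Qed.

Section bounded_measurable.
Context {dS : measure_display} {S : measurableType dS} {R : realType}.
Implicit Types f g h u : S -> R.

Definition bmeas f := measurable_fun setT f /\ exists M, forall x, `|f x| <= M.

Lemma bmeas_cst r : bmeas (fun=> r).
Proof. by split; [exact: measurable_cst|exists `|r|]. Qed.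

Lemma bmeasM f g : bmeas f -> bmeas g -> bmeas (fun x => f x * g x).
Proof.
move=> [mf [M fM]] [mg [N gN]]; split; first exact: measurable_funM.
by exists (M * N) => x; rewrite normrM ler_pM.
Qed.

Lemma bmeasD f g : bmeas f -> bmeas g -> bmeas (fun x => f x + g x).
Proof.
move=> [mf [M fM]] [mg [N gN]]; split; first exact: measurable_funD.
by exists (M + N) => x; rewrite (le_trans (ler_normD _ _))// lerD.
Qed.

Lemma bmeas_cos f : measurable_fun setT f -> bmeas (fun x => cos (f x)).
Proof.
move=> mf; split; last by exists 1 => x; exact: cos_max.
exact: (measurableT_comp (@measurable_cos R) mf).
Qed.

Lemma bmeas_indic (B : set S) : measurable B -> bmeas (\1_B).
Proof.
move=> mB; split; first exact: measurable_indic.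
by exists 1 => x; rewrite indicE; case: (_ \in _); rewrite ?normr1 ?normr0.
Qed.

Lemma bmeas_cvg (h : nat -> S -> R) f M :
  (forall n, bmeas (h n)) -> (forall n x, `|h n x| <= M) ->
  (forall x, h ^~ x @ \oo --> f x) -> bmeas f.
Proof.
move=> mh hM hf; split.
  by apply: (measurable_fun_cvg (h := h)) => [n|x _]; [have [] := mh n|exact: hf].
exists M => x; have hnf : `|h n x| @[n --> \oo] --> `|f x| by exact: cvg_norm.
have cvgn_h : cvgn (fun n => `|h n x|) by apply/cvg_ex; exists `|f x|.
rewrite -(cvg_lim _ hnf)//; apply: limr_le => //.
by near=> n; exact: hM.
Unshelve. all: by end_near. Qed.

Section weighted_integral.
Context {d : measure_display} {E : measurableType d}.
Variables (k : {measure set E -> \bar R}) (F : E -> S) (w : E -> R).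
Hypotheses (mF : measurable_fun setT F) (iw : k.-integrable setT (EFin \o w)).

(** The integral of [h] against the image under [F] of [w dk]. Only the weight is integrable, so one
    argument covers probabilities, with [w = 1], and infinite measures, with [w = 1 - cos l0]. *)
Definition wint h : R := \int[k]_x (h (F x) * w x).

Lemma wint_integrable h : bmeas h ->
  k.-integrable setT (EFin \o (fun x => h (F x) * w x)).
Proof.
move=> [mh [M hM]].
rewrite (_ : EFin \o _ = ((EFin \o (h \o F)) \* (EFin \o w))%E)//.
apply: integrableMr => //; first exact: measurableT_comp.
exists M; split; first exact: num_real.
by move=> N MN x _ /=; exact: (le_trans (hM _) (ltW MN)).
Qed.

Lemma wintZ a f : bmeas f -> wint (fun x => a * f x) = a * wint f.
Proof.
move=> bf; rewrite /wint; under eq_Rintegral do rewrite -mulrA.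
by rewrite RintegralZl//; exact: wint_integrable.
Qed.

Lemma wintD f g : bmeas f -> bmeas g ->
  wint (fun x => f x + g x) = wint f + wint g.
Proof.
move=> bf bg; rewrite /wint; under eq_Rintegral do rewrite mulrDl.
by rewrite RintegralD//; exact: wint_integrable.
Qed.

Lemma wint_cvg (h : nat -> S -> R) f M :
  (forall n, bmeas (h n)) -> (forall n x, `|h n x| <= M) ->
  (forall x, h ^~ x @ \oo --> f x) -> wint (h n) @[n --> \oo] --> wint f.
Proof.
move=> mh hM hf; have bf := bmeas_cvg mh hM hf.
have iM : k.-integrable setT (fun x => (M * `|w x|)%:E).
  have -> : (fun x => (M * `|w x|)%:E) = (fun x => M%:E * (EFin \o (Num.norm \o w)) x)%E.
    by [].
  by apply: integrableZl => //; exact: integrable_norm.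
have [|||//|_ _] := @dominated_convergence _ _ _ k setT measurableT
  (fun n x => (h n (F x) * w x)%:E) (fun x => (f (F x) * w x)%:E) _ _ _ _ iM.
- by move=> n; have /integrableP[] := wint_integrable (mh n).
- by have /integrableP[] := wint_integrable bf.
- apply: aeW => x _; apply: cvg_EFin; first exact: nearW.
  by apply: cvgM; [exact: hf|exact: cvg_cst].
- apply: aeW => x n _; rewrite lee_fin normrM ler_wpM2r//.
- move=> cv; apply: fine_cvg.
  rewrite fineK; first exact: cv.
  exact: integrable_fin_num (wint_integrable bf).
Qed.

End weighted_integral.
End bounded_measurable.

(** * A polynomial step function *)

Section sharpening.
Context {R : realType}.
Implicit Types a y : R.

Lemma bernoulli_ineq a n : -1 <= a -> 1 + n%:R * a <= (1 + a) ^+ n.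
Proof.
move=> a1; elim: n => [|n IH]; first by rewrite mul0r addr0 expr0.
rewrite exprS; have a0 : 0 <= 1 + a by lra.
apply: (le_trans _ (ler_wpM2l a0 IH)).
have n0 : 0 <= n%:R * a ^+ 2 by rewrite mulr_ge0// sqr_ge0.
rewrite -natr1; lra.
Qed.

Lemma cvg_natr_expr y : 0 <= y < 1 -> n%:R * y ^+ n @[n --> \oo] --> (0 : R).
Proof.
(* Since [y <= w^2] by the inequality of means, [n y^n <= (n w^n) w^n]: the first factor is bounded
   by Bernoulli and the second vanishes. *)
move=> /andP[y0 y1]; pose w := (1 + y) / 2.
have w0 : 0 < w by rewrite /w; lra.
have w1 : w < 1 by rewrite /w; lra.
have yw : y <= w * w by rewrite /w; nra.
pose C := (w^-1 - 1)^-1.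
have h0 : 0 < w^-1 - 1 by rewrite subr_gt0 invf_gt1.
have nw n : n%:R * w ^+ n <= C.
  have := @bernoulli_ineq (w^-1 - 1) n.
  rewrite [1 + (w^-1 - 1)]addrC subrK exprVn => /(_ ltac:(lra)) H.
  rewrite -ler_pdivlMr ?exprn_gt0// /C mulrC ler_pdivlMr//; lra.
apply: (@squeeze_cvgr _ _ _ _ (cst 0) (fun n => C * w ^+ n)).
- near=> n; rewrite mulr_ge0 ?exprn_ge0//=.
  rewrite (@le_trans _ _ ((n%:R * w ^+ n) * w ^+ n))//.
    by rewrite -mulrA -exprMn ler_wpM2l// lerXn2r ?nnegrE// mulr_ge0// ltW.
  by rewrite ler_wpM2r// exprn_ge0// ltW.
- exact: cvg_cst.
- rewrite -[0 in X in _ --> X](mulr0 C); apply: cvgM; first exact: cvg_cst.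
  by apply: cvg_expr; rewrite ger0_norm// ltW.
Unshelve. all: by end_near. Qed.

(** A step at [1/2] of the kind used in elementary proofs of the Stone-Weierstrass theorem: [y^n] is
    measured against [2^-n]. The factor [n] in the exponent forces the limit [0] at [y = 1/2]
    itself, where [(1 - 2^-n)^(2^n)] would tend to [1/e]. *)
Definition sharpen n y : R := (1 - y ^+ n) ^+ (n * 2 ^ n).

Lemma sharpen_itv n y : 0 <= y <= 1 -> 0 <= sharpen n y <= 1.
Proof.
move=> /andP[y0 y1]; have yn0 : 0 <= y ^+ n by rewrite exprn_ge0.
have yn1 : y ^+ n <= 1 by rewrite exprn_ile1.
by rewrite exprn_ge0 ?exprn_ile1; lra.
Qed.

Lemma cvg_sharpen y : 0 <= y <= 1 ->
  sharpen n y @[n --> \oo] --> ((y < 2^-1)%R%:R : R).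
Proof.
move=> y01; have /andP[y0 y1] := y01; have [y2|y2] := ltP y 2^-1.
- apply: (@squeeze_cvgr _ _ _ _ (fun n => 1 - n%:R * (2 * y) ^+ n) (cst 1)).
  + near=> n; have /andP[_ ->] := sharpen_itv n y01; rewrite andbT.
    have yn1 : y ^+ n <= 1 by rewrite exprn_ile1.
    have := @bernoulli_ineq (- y ^+ n) (n * 2 ^ n).
    by rewrite lerN2 => /(_ yn1); rewrite mulrN natrM natrX exprMn mulrA.
  + rewrite -[1 in X in _ --> X]subr0; apply: cvgB; first exact: cvg_cst.
    by apply: cvg_natr_expr; lra.
  + exact: cvg_cst.
- have y21 : 1 <= 2 * y by lra.
  apply: (@squeeze_cvgr _ _ _ _ (cst 0) (@harmonic R)); last 2 first.
  + exact: cvg_cst.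
  + exact: cvg_harmonic.
  near=> n; have /andP[-> _] /= := sharpen_itv n y01.
  (* [(1 - a)^N (1 + a)^N <= 1] while [(1 + a)^N >= 1 + N a >= n + 1], so the value is at most
     [1 / (n + 1)]. *)
  set a := y ^+ n; set N := (n * 2 ^ n)%N.
  have a0 : 0 <= a by rewrite exprn_ge0.
  have a1 : a <= 1 by rewrite exprn_ile1.
  have Na : n%:R <= N%:R * a.
    by rewrite /N natrM natrX -mulrA -exprMn ler_peMr// exprn_ege1.
  have B : n.+1%:R <= (1 + a) ^+ N.
    rewrite -natr1 addrC; apply: (@le_trans _ _ (1 + N%:R * a)).
      by rewrite lerD2l.
    by apply: bernoulli_ineq; apply: le_trans a0; rewrite oppr_le0.
  have B0 : 0 < (1 + a) ^+ N by apply: lt_le_trans B.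
  apply: (@le_trans _ _ ((1 + a) ^+ N)^-1); last first.
    by rewrite lef_pV2 ?posrE.
  have a10 : 0 <= 1 - a by rewrite subr_ge0.
  rewrite -[leRHS]mul1r ler_pdivlMr// -exprMn exprn_ile1//.
    by rewrite mulr_ge0// addr_ge0.
  by rewrite -subr_sqr expr1n gerBl sqr_ge0.
Unshelve. all: by end_near. Qed.

End sharpening.

(** * From trigonometric functions to indicators of half-spaces *)

Section trigonometric_uniqueness.
Context {dS : measure_display} {S : measurableType dS} {R : realType}.
Context {d1 : measure_display} {E1 : measurableType d1}.
Context {d2 : measure_display} {E2 : measurableType d2}.
Variables (k1 : {measure set E1 -> \bar R}) (F1 : E1 -> S) (w1 : E1 -> R).
Variables (k2 : {measure set E2 -> \bar R}) (F2 : E2 -> S) (w2 : E2 -> R).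
Hypotheses (mF1 : measurable_fun setT F1) (mF2 : measurable_fun setT F2).
Hypotheses (iw1 : k1.-integrable setT (EFin \o w1)).
Hypotheses (iw2 : k2.-integrable setT (EFin \o w2)).
Variable L : set (S -> R).
Hypothesis mL : forall l, L l -> measurable_fun setT l.
Hypothesis LD : forall l l', L l -> L l' -> L (fun x => l x + l' x).
Hypothesis LZ : forall a l, L l -> L (fun x => a * l x).
Hypothesis L0 : exists l, L l.

Let J1 := wint k1 F1 w1.
Let J2 := wint k2 F2 w2.

Hypothesis eq_char : forall l c, L l ->
  J1 (fun x => cos (l x + c)) = J2 (fun x => cos (l x + c)).

(** Equality of two integrals does not survive products, so it is demanded of [f] times every
    trigonometric function; the phase [c] brings in the sines. *)
Let matching (f : S -> R) := bmeas f /\ forall l c, L l ->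
  J1 (fun x => f x * cos (l x + c)) = J2 (fun x => f x * cos (l x + c)).

Let bcos l c : L l -> bmeas (fun x => cos (l x + c)).
Proof. by move=> Ll; apply: bmeas_cos; apply: measurable_funD => //; exact: mL. Qed.

(* Multipliers of matching functions form an algebra that contains the
   trigonometric functions and is closed under bounded pointwise limits. *)
Definition multiplier (u : S -> R) := bmeas u /\
  forall f, matching f -> matching (fun x => f x * u x).

Let matchingM_closed u v f : multiplier u -> multiplier v ->
  matching f -> matching (fun x => f x * u x * v x).
Proof. by move=> [_ hu] [_ hv] mf; exact/hv/hu. Qed.

Let matching1 : matching (fun=> 1).
Proof.
split; first exact: bmeas_cst.
by move=> l c Ll; under eq_fun do rewrite mul1r; exact: eq_char.
Qed.

Lemma multiplier_cst r : multiplier (fun=> r).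
Proof.
split; first exact: bmeas_cst.
move=> f [bf hf]; split; first exact: (bmeasM bf (bmeas_cst r)).
move=> l c Ll; have -> : (fun x => f x * r * cos (l x + c)) =
    (fun x => r * (f x * cos (l x + c))) by apply/funext => x; ring.
have b : bmeas (fun x => f x * cos (l x + c)) := bmeasM bf (bcos c Ll).
rewrite /J1 /J2 (wintZ mF1 iw1 r b) (wintZ mF2 iw2 r b).
by have := hf _ c Ll; rewrite /J1 /J2 => ->.
Qed.

Lemma multiplierD u v : multiplier u -> multiplier v ->
  multiplier (fun x => u x + v x).
Proof.
move=> [bu hu] [bv hv]; split; first exact: bmeasD.
move=> f mf; have [bf _] := mf; split; first exact: (bmeasM bf (bmeasD bu bv)).
move=> l c Ll; have -> : (fun x => f x * (u x + v x) * cos (l x + c)) =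
    (fun x => f x * u x * cos (l x + c) + f x * v x * cos (l x + c)).
  by apply/funext => x; ring.
have [bfu hfu] := hu _ mf; have [bfv hfv] := hv _ mf.
have b1 := bmeasM bfu (bcos c Ll); have b2 := bmeasM bfv (bcos c Ll).
rewrite /J1 /J2 (wintD mF1 iw1 b1 b2) (wintD mF2 iw2 b1 b2).
by have := (hfu _ c Ll, hfv _ c Ll); rewrite /J1 /J2 => -[-> ->].
Qed.

Lemma multiplierM u v : multiplier u -> multiplier v ->
  multiplier (fun x => u x * v x).
Proof.
move=> mu mv; split; first by apply: bmeasM; [have [] := mu|have [] := mv].
move=> f mf; rewrite (_ : (fun _ => _) = (fun x => f x * u x * v x)).
  exact: matchingM_closed.
by apply/funext => x; rewrite mulrA.
Qed.

Lemma multiplierX u n : multiplier u -> multiplier (fun x => u x ^+ n).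
Proof.
move=> mu; elim: n => [|n IH].
  by under eq_fun do rewrite expr0; exact: multiplier_cst.
by under eq_fun do rewrite exprS; exact: multiplierM.
Qed.

Lemma multiplierB u v : multiplier u -> multiplier v ->
  multiplier (fun x => u x - v x).
Proof.
move=> mu mv; under eq_fun do rewrite -mulN1r.
by apply: multiplierD => //; apply: multiplierM => //; exact: multiplier_cst.
Qed.

Lemma multiplier_sum n (u : nat -> S -> R) : (forall i, multiplier (u i)) ->
  multiplier (fun x => \sum_(i < n) u i x).
Proof.
move=> mu; elim: n => [|n IH].
  by under eq_fun do rewrite big_ord0; exact: multiplier_cst.
by under eq_fun do rewrite big_ord_recr; exact: multiplierD.
Qed.

Lemma multiplier_cvg (u : nat -> S -> R) v M : (forall n, multiplier (u n)) ->
  (forall n x, `|u n x| <= M) -> (forall x, u ^~ x @ \oo --> v x) ->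
  multiplier v.
Proof.
move=> mu uM uv; have bu n : bmeas (u n) by have [] := mu n.
have bv := bmeas_cvg bu uM uv; split => // f mf.
have bf : bmeas f by have [] := mf.
split; first exact: bmeasM.
move=> l c Ll; have bc := bcos c Ll.
pose h n x := f x * u n x * cos (l x + c).
have bh n : bmeas (h n) by apply: (bmeasM (bmeasM bf (bu n)) bc).
have [N fN] : exists N, forall x, `|f x| <= N by have [] := bf.
have hM n x : `|h n x| <= N * M * 1.
  by rewrite /h !normrM ler_pM ?mulr_ge0 ?cos_max// ler_pM.
have hh x : h ^~ x @ \oo --> f x * v x * cos (l x + c).
  apply: cvgM; last exact: cvg_cst.
  by apply: cvgM; [exact: cvg_cst|exact: uv].
have c1 := wint_cvg mF1 iw1 bh hM hh; have c2 := wint_cvg mF2 iw2 bh hM hh.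
suff E : (fun n => wint k1 F1 w1 (h n)) = (fun n => wint k2 F2 w2 (h n)).
  by rewrite /J1 /J2 -(cvg_lim _ c1)// -(cvg_lim _ c2)// E.
by apply/funext => n; have [_ H] := mu n; have [_] := H _ mf; exact.
Qed.

(** A product of two cosines is half a sum of two cosines, whose arguments stay in the family
    because [L] is closed under sums and differences. *)
Lemma multiplier_cos l c : L l -> multiplier (fun x => cos (l x + c)).
Proof.
move=> Ll; split; first exact: bcos.
move=> f [bf hf]; split; first exact: (bmeasM bf (bcos c Ll)).
move=> l' c' Ll'.
have Lp : L (fun x => l x + l' x) by exact: LD.
have Lm : L (fun x => l x + -1 * l' x) by apply: LD => //; exact: LZ.
pose g1 x := 2^-1 * (f x * cos ((l x + l' x) + (c + c'))).
pose g2 x := 2^-1 * (f x * cos ((l x + -1 * l' x) + (c - c'))).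
have -> : (fun x => f x * cos (l x + c) * cos (l' x + c')) =
    (fun x => g1 x + g2 x).
  apply/funext => x; rewrite /g1 /g2.
  rewrite (_ : (l x + l' x) + (c + c') = (l x + c) + (l' x + c')); last by ring.
  rewrite (_ : (l x + -1 * l' x) + (c - c') = (l x + c) - (l' x + c')); last by ring.
  by move: (l x + c) (l' x + c') => a b; rewrite cosD cosB; field.
have b1 : bmeas (fun x => f x * cos ((l x + l' x) + (c + c'))).
  by apply: bmeasM => //; exact: bcos.
have b2 : bmeas (fun x => f x * cos ((l x + -1 * l' x) + (c - c'))).
  by apply: bmeasM => //; exact: (bcos _ Lm).
have bg1 : bmeas g1 by exact: (bmeasM (bmeas_cst _) b1).
have bg2 : bmeas g2 by exact: (bmeasM (bmeas_cst _) b2).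
rewrite /J1 /J2 (wintD mF1 iw1 bg1 bg2) (wintD mF2 iw2 bg1 bg2).
rewrite (wintZ mF1 iw1 _ b1) (wintZ mF1 iw1 _ b2).
rewrite (wintZ mF2 iw2 _ b1) (wintZ mF2 iw2 _ b2).
by have := (hf _ (c + c') Lp, hf _ (c - c') Lm); rewrite /J1 /J2 => -[-> ->].
Qed.

(** Each [sharpen n] is a polynomial, so it maps multipliers to multipliers; the indicator is the
    bounded limit. *)
Lemma multiplier_lt_half y : multiplier y -> (forall x, 0 <= y x <= 1) ->
  multiplier (\1_[set x | y x < 2^-1]).
Proof.
move=> my y01; apply: (@multiplier_cvg (fun n x => sharpen n (y x)) _ 1).
- move=> n; apply: multiplierX; apply: multiplierB; first exact: multiplier_cst.
  exact: multiplierX.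
- by move=> n x; rewrite ger0_norm; have /andP[] := sharpen_itv n (y01 x).
- move=> x; have := cvg_sharpen (y01 x); rewrite indicE.
  by rewrite (_ : x \in _ = (y x < 2^-1))//; apply/idP/idP; rewrite inE.
Qed.

(** Trigonometric functions are periodic, but at a fixed point the argument [(l x - c) / (n + 1)]
    eventually lies in [(-1, 1)], where the sine has the sign of its argument. *)
Lemma multiplier_gt l c : L l -> multiplier (\1_[set x | c < l x]).
Proof.
move=> Ll.
pose A (n : nat) : R := n.+1%:R^-1.
pose U n := [set x | 0 < sin ((l x - c) * A n)].
apply: (@multiplier_cvg (fun n => \1_(U n)) _ 1).
(* The shift by [pi / 2] turns the cosine into minus the sine, so positivity of the sine becomes
   [y < 1/2]. *)
- move=> n; pose y x := 2^-1 * (1 + cos (A n * l x + (pi / 2 - c * A n))).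
  have yE x : y x = 2^-1 * (1 - sin ((l x - c) * A n)).
    rewrite /y -cosDpihalf; congr (_ * (_ + cos _)); ring.
  have my : multiplier y.
    apply: multiplierM; first exact: multiplier_cst.
    apply: multiplierD; first exact: multiplier_cst.
    exact: (multiplier_cos _ (LZ _ Ll)).
  have y01 x : 0 <= y x <= 1.
    by rewrite yE; have := sin_le1 ((l x - c) * A n);
      have := sin_geN1 ((l x - c) * A n); lra.
  rewrite (_ : U n = [set x | y x < 2^-1]); first exact: multiplier_lt_half.
  by apply/seteqP; split=> x; rewrite /U /= yE => h; lra.
- by move=> n x; rewrite indicE; case: (_ \in _); rewrite ?normr1 ?normr0.
- move=> x; apply: cvg_near_cst.
  have : (l x - c) * A n @[n --> \oo] --> (l x - c) * 0.
    by apply: cvgM; [exact: cvg_cst|exact: cvg_harmonic].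
  rewrite mulr0 => /cvgrPdist_lt/(_ _ ltr01) H; near=> n.
  have An : 0 < A n by rewrite /A invr_gt0.
  have : `|0 - (l x - c) * A n| < 1 by near: n; exact: H.
  rewrite sub0r normrN !indicE ltr_norml => /andP[h1 h2]; have p2 := @pi_ge2 R.
  have -> : (x \in [set x | c < l x]) = (c < l x).
    by apply/idP/idP; rewrite inE.
  have -> : (x \in U n) = (0 < sin ((l x - c) * A n)).
    by apply/idP/idP; rewrite inE.
  congr (_%:R); congr nat_of_bool; have [cl|lc] := ltP c (l x).
  + have h : 0 < (l x - c) * A n by rewrite mulr_gt0// subr_gt0.
    by rewrite sin_gt0_pi//; lra.
  + have h : (l x - c) * A n <= 0 by apply: mulr_le0_ge0; [rewrite subr_le0|exact: ltW].
    by apply/negbTE; rewrite -leNgt -oppr_ge0 -sinN sin_ge0_pi//; lra.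
Unshelve. all: by end_near. Qed.

(** Products and complements give finite unions through [1 - (1 - u) (1 - v)], and bounded limits
    give countable ones; so the class is a full sigma-algebra and not merely a Dynkin class. *)
Lemma multiplier_indic_sigma_algebra :
  sigma_algebra setT [set B : set S | measurable B /\ multiplier (\1_B)].
Proof.
split=> [|B [mB hB]|B hB] /=.
- split=> //; rewrite (_ : \1_set0 = fun=> 0); first exact: multiplier_cst.
  by apply/funext => x; rewrite indic0.
- split; first by rewrite setTD; exact: measurableC.
  rewrite (_ : \1__ = fun x => 1 - \1_B x).
    by apply: multiplierB => //; exact: multiplier_cst.
  by apply/funext => x; rewrite setTD indicC indicE; case: (x \in B);
    rewrite /= ?subrr ?subr0.
- split; first by apply: bigcupT_measurable => n; have [] := hB n.
  pose U n := \big[setU/set0]_(i < n) B i.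
  apply: (@multiplier_cvg (fun n => \1_(U n)) _ 1).
  + elim=> [|n IH].
      rewrite /U big_ord0 (_ : \1_set0 = fun=> 0); first exact: multiplier_cst.
      by apply/funext => x; rewrite indic0.
    rewrite /U big_ord_recr/= -/(U n).
    rewrite (_ : \1__ = fun x => 1 - (1 - \1_(U n) x) * (1 - \1_(B n) x)).
      apply: multiplierB; first exact: multiplier_cst.
      by apply: multiplierM; apply: multiplierB => //;
        [exact: multiplier_cst|exact: multiplier_cst|have [] := hB n].
    apply/funext => x; rewrite !indicE in_setU.
    by case: (x \in U n); case: (x \in B n); rewrite /= ?subrr ?subr0 ?mul0r ?mulr0 ?mulr1 ?subrr ?subr0.
  + by move=> n x; rewrite indicE; case: (_ \in _); rewrite ?normr1 ?normr0.
  + move=> x; apply: cvg_near_cst; rewrite !indicE.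
    have [[m _ Bmx]|nBx] := pselect ((\bigcup_i B i) x).
      near=> n; congr (_%:R); congr nat_of_bool.
      rewrite [in RHS]mem_set; last by exists m.
      apply/mem_set; rewrite /U -bigcup_mkord; exists m => //=.
      by near: n; exact: nbhs_infty_gt.
    near=> n; congr (_%:R); congr nat_of_bool.
    rewrite [RHS]memNset// memNset// /U -bigcup_mkord => -[i _ Bix].
    by apply: nBx; exists i.
Unshelve. all: by end_near. Qed.

Definition half_spaces := [set B : set S | exists l c, L l /\ B = [set x | c < l x]].

Lemma measurable_half_spaces B : half_spaces B -> measurable B.
Proof.
move=> [l [c [Ll ->]]]; rewrite -[X in measurable X]setTI.
rewrite (_ : [set x | _] = l @^-1` `]c, +oo[); first exact: mL.
by apply/seteqP; split => x /=; rewrite in_itv/= andbT.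
Qed.

Lemma multiplier_indic B : <<s half_spaces >> B -> multiplier (\1_B).
Proof.
move=> sB; suff [] : measurable B /\ multiplier (\1_B) by [].
apply: (@smallest_sub _ (sigma_algebra setT)
  half_spaces [set B : set S | measurable B /\ multiplier (\1_B)] _ _ B sB).
  exact: multiplier_indic_sigma_algebra.
move=> C [l [c [Ll CE]]]; split; first by apply: measurable_half_spaces; exists l, c.
by rewrite CE; exact: multiplier_gt.
Qed.

(** The constant [1] is matching; multiplied by [u] and tested against the null form [0 * l], whose
    cosine is [1], it leaves the integral of [u]. *)
Lemma multiplier_wint u : multiplier u -> J1 u = J2 u.
Proof.
move=> [_ hu]; have [_ h] := hu _ matching1.
have [l Ll] := L0; have := h _ 0 (LZ 0 Ll).
rewrite (_ : (fun _ => _) = u)//; apply/funext => x.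
by rewrite mul0r addr0 cos0 mulr1 mul1r.
Qed.

End trigonometric_uniqueness.

Section characteristic_corollaries.
Context {dS : measure_display} {S : measurableType dS} {R : realType}.
Context {d1 : measure_display} {E1 : measurableType d1}.
Context {d2 : measure_display} {E2 : measurableType d2}.
Variables (F1 : E1 -> S) (F2 : E2 -> S).
Hypotheses (mF1 : measurable_fun setT F1) (mF2 : measurable_fun setT F2).
Variable L : set (S -> R).
Hypothesis mL : forall l, L l -> measurable_fun setT l.
Hypothesis LD : forall l l', L l -> L l' -> L (fun x => l x + l' x).
Hypothesis LZ : forall a l, L l -> L (fun x => a * l x).

Lemma eq_cos_probability (P1 : probability E1 R) (P2 : probability E2 R) B :
  (exists l, L l) ->
  (forall l c, L l ->
    \int[P1]_x cos (l (F1 x) + c) = \int[P2]_x cos (l (F2 x) + c)) ->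
  <<s half_spaces L >> B -> P1 (F1 @^-1` B) = P2 (F2 @^-1` B).
Proof.
move=> L0 hcos sB.
have i1 d (E : measurableType d) (P : probability E R) :
    P.-integrable setT (EFin \o (fun=> 1)).
  exact: finite_measure_integrable_cst.
have hw l c : L l -> wint P1 F1 (fun=> 1) (fun x => cos (l x + c)) =
    wint P2 F2 (fun=> 1) (fun x => cos (l x + c)).
  move=> Ll; rewrite /wint; under eq_Rintegral do rewrite mulr1.
  by under [RHS]eq_Rintegral do rewrite mulr1; exact: hcos.
have mB : measurable B.
  apply: (smallest_sub _ _ sB); first exact: sigma_algebra_measurable.
  by move=> C; exact: measurable_half_spaces.
have := multiplier_wint LZ L0 hw
  (multiplier_indic mF1 mF2 (i1 _ _ P1) (i1 _ _ P2) mL LD LZ sB).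
have H d (E : measurableType d) (P : probability E R) F : measurable_fun setT F ->
    wint P F (fun=> 1) (\1_B) = fine (P (F @^-1` B)).
  move=> mF; have mFB : measurable (F @^-1` B).
    by rewrite -[_ @^-1` _]setTI; exact: mF.
  rewrite /wint /Rintegral -[F @^-1` B]setIT -integral_indic//; congr fine.
  by apply: eq_integral => x _; rewrite mulr1 /= !indicE.
rewrite (H _ _ P1 _ mF1) (H _ _ P2 _ mF2) => h; have := congr1 EFin h.
by rewrite !fineK//; apply: fin_num_measure; rewrite -[_ @^-1` _]setTI;
  [exact: mF2|exact: mF1].
Qed.

Variables (k1 : {measure set E1 -> \bar R}) (k2 : {measure set E2 -> \bar R}).
Variable l0 : S -> R.
Hypothesis Ll0 : L l0.
Let theta x : R := 2^-1 * (1 - cos (l0 x)).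
Hypothesis iw1 : k1.-integrable setT (fun x => (1 - cos (l0 (F1 x)))%:E).
Hypothesis iw2 : k2.-integrable setT (fun x => (1 - cos (l0 (F2 x)))%:E).

Let theta_itv x : 0 <= theta x <= 1.
Proof. by rewrite /theta; have := cos_max (l0 x); rewrite ler_norml; lra. Qed.

Let damp (n : nat) x : R := 1 - (1 - theta x) ^+ n.

Let damp_itv n x : 0 <= damp n x <= 1.
Proof.
have /andP[t0 t1] := theta_itv x.
have h0 : 0 <= (1 - theta x) ^+ n by rewrite exprn_ge0// subr_ge0.
have h1 : (1 - theta x) ^+ n <= 1 by rewrite exprn_ile1; lra.
by rewrite /damp; lra.
Qed.

Let bmeas_damp n : bmeas (damp n).
Proof.
have mt : measurable_fun setT theta.
  apply: measurable_funM => //; apply: measurable_funB => //.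
  by have [] := bmeas_cos (mL Ll0).
split; last by exists 1 => x; rewrite ger0_norm; have /andP[] := damp_itv n x.
apply: measurable_funB => //; apply: measurable_funX; exact: measurable_funB.
Qed.

(* [1 - cos l0 = 2 theta] and [2 theta * (sum_(i < n) (1 - theta)^i) / 2]
   increases to the indicator of [theta > 0]. *)
Lemma eq_cos_weighted B :
  (forall l c, L l ->
    \int[k1]_x (cos (l (F1 x) + c) * (1 - cos (l0 (F1 x)))) =
    \int[k2]_x (cos (l (F2 x) + c) * (1 - cos (l0 (F2 x))))) ->
  <<s half_spaces L >> B ->
  k1 (F1 @^-1` (B `&` [set x | cos (l0 x) != 1])) =
  k2 (F2 @^-1` (B `&` [set x | cos (l0 x) != 1])).
Proof.
move=> hcos sB; set B' := _ `&` _.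
have mB : measurable B.
  apply: (smallest_sub _ _ sB); first exact: sigma_algebra_measurable.
  by move=> C; exact: measurable_half_spaces.
have mB' : measurable B'.
  apply: measurableI => //; rewrite -[X in measurable X]setTI.
  rewrite (_ : [set x | _] = (fun x => cos (l0 x)) @^-1` (~` [set 1])).
    by have [mc _] := bmeas_cos (mL Ll0); apply: mc => //; exact: measurableC.
  by apply/seteqP; split=> x /= /eqP.
have mB1 := multiplier_indic mF1 mF2 iw1 iw2 mL LD LZ sB.
pose u n x := \1_B x * (2^-1 * \sum_(i < n) (1 - theta x) ^+ i).
have mu n : multiplier k1 F1 (fun x => 1 - cos (l0 (F1 x)))
                       k2 F2 (fun x => 1 - cos (l0 (F2 x))) L (u n).
  apply: multiplierM => //.
  apply: multiplierM => //; first exact: multiplier_cst.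
  apply: (@multiplier_sum _ _ _ _ _ _ _ _ _ _ _ _ _ mF1 mF2 iw1 iw2 _ mL n
    (fun i x => (1 - theta x) ^+ i)) => // i.
  apply: multiplierX => //.
  apply: multiplierB => //; first exact: multiplier_cst.
  apply: multiplierM => //; first exact: multiplier_cst.
  apply: multiplierB => //; first exact: multiplier_cst.
  rewrite (_ : (fun _ => _) = fun x => cos (l0 x + 0)).
    exact: multiplier_cos.
  by apply/funext => x; rewrite addr0.
have uE n x : u n x * (1 - cos (l0 x)) = \1_B x * damp n x.
  rewrite /u /damp -mulrA; congr (_ * _).
  have -> : 1 - cos (l0 x) = 2 * theta x by rewrite /theta; field.
  have := subrX1 (1 - theta x) n; set Y := (1 - theta x) ^+ n => YE.
  have -> : 1 - Y = theta x * \sum_(i < n) (1 - theta x) ^+ i.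
    by rewrite -opprB YE; ring.
  by field.
have E n : (\int[k1]_x (\1_B (F1 x) * damp n (F1 x))%:E =
            \int[k2]_x (\1_B (F2 x) * damp n (F2 x))%:E)%E.
  have := multiplier_wint LZ (ex_intro _ _ Ll0) hcos (mu n).
  have H d (E : measurableType d) (k : {measure set E -> \bar R}) F :
      measurable_fun setT F ->
      k.-integrable setT (fun x => (1 - cos (l0 (F x)))%:E) ->
      (wint k F (fun x => 1 - cos (l0 (F x))) (u n))%:E =
      (\int[k]_x (\1_B (F x) * damp n (F x))%:E)%E.
    move=> mF iw; have [bu _] := mu n; have iu := wint_integrable mF iw bu.
    rewrite /wint /Rintegral fineK; last exact: integrable_fin_num.
    by apply: eq_integral => x _; rewrite uE.
  move=> h; have := congr1 EFin h.
  by rewrite (H _ _ k1 _ mF1 iw1) (H _ _ k2 _ mF2 iw2).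
have cvgk d (E' : measurableType d) (k : {measure set E' -> \bar R}) F :
    measurable_fun setT F ->
    (\int[k]_x (\1_B (F x) * damp n (F x))%:E @[n --> \oo] --> k (F @^-1` B'))%E.
  move=> mF.
  have mF' C : measurable C -> measurable (F @^-1` C).
    by move=> mC; rewrite -[_ @^-1` _]setTI; exact: mF.
  have <- : (\int[k]_x (\1_B' (F x))%:E)%E = k (F @^-1` B').
    rewrite -[F @^-1` B']setIT -integral_indic//; first exact: mF'.
  have -> : (\int[k]_x (\1_B' (F x))%:E)%E =
      (\int[k]_x (limn (fun n => (\1_B (F x) * damp n (F x))%:E)))%E.
    apply: eq_integral => x _; apply/esym/cvg_lim => //.
    apply: cvg_EFin; first exact: nearW.
    rewrite indicI; apply: cvgM; first exact: cvg_cst.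
    rewrite indicE; have [t0|t0] := eqVneq (cos (l0 (F x))) 1.
      rewrite memNset; last by rewrite /= t0 eqxx.
      by rewrite /damp /theta t0; under eq_fun do rewrite subrr mulr0 subr0 expr1n subrr; exact: cvg_cst.
    rewrite mem_set// -[1%:R in X in _ --> X]subr0.
    apply: cvgB; first exact: cvg_cst.
    apply: cvg_expr; have /andP[h0 h1] := theta_itv (F x).
    rewrite ger0_norm ?subr_ge0// ltrBlDr ltrDl lt_neqAle h0 andbT eq_sym.
    by rewrite /theta mulf_neq0// subr_eq0 eq_sym.
  (* The limit may be infinite, hence monotone rather than dominated convergence. *)
  apply: cvg_monotone_convergence => //.
  - move=> n; apply/measurable_EFinP.
    have [m1 _] := bmeasM (bmeas_indic mB) (bmeas_damp n).
    exact: (measurableT_comp m1 mF).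
  - move=> n x _; rewrite lee_fin mulr_ge0 ?indicE//.
    by have /andP[] := damp_itv n (F x).
  - move=> x _ m n mn; rewrite lee_fin ler_wpM2l// lerD2l lerN2.
    by have /andP[t0 t1] := theta_itv (F x); apply: ler_wiXn2l => //; lra.
have c1 := cvgk _ _ k1 _ mF1; have c2 := cvgk _ _ k2 _ mF2.
by rewrite -(cvg_lim _ c1)// -(cvg_lim _ c2)//; under eq_fun do rewrite E.
Qed.

End characteristic_corollaries.

(** * Characteristic functions of compensated Poisson integrals *)

Section poisson_series.
Context {R : realType}.
Implicit Types a b c x : R.

(** The number [e^(i a)]. Complex numbers enter only algebraically, to multiply characteristic
    functions of independent counts; limits and integrals are taken by components. *)
Definition cis a : R[i] := Complex (cos a) (sin a).

Lemma cis0 : cis 0 = 1.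
Proof. by rewrite /cis cos0 sin0. Qed.

Lemma cisD a b : cis (a + b) = cis a * cis b.
Proof. by rewrite /cis cosD sinD; congr Complex; ring. Qed.

Lemma cis_sum (I : Type) (r : seq I) (f : I -> R) :
  cis (\sum_(i <- r) f i) = \prod_(i <- r) cis (f i).
Proof. exact: (big_morph cis cisD cis0). Qed.

Lemma is_derive_egf_cos c x :
  is_derive x (1 : R) (egf (fun n => cos (n%:R * c)))
    (cos c * egf (fun n => cos (n%:R * c)) x -
     sin c * egf (fun n => sin (n%:R * c)) x).
Proof.
have b1 n : `|cos (n%:R * c)| <= 1 * 1 ^+ n by rewrite expr1n mulr1 cos_max.
have b2 n : `|sin (n%:R * c)| <= 1 * 1 ^+ n by rewrite expr1n mulr1 sin_max.
have H := is_derive_egf x b1; apply: is_derive_eq.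
pose b (i : bool) (n : nat) : R := if i then cos (n%:R * c) else sin (n%:R * c).
have bb i n : `|b i n| <= 1 * 1 ^+ n.
  by case: i; [exact: b1|exact: b2].
pose e (i : bool) : R := if i then cos c else - sin c.
transitivity (\sum_(i <- [:: true; false]) e i * egf (b i) x); last first.
  by rewrite !big_cons big_nil addr0 /e mulNr.
rewrite -(egf_sum _ _ _ bb); congr (egf _ x); apply/funext => n.
rewrite !big_cons big_nil /b /e -natr1 mulrDl mul1r.
by rewrite cosD; ring.
Qed.

Lemma is_derive_egf_sin c x :
  is_derive x (1 : R) (egf (fun n => sin (n%:R * c)))
    (sin c * egf (fun n => cos (n%:R * c)) x +
     cos c * egf (fun n => sin (n%:R * c)) x).
Proof.
have b1 n : `|cos (n%:R * c)| <= 1 * 1 ^+ n by rewrite expr1n mulr1 cos_max.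
have b2 n : `|sin (n%:R * c)| <= 1 * 1 ^+ n by rewrite expr1n mulr1 sin_max.
have H := is_derive_egf x b2; apply: is_derive_eq.
pose b (i : bool) (n : nat) : R := if i then cos (n%:R * c) else sin (n%:R * c).
have bb i n : `|b i n| <= 1 * 1 ^+ n.
  by case: i; [exact: b1|exact: b2].
pose e (i : bool) : R := if i then sin c else cos c.
transitivity (\sum_(i <- [:: true; false]) e i * egf (b i) x); last first.
  by rewrite !big_cons big_nil addr0 /e.
rewrite -(egf_sum _ _ _ bb); congr (egf _ x); apply/funext => n.
rewrite !big_cons big_nil /b /e -natr1 mulrDl mul1r.
by rewrite sinD; ring.
Qed.

(* The two exponential series, damped and rotated back, have zero derivative. *)
Lemma egf_cos_sin c x :
  egf (fun n => cos (n%:R * c)) x = expR (x * cos c) * cos (x * sin c) /\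
  egf (fun n => sin (n%:R * c)) x = expR (x * cos c) * sin (x * sin c).
Proof.
pose u := egf (fun n => cos (n%:R * c)); pose v := egf (fun n => sin (n%:R * c)).
pose E y := expR (- cos c * y); pose C y := cos (sin c * y); pose S y := sin (sin c * y).
(* [p + i q] is [exp (- y e^(i c)) (u + i v)], with [u + i v] the series to be summed. *)
pose p y := E y * (u y * C y + v y * S y).
pose q y := E y * (v y * C y - u y * S y).
have Dlin a y : is_derive y (1 : R) (fun z => a * z) a.
  by have := @is_deriveZ _ _ _ (fun z : R => z) a y 1 1 (is_derive_id _ _);
    rewrite [X in is_derive _ _ _ X]mulr1.
have DE y : is_derive y (1 : R) E (E y * - cos c).
  exact: (@is_derive1_comp _ expR (fun z => - cos c * z) y _ _ (is_derive_expR _) (Dlin _ y)).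
have DC y : is_derive y (1 : R) C (- S y * sin c).
  exact: (@is_derive1_comp _ cos (fun z => sin c * z) y _ _ (is_derive_cos _) (Dlin _ y)).
have DS y : is_derive y (1 : R) S (C y * sin c).
  exact: (@is_derive1_comp _ sin (fun z => sin c * z) y _ _ (is_derive_sin _) (Dlin _ y)).
have Du y : is_derive y (1 : R) u (cos c * u y - sin c * v y) := is_derive_egf_cos c y.
have Dv y : is_derive y (1 : R) v (sin c * u y + cos c * v y) := is_derive_egf_sin c y.
have Dp y : is_derive y (1 : R) p 0.
  have H := is_deriveM (DE y) (is_deriveD (is_deriveM (Du y) (DC y)) (is_deriveM (Dv y) (DS y))).
  apply: (is_derive_eq H); rewrite /GRing.scale/=.
  have -> : (u * C + v * S) y = u y * C y + v y * S y by [].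
  by ring.
have Dq y : is_derive y (1 : R) q 0.
  have H := is_deriveM (DE y) (is_deriveB (is_deriveM (Dv y) (DC y)) (is_deriveM (Du y) (DS y))).
  apply: (is_derive_eq H); rewrite /GRing.scale/=.
  have -> : (v * C - u * S) y = v y * C y - u y * S y by [].
  by ring.
have p1 : p x = 1.
  rewrite (is_derive_0_is_cst x 0 Dp) /p /E /C /S /u /v !mulr0 !egf0 expR0 cos0 sin0.
  by rewrite !mul0r cos0 sin0; ring.
have q0 : q x = 0.
  rewrite (is_derive_0_is_cst x 0 Dq) /q /E /C /S /u /v !mulr0 !egf0 expR0 cos0 sin0.
  by rewrite !mul0r cos0 sin0; ring.
have CS : C x ^+ 2 + S x ^+ 2 = 1 by exact: cos2Dsin2.
have EE : expR (x * cos c) * E x = 1.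
  by rewrite /E mulNr mulrC (mulrC x) -expRD addNr expR0.
have -> : cos (x * sin c) = C x by rewrite /C mulrC.
have -> : sin (x * sin c) = S x by rewrite /S mulrC.
split.
  transitivity (expR (x * cos c) * (p x * C x - q x * S x)); last first.
    by rewrite p1 q0; ring.
  transitivity (u x * (expR (x * cos c) * E x) * (C x ^+ 2 + S x ^+ 2)).
    by rewrite EE CS !mulr1.
  by rewrite /p /q; ring.
transitivity (expR (x * cos c) * (p x * S x + q x * C x)); last first.
  by rewrite p1 q0; ring.
transitivity (v x * (expR (x * cos c) * E x) * (C x ^+ 2 + S x ^+ 2)).
  by rewrite EE CS !mulr1.
by rewrite /p /q; ring.
Qed.

End poisson_series.

Lemma Rintegral_sum_indic {d : measure_display} {T : measurableType d}
    {R : realType} (mu : {measure set T -> \bar R}) (I : Type) (r : seq I)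
    (a : I -> R) (B : I -> set T) :
  (forall i, measurable (B i)) -> (forall i, (mu (B i) < +oo)%E) ->
  mu.-integrable setT (EFin \o (fun x => \sum_(i <- r) a i * \1_(B i) x)) /\
  \int[mu]_x (\sum_(i <- r) a i * \1_(B i) x) =
    \sum_(i <- r) a i * fine (mu (B i)).
Proof.
move=> mB fB.
have iB i : mu.-integrable setT (EFin \o (\1_(B i) : T -> R)).
  apply/integrableP; split.
    by apply/measurable_EFinP; exact: measurable_indic.
  rewrite (eq_integral (fun x => (\1_(B i) x)%:E)).
    by rewrite integral_indic// setIT.
  by move=> x _; rewrite gee0_abs// lee_fin.
have iaB i : mu.-integrable setT (EFin \o (fun x => a i * (\1_(B i) x : R))).
  rewrite (_ : EFin \o _ = (fun x => (a i)%:E * (EFin \o (\1_(B i) : T -> R)) x)%E)//.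
  exact: integrableZl.
elim: r => [|i r [IHi IH]].
  have E : EFin \o (fun x => \sum_(i <- [::]) a i * \1_(B i) x) = cst 0%E :> (T -> \bar R).
    by apply/funext => x; rewrite /= big_nil.
  rewrite E; split; first exact: integrable0.
  rewrite big_nil /Rintegral; under eq_integral do rewrite big_nil.
  by rewrite integral0.
have E : EFin \o (fun x => \sum_(j <- i :: r) a j * \1_(B j) x) =
    ((EFin \o (fun x => (a i * (\1_(B i) x : R))%R)) \+
     (EFin \o (fun x => (\sum_(j <- r) a j * \1_(B j) x)%R)))%E.
  by apply/funext => x; rewrite /= big_cons EFinD.
split; first by rewrite E; exact: integrableD.
under eq_Rintegral do rewrite big_cons.
rewrite RintegralD// IH big_cons RintegralZl//; congr (_ * _ + _).
by rewrite /Rintegral integral_indic// setIT.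
Qed.

Section complex_limits.
Context {R : realType}.

Definition ccvg (z : nat -> R[i]) (l : R[i]) :=
  complex.Re (z n) @[n --> \oo] --> complex.Re l /\
  complex.Im (z n) @[n --> \oo] --> complex.Im l.

Lemma ccvgM z z' l l' : ccvg z l -> ccvg z' l' -> ccvg (fun n => z n * z' n) (l * l').
Proof.
have ReM (x y : R[i]) : complex.Re (x * y) =
    complex.Re x * complex.Re y - complex.Im x * complex.Im y by case: x y => a b [].
have ImM (x y : R[i]) : complex.Im (x * y) =
    complex.Re x * complex.Im y + complex.Im x * complex.Re y by case: x y => a b [].
move=> [r i] [r' i']; split.
  by rewrite ReM; under eq_fun do rewrite ReM; apply: cvgB; apply: cvgM.
by rewrite ImM; under eq_fun do rewrite ImM; apply: cvgD; apply: cvgM.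
Qed.

Lemma ccvg_prod (I : Type) (r : seq I) (z : I -> nat -> R[i]) l :
  (forall i, ccvg (z i) (l i)) ->
  ccvg (fun n => \prod_(i <- r) z i n) (\prod_(i <- r) l i).
Proof.
move=> zl; elim: r => [|i r IH].
  by rewrite big_nil; under eq_fun do rewrite big_nil; split; exact: cvg_cst.
by rewrite big_cons; under eq_fun do rewrite big_cons; exact: ccvgM.
Qed.

Lemma Re_sum (I : Type) (r : seq I) (z : I -> R[i]) :
  complex.Re (\sum_(i <- r) z i) = \sum_(i <- r) complex.Re (z i).
Proof. by apply: (big_morph (@complex.Re R)) => // -[a b] [a' b']. Qed.

Lemma Im_sum (I : Type) (r : seq I) (z : I -> R[i]) :
  complex.Im (\sum_(i <- r) z i) = \sum_(i <- r) complex.Im (z i).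
Proof. by apply: (big_morph (@complex.Im R)) => // -[a b] [a' b']. Qed.

End complex_limits.

(* The counts may a priori be infinite; the truncation reduces expectations to
   finite sums over [K ^ n] cells. *)
Definition prm_trunc {R : realType} {dE : measure_display}
    {E : measurableType dE} {Omega : Type}
    (N : Omega -> {measure set E -> \bar R}) n (A : 'I_n -> set E) (K : nat) :=
  [set w | forall i, exists k : 'I_K, N w (A i) = k%:R%:E].

Section poisson_joint.
Context {R : realType} {dE : measure_display} {E : measurableType dE}.
Context {d : measure_display} {Omega : measurableType d}.
Variables (P : probability Omega R) (kappa : {measure set E -> \bar R}).
Variable N : Omega -> {measure set E -> \bar R}.
Hypothesis hN : poisson_random_measure P kappa N.

Lemma prm_pmf A k : measurable A -> (kappa A < +oo)%E ->
  P [set w | N w A = k%:R%:E] =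
  (expR (- fine (kappa A)) * (k`!%:R^-1 * fine (kappa A) ^+ k))%:E.
Proof.
move=> mA fA; rewrite (prm_poisson hN)//; set l := fine _.
rewrite /poisson_prob; case: ifPn => [l0|l0].
  by rewrite esum_set1 /poisson_pmf l0 ?lee_fin ?mulr_ge0 ?exprn_ge0 ?expR_ge0 ?(ltW l0)//; congr EFin; ring.
(* Rate zero falls in the other branch of [poisson_prob], the Dirac mass at [0]; the formula agrees
   since [0 ^+ 0 = 1]. *)
have -> : l = 0 by apply/eqP; rewrite eq_le leNgt l0 fine_ge0.
rewrite oppr0 expR0 mul1r diracE; congr EFin.
case: k => [|k]; first by rewrite mem_set// fact0 invr1 expr0 mulr1.
by rewrite memNset// expr0n mulr0.
Qed.

Variables (n : nat) (A : 'I_n -> set E) (c : 'I_n -> R).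
Hypotheses (mA : forall i, measurable (A i)) (tA : trivIset setT A).
Hypothesis fA : forall i, (kappa (A i) < +oo)%E.

Let lam i := fine (kappa (A i)).
Let X w := \sum_i c i * fine (N w (A i)).
Let trunc K := prm_trunc N A K.
Let cell K (f : {ffun 'I_n -> 'I_K}) :=
  [set w | forall i, N w (A i) = (f i)%:R%:E].

Lemma measurable_prm_eq B k : measurable B ->
  measurable [set w | N w B = k%:R%:E].
Proof.
move=> mB; rewrite -[X in measurable X]setTI.
rewrite (_ : [set w | _] = (fun w => N w B) @^-1` [set k%:R%:E])//.
by apply: (prm_measurable hN) => //; exact: emeasurable_set1.
Qed.

Let measurable_cell K f : measurable (@cell K f).
Proof.
rewrite (_ : cell f = \bigcap_(i in [set: 'I_n]) [set w | N w (A i) = (f i)%:R%:E]).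
  by apply: fin_bigcap_measurable => // i _; exact: measurable_prm_eq.
by apply/seteqP; split=> [w h i _|w h i]; exact: h.
Qed.

Let pcell K f : P (@cell K f) =
  (\prod_i (expR (- lam i) * ((f i)`!%:R^-1 * lam i ^+ f i)))%:E.
Proof.
have := prm_independent hN mA tA (B := fun i => [set (f i)%:R%:E]).
rewrite /= => ->; last by move=> i; exact: emeasurable_set1.
by congr EFin; apply: eq_bigr => i _; rewrite prm_pmf.
Qed.

(** On the truncation event exactly one cell contains [w]; off it none does. *)
Let truncE K (h : R -> R) w : h (X w) * \1_(trunc K) w =
  \sum_(f : {ffun 'I_n -> 'I_K}) h (\sum_i c i * (f i)%:R) * \1_(cell f) w.
Proof.
have [Tw|nTw] := pselect (trunc K w).
  have /choice[f fE] := Tw; pose g := [ffun i => f i].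
  rewrite indicE mem_set// mulr1 (bigD1 g)//= [X in _ + X]big1 => [|j jg].
    rewrite indicE mem_set ?mulr1 ?addr0; last by move=> i; rewrite ffunE.
    by congr (h _); apply: eq_bigr => i _; rewrite fE ffunE.
  rewrite indicE memNset ?mulr0// => jw; move/eqP: jg; apply; apply/ffunP => i.
  have := jw i; rewrite fE ffunE => -[] /eqP; rewrite eqr_nat => /eqP ji.
  by apply/val_inj; rewrite /= -ji.
rewrite indicE memNset// mulr0 big1// => f _.
rewrite indicE memNset ?mulr0// => fw; apply: nTw => i.
by exists (f i); exact: fw.
Qed.

Let Z K i : R[i] := \sum_(k < K)
  real_complex R (expR (- lam i) * (k`!%:R^-1 * lam i ^+ k)) * cis (c i * k%:R).

(** Independence enters through [pcell]: distributing the product of one-variable sums produces one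
    term per cell, weighted by its probability. *)
Let prodZ K : \prod_i Z K i = \sum_(f : {ffun 'I_n -> 'I_K})
  real_complex R (fine (P (cell f))) * cis (\sum_i c i * (f i)%:R).
Proof.
rewrite /Z bigA_distr_bigA; apply: eq_bigr => f _.
by rewrite big_split/= cis_sum pcell/= rmorph_prod.
Qed.

Let trunc_int K (h : R -> R) : \int[P]_w (h (X w) * \1_(trunc K) w) =
  \sum_(f : {ffun 'I_n -> 'I_K}) h (\sum_i c i * (f i)%:R) * fine (P (cell f)).
Proof.
under eq_Rintegral do rewrite truncE.
have fcell (f : {ffun 'I_n -> 'I_K}) : (P (cell f) < +oo)%E.
  by rewrite (le_lt_trans (probability_le1 _ _)) ?ltry.
by have [_ ->] := @Rintegral_sum_indic _ _ _ P _ (index_enum _)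
  (fun f : {ffun 'I_n -> 'I_K} => h (\sum_i c i * (f i)%:R)) (@cell K)
  (@measurable_cell K) fcell.
Qed.

Let ccvgZ i : ccvg (Z^~ i)
  (real_complex R (expR (lam i * (cos (c i) - 1))) * cis (lam i * sin (c i))).
Proof.
have [E1 E2] := egf_cos_sin (c i) (lam i).
have exE : expR (lam i * (cos (c i) - 1)) = expR (- lam i) * expR (lam i * cos (c i)).
  by rewrite -expRD; congr expR; ring.
have b1 k : `|cos (k%:R * c i)| <= 1 * 1 ^+ k by rewrite expr1n mulr1 cos_max.
have b2 k : `|sin (k%:R * c i)| <= 1 * 1 ^+ k by rewrite expr1n mulr1 sin_max.
split; rewrite /= !(mul0r, subr0, addr0) exE -mulrA -?E1 -?E2.
- rewrite (_ : (fun _ => _) = (fun K => expR (- lam i) *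
      pseries (fun k => cos (k%:R * c i) / k`!%:R) (lam i) K)).
    apply: cvgM; first exact: cvg_cst.
    exact: (is_cvg_egf (x := lam i) b1).
  apply/funext => K; rewrite /Z Re_sum /pseries /series/= big_mkord mulr_sumr.
  by apply: eq_bigr => k _; rewrite /= mul0r subr0 (mulrC (c i)); ring.
- rewrite (_ : (fun _ => _) = (fun K => expR (- lam i) *
      pseries (fun k => sin (k%:R * c i) / k`!%:R) (lam i) K)).
    apply: cvgM; first exact: cvg_cst.
    exact: (is_cvg_egf (x := lam i) b2).
  apply/funext => K; rewrite /Z Im_sum /pseries /series/= big_mkord mulr_sumr.
  by apply: eq_bigr => k _; rewrite /= mul0r addr0 (mulrC (c i)); ring.
Qed.

Lemma poisson_trunc_char :
  (\int[P]_w (cos (\sum_i c i * fine (N w (A i))) * \1_(prm_trunc N A K) w))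
    @[K --> \oo] --> expR (\sum_i lam i * (cos (c i) - 1)) *
                    cos (\sum_i lam i * sin (c i)) /\
  (\int[P]_w (sin (\sum_i c i * fine (N w (A i))) * \1_(prm_trunc N A K) w))
    @[K --> \oo] --> expR (\sum_i lam i * (cos (c i) - 1)) *
                    sin (\sum_i lam i * sin (c i)).
Proof.
have := ccvg_prod (index_enum _) ccvgZ.
rewrite big_split/= -cis_sum -rmorph_prod -expR_sum => -[].
rewrite /= !(mul0r, subr0, addr0) => h1 h2; split.
- rewrite (_ : (fun _ => _) = (fun K => complex.Re (\prod_i Z K i)))//.
  apply/funext => K; rewrite (trunc_int K cos) prodZ Re_sum.
  by apply: eq_bigr => f _; rewrite /= mul0r subr0 mulrC.
- rewrite (_ : (fun _ => _) = (fun K => complex.Im (\prod_i Z K i)))//.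
  apply/funext => K; rewrite (trunc_int K sin) prodZ Im_sum.
  by apply: eq_bigr => f _; rewrite /= mul0r addr0 mulrC.
Qed.

End poisson_joint.

Section poisson_char.
Context {R : realType} {dE : measure_display} {E : measurableType dE}.
Context {d : measure_display} {Omega : measurableType d}.
Variables (P : probability Omega R) (kappa : {measure set E -> \bar R}).
Variable N : Omega -> {measure set E -> \bar R}.
Hypothesis hN : poisson_random_measure P kappa N.

Lemma measurable_prm_fine B : measurable B ->
  measurable_fun setT (fun w => fine (N w B)).
Proof.
move=> mB; apply: (measurableT_comp (@fine_measurable _ _ measurableT)).
exact: prm_measurable hN _ mB.
Qed.

Section joint.
Variables (n : nat) (A : 'I_n -> set E).
Hypotheses (mA : forall i, measurable (A i)) (tA : trivIset setT A).
Hypothesis fA : forall i, (kappa (A i) < +oo)%E.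

Lemma measurable_prm_trunc K : measurable (prm_trunc N A K).
Proof.
rewrite (_ : prm_trunc N A K = \bigcap_(i in [set: 'I_n])
    \bigcup_(k in [set: 'I_K]) [set w | N w (A i) = k%:R%:E]).
  apply: fin_bigcap_measurable => // i _; apply: fin_bigcup_measurable => // k _.
  exact (measurable_prm_eq hN _ (mA i)).
apply/seteqP; split=> [w h i _|w h i].
  by have [k ?] := h i; exists k.
by have [k _ ?] := h i Logic.I; exists k.
Qed.

(** The case of zero coefficients, where the cosine is [1]: the Poisson weights sum to one. *)
Lemma prm_trunc_cvg1 : fine (P (prm_trunc N A K)) @[K --> \oo] --> (1 : R).
Proof.
have [+ _] := poisson_trunc_char hN (fun=> 0) mA tA fA.
have z i : fine (kappa (A i)) * (cos 0 - 1) = 0 by rewrite cos0 subrr mulr0.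
have z' i : fine (kappa (A i)) * sin 0 = 0 by rewrite sin0 mulr0.
have -> : expR (\sum_i fine (kappa (A i)) * (cos 0 - 1)) *
    cos (\sum_i fine (kappa (A i)) * sin 0) = 1.
  by rewrite (eq_bigr _ (fun i _ => z i)) (eq_bigr _ (fun i _ => z' i)) !big1// expR0 cos0 mulr1.
apply: cvg_trans.
rewrite (_ : (fun _ => _) = (fun K => fine (P (prm_trunc N A K)))) //.
apply/funext => K; rewrite -[prm_trunc N A K]setIT -integral_indic//.
  by congr fine; apply: eq_integral => w _; rewrite big1 ?cos0 ?mul1r ?setIT// => i _; rewrite mul0r.
exact: measurable_prm_trunc.
Qed.

(** The Poisson law is given only on finite values; a point with an infinite or non-integral count
    avoids every truncation event, and these have probability tending to one. *)
Lemma prm_fin_num : {ae P, forall w, forall i, N w (A i) \is a fin_num}.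
Proof.
pose U := \bigcap_K ~` prm_trunc N A K.
have mU : measurable U.
  by apply: bigcapT_measurable => K; apply: measurableC; exact: measurable_prm_trunc.
exists U; split => //; last first.
  move=> w /= nfin K _ Tw; apply: nfin => i; have [k ->] := Tw i.
  by rewrite fin_numE.
apply/eqP; rewrite eq_le measure_ge0 andbT.
have PU K : (P U <= 1 - P (prm_trunc N A K))%E.
  rewrite -probability_setC; last exact: measurable_prm_trunc.
  apply: le_measure; rewrite ?inE//; first by apply: measurableC; exact: measurable_prm_trunc.
  by move=> w; apply.
have fU : P U \is a fin_num by exact: fin_num_measure.
rewrite -(fineK fU) lee_fin.
have h : 1 - fine (P (prm_trunc N A K)) @[K --> \oo] --> (1 - 1 : R).
  by apply: cvgB; [exact: cvg_cst|exact: prm_trunc_cvg1].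
rewrite -(subrr 1) -(cvg_lim _ h)//; apply: limr_ge; first by apply/cvg_ex; exists (1 - 1).
apply: nearW => K; rewrite -lee_fin fineK// EFinB fineK//.
by apply: fin_num_measure; exact: measurable_prm_trunc.
Qed.

Let trunc_cvg (h : R -> R) (X : Omega -> R) :
  measurable_fun setT (fun w => h (X w)) -> (forall x, `|h x| <= 1) ->
  (\int[P]_w (h (X w) * \1_(prm_trunc N A K) w))
    @[K --> \oo] --> \int[P]_w h (X w).
Proof.
move=> mh h1.
have bd := @bounded_probability_integrable _ _ _ P.
have mT K : measurable_fun setT (\1_(prm_trunc N A K) : Omega -> R).
  by apply: measurable_indic; exact: measurable_prm_trunc.
have T01 K w : 0 <= (\1_(prm_trunc N A K) w : R) <= 1.
  by rewrite indicE; case: (_ \in _); rewrite /= ?lexx ?ler01.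
have ih : P.-integrable setT (EFin \o (fun w => h (X w))) by exact: bd.
have i1 K : P.-integrable setT (EFin \o (fun w => h (X w) * \1_(prm_trunc N A K) w)).
  apply: bd => [|w]; first exact: measurable_funM.
  by have /andP[t0 t1] := T01 K w; rewrite normrM (ger0_norm t0) mulr_ile1.
have i2 K : P.-integrable setT (EFin \o (fun w => (1 - \1_(prm_trunc N A K) w) : R)).
  apply: bd => [|w]; first exact: measurable_funB.
  by have /andP[t0 t1] := T01 K w; rewrite ger0_norm; lra.
apply/cvgrPdist_le => e e0.
have := prm_trunc_cvg1 => /cvgrPdist_le/(_ _ e0); apply: filterS => K.
have PT1 : fine (P (prm_trunc N A K)) <= 1.
  rewrite -lee_fin fineK ?probability_le1//.
    exact: measurable_prm_trunc.
  by apply: fin_num_measure; exact: measurable_prm_trunc.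
rewrite ger0_norm ?subr_ge0// => PTe.
rewrite -RintegralB//.
have iB : P.-integrable setT (EFin \o (fun w => h (X w) - h (X w) * \1_(prm_trunc N A K) w)).
  have := integrableB measurableT ih (i1 K).
  by apply: eq_integrable => // w _ /=; rewrite EFinB.
apply: (le_trans (le_normr_Rintegral _ iB)) => //.
apply: le_trans PTe.
apply: (@le_trans _ _ (\int[P]_w (1 - \1_(prm_trunc N A K) w))).
  apply: le_Rintegral => //; first exact: integrable_norm.
  move=> w _; have /andP[t0 t1] := T01 K w.
  rewrite -[X in X - _]mulr1 -mulrBr normrM.
  by rewrite -[leRHS]mul1r ler_pM// ger0_norm; lra.
rewrite RintegralB//; last 2 first.
- by apply: bd => // w; rewrite normr1.
- by apply: bd => // w; have /andP[t0 t1] := T01 K w; rewrite ger0_norm.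
rewrite Rintegral_cst// mul1r lerD//.
  by have -> : fine (P setT) = 1 by exact: (congr1 fine (@probability_setT _ _ _ P)).
rewrite lerN2 /Rintegral integral_indic ?setIT//; exact: measurable_prm_trunc.
Qed.

Lemma poisson_joint_char (c : 'I_n -> R) :
  (\int[P]_w cos (\sum_i c i * fine (N w (A i))) =
    expR (\sum_i fine (kappa (A i)) * (cos (c i) - 1)) *
    cos (\sum_i fine (kappa (A i)) * sin (c i))) /\
  (\int[P]_w sin (\sum_i c i * fine (N w (A i))) =
    expR (\sum_i fine (kappa (A i)) * (cos (c i) - 1)) *
    sin (\sum_i fine (kappa (A i)) * sin (c i))).
Proof.
have [h1 h2] := poisson_trunc_char hN c mA tA fA.
have mX : measurable_fun setT (fun w => \sum_i c i * fine (N w (A i))).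
  by apply: measurable_sum => i; apply: measurable_funM => //; exact: measurable_prm_fine.
split.
- rewrite -(cvg_lim _ h1)//; apply/esym/cvg_lim => //.
  apply: (trunc_cvg (h := cos)); last exact: cos_max.
  exact: (measurableT_comp (@measurable_cos R) mX).
- rewrite -(cvg_lim _ h2)//; apply/esym/cvg_lim => //.
  apply: (trunc_cvg (h := sin)); last exact: sin_max.
  exact: (measurableT_comp (@measurable_sin R) mX).
Qed.

End joint.
End poisson_char.

(** * Atoms of a finite family of sets *)

Section atoms.
Context {R : realType} {dE : measure_display} {E : measurableType dE}.
Variables (I : finType) (A : I -> set E) (c : I -> R).
Hypotheses (mA : forall i, measurable (A i)).

(* The sets of an elementary function may overlap; independence of the Poisson
   counts only applies to the atoms they generate. *)
Definition atom (s : {set I}) : set E :=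
  [set x | s != finset.set0 /\ forall i, (i \in s) = (x \in A i)].

Definition atom_val (s : {set I}) : R := \sum_(i in s) c i.

Lemma measurable_atom s : measurable (atom s).
Proof.
have [s0|s0] := eqVneq s finset.set0.
  rewrite (_ : atom s = set0)//; apply/seteqP; split=> // x [].
  by rewrite s0 eqxx.
rewrite (_ : atom s = \bigcap_(i in [set: I]) (if i \in s then A i else ~` A i)).
  by apply: fin_bigcap_measurable => // i _; case: ifP => // _; exact: measurableC.
apply/seteqP; split=> [x [_ h] i _|x h].
  by have := h i; case: ifP => _ /esym; [move/set_mem|move/negbT; rewrite notin_setE].
split=> // i; have := h i Logic.I; case: ifP => _ => [Ax|nAx]; apply/esym.
  exact/mem_set.
exact/memNset.
Qed.

Lemma atom_sub (s : {set I}) i : i \in s -> atom s `<=` A i.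
Proof. by move=> is_ x [_ /(_ i)]; rewrite is_ => /esym/set_mem. Qed.

Lemma trivIset_atom (D : set {set I}) : trivIset D atom.
Proof.
move=> s s' _ _ [x [[_ h] [_ h']]]; apply/setP => i.
by rewrite h h'.
Qed.

(** The condition [phi 0 = 0] accounts for the points outside every [A i], which belong to no
    atom. *)
Lemma comp_elementary (phi : R -> R) x : phi 0 = 0 ->
  phi (\sum_i c i * \1_(A i) x) = \sum_s phi (atom_val s) * \1_(atom s) x.
Proof.
move=> phi0; pose s0 := [set i | x \in A i]%SET.
have xiE : \sum_i c i * (\1_(A i) x : R) = atom_val s0.
  rewrite /atom_val [RHS]big_mkcond/=; apply: eq_bigr => i _.
  by rewrite inE indicE; case: (_ \in _); rewrite ?mulr1 ?mulr0.
rewrite xiE; have [z|nz] := eqVneq s0 finset.set0.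
  rewrite z /atom_val big_set0 phi0 big1// => s _.
  rewrite indicE memNset ?mulr0// => -[/eqP sn0 h]; apply: sn0.
  by rewrite -z; apply/setP => i; rewrite inE h.
rewrite (bigD1 s0)//= [X in _ + X]big1 ?addr0.
  by rewrite indicE mem_set ?mulr1//; split => // i; rewrite inE.
move=> s ss0; rewrite indicE memNset ?mulr0// => -[_ h]; move/eqP: ss0; apply.
by apply/setP => i; rewrite inE h.
Qed.

(** Finiteness relies on the empty index set having an empty atom: the common complement of the
    [A i] may have infinite measure. *)
Lemma atom_lty (m : {measure set E -> \bar R}) s :
  (forall i, (m (A i) < +oo)%E) -> (m (atom s) < +oo)%E.
Proof.
move=> fA; have [s0|/set0Pn[i si]] := eqVneq s finset.set0.
  rewrite (_ : atom s = set0) ?measure0 ?ltry//; apply/seteqP; split=> // x [].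
  by rewrite s0 eqxx.
apply: le_lt_trans (fA i); apply: le_measure; rewrite ?inE//.
  exact: measurable_atom.
exact: atom_sub.
Qed.

Lemma elementary_comp_int (m : {measure set E -> \bar R}) (phi : R -> R) :
  (forall i, (m (A i) < +oo)%E) -> phi 0 = 0 ->
  m.-integrable setT (EFin \o (fun x => phi (\sum_i c i * \1_(A i) x))) /\
  \int[m]_x phi (\sum_i c i * \1_(A i) x) =
    \sum_s phi (atom_val s) * fine (m (atom s)).
Proof.
move=> fA phi0.
have [i1 i2] := Rintegral_sum_indic (mu := m) (index_enum _)
  (fun s => phi (atom_val s)) measurable_atom (fun s => atom_lty s fA).
split.
  apply: eq_integrable i1 => // x _ /=; congr EFin.
  by rewrite comp_elementary.
by rewrite -i2; apply: eq_Rintegral => x _; rewrite comp_elementary.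
Qed.

Lemma elementary_measure (m : {measure set E -> \bar R}) :
  (forall i, (m (A i) < +oo)%E) ->
  \sum_i c i * fine (m (A i)) = \sum_s atom_val s * fine (m (atom s)).
Proof.
move=> fA; have [_ <-] := elementary_comp_int (phi := id) fA erefl.
by have [_ ->] := Rintegral_sum_indic (mu := m) (index_enum _) c mA fA.
Qed.

End atoms.

Section elementary_char.
Context {R : realType} {dE : measure_display} {E : measurableType dE}.
Context {d : measure_display} {Omega : measurableType d}.
Variables (P : probability Omega R) (kappa : {measure set E -> \bar R}).
Variable N : Omega -> {measure set E -> \bar R}.
Hypothesis hN : poisson_random_measure P kappa N.
Variables (I : finType) (A : I -> set E) (c : I -> R).
Hypotheses (mA : forall i, measurable (A i)).
Hypothesis fA : forall i, (kappa (A i) < +oo)%E.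

Let W w := \sum_i c i * (fine (N w (A i)) - fine (kappa (A i))).
Let xi x := \sum_i c i * \1_(A i) x : R.
Let n := #|{: {set I}}|.
Let B (j : 'I_n) := atom A (enum_val j).

Let mB j : measurable (B j). Proof. exact: measurable_atom. Qed.
Let tB : trivIset setT B.
Proof.
move=> i j _ _ ij; apply/enum_val_inj.
by apply: (trivIset_atom (A := A) (D := setT)).
Qed.
Let fB j : (kappa (B j) < +oo)%E. Proof. exact: atom_lty. Qed.

Lemma prm_finite_ae (C : set E) : measurable C -> (kappa C < +oo)%E ->
  {ae P, forall w, N w C \is a fin_num}.
Proof.
move=> mC fC.
have := @prm_fin_num _ _ _ _ _ P kappa N hN 1 (fun=> C) (fun=> mC) _ (fun=> fC).
have tC : trivIset [set: 'I_1] (fun=> C) by move=> i j _ _ _; rewrite !ord1.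
by move=> /(_ tC); apply: filterS => w /(_ ord0).
Qed.

Let measurable_fine_prm C : measurable C ->
  measurable_fun setT (fun w => fine (N w C)).
Proof. exact: measurable_prm_fine hN _. Qed.

(** Only almost surely: [fine] sends an infinite count to [0], so additivity over the atoms needs
    finite counts. *)
Let WE : {ae P, forall w, W w =
  \sum_j atom_val c (enum_val j) * fine (N w (B j)) -
  \sum_i c i * fine (kappa (A i))}.
Proof.
have : {ae P, forall w, forall i, N w (A i) \is a fin_num}.
  by apply: filter_forall => i; exact: prm_finite_ae.
apply: filterS => w h; rewrite /W; under eq_bigr do rewrite mulrBr.
have fNA i : (N w (A i) < +oo)%E by rewrite ltey_eq h.
rewrite sumrB (elementary_measure c mA fNA).
by congr (_ - _); rewrite (big_enum_val (fun s => atom_val c s * fine (N w (atom A s)))).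
Qed.

Lemma measurable_elementary_prm : measurable_fun setT W.
Proof.
apply: measurable_sum => i; apply: measurable_funM => //.
by apply: measurable_funB => //; exact: measurable_fine_prm.
Qed.

(** The compensator is a deterministic shift of the phase. Absorbed into the integrand it turns
    [sin] into [sin - id], which is of second order and therefore survives the passage to
    square-integrable functions. *)
Lemma elementary_char :
  (\int[P]_w cos (W w) = expR (\int[kappa]_x (cos (xi x) - 1)) *
                         cos (\int[kappa]_x (sin (xi x) - xi x))) /\
  (\int[P]_w sin (W w) = expR (\int[kappa]_x (cos (xi x) - 1)) *
                         sin (\int[kappa]_x (sin (xi x) - xi x))).
Proof.
have c1 : cos 0 - 1 = 0 :> R by rewrite cos0 subrr.
have s1 : sin 0 - 0 = 0 :> R by rewrite sin0 subrr.
have [_ ->] := @elementary_comp_int _ _ _ _ A c mA kappa (fun y => cos y - 1) fA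
  c1.
have [_ ->] := @elementary_comp_int _ _ _ _ A c mA kappa (fun y => sin y - y) fA
  s1.
have [] := @poisson_joint_char _ _ _ _ _ P kappa N hN n B mB tB fB
  (fun j => atom_val c (enum_val j)).
pose X w := \sum_j atom_val c (enum_val j) * fine (N w (B j)).
rewrite -/X; pose K := \sum_i c i * fine (kappa (A i)).
set a := \sum_j fine (kappa (B j)) * (cos _ - 1).
set b := \sum_j fine (kappa (B j)) * sin _ => hc hs.
have -> : \sum_s (cos (atom_val c s) - 1) * fine (kappa (atom A s)) = a.
  rewrite (big_enum_val (fun s => (cos (atom_val c s) - 1) * fine (kappa (atom A s))))/=.
  by apply: eq_bigr => j _; rewrite mulrC.
have -> : \sum_s (sin (atom_val c s) - atom_val c s) * fine (kappa (atom A s)) = b - K.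
  under eq_bigr do rewrite mulrBl; rewrite sumrB /K (elementary_measure _ mA)//; congr (_ - _).
  rewrite (big_enum_val (fun s => sin (atom_val c s) * fine (kappa (atom A s))))/=.
  by apply: eq_bigr => j _; rewrite mulrC.
have mX : measurable_fun setT X.
  by apply: measurable_sum => j; apply: measurable_funM => //; exact: measurable_fine_prm.
have bd := @bounded_probability_integrable _ _ _ P.
have [mcos msin] := (@measurable_cos R, @measurable_sin R).
have ic : P.-integrable setT (EFin \o (fun w => cos (X w))).
  by apply: bd; [exact: (measurableT_comp mcos mX)|move=> w; exact: cos_max].
have is_ : P.-integrable setT (EFin \o (fun w => sin (X w))).
  by apply: bd; [exact: (measurableT_comp msin mX)|move=> w; exact: sin_max].
have icr r : P.-integrable setT (EFin \o (fun w => cos (X w) * r)).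
  by have := integrableZr measurableT r ic; apply: eq_integrable.
have isr r : P.-integrable setT (EFin \o (fun w => sin (X w) * r)).
  by have := integrableZr measurableT r is_; apply: eq_integrable.
have aeE (h : R -> R) : measurable_fun setT h ->
    \int[P]_w h (W w) = \int[P]_w h (X w - K).
  move=> mh; congr fine; apply: ae_eq_integral => //.
  - apply/measurable_EFinP; apply: (measurableT_comp mh).
    exact: measurable_elementary_prm.
  - by apply/measurable_EFinP; apply: (measurableT_comp mh); exact: measurable_funB.
  - by have := WE; apply: filterS => w -> _.
split.
- rewrite aeE//; under eq_Rintegral do rewrite cosB.
  rewrite RintegralD// !RintegralZr// hc hs cosB; ring.
- rewrite aeE//; under eq_Rintegral do rewrite sinB.
  rewrite RintegralB// !RintegralZr// hc hs sinB; ring.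
Qed.

End elementary_char.

(** * Quadratic estimates for the exponents *)

Section trigonometric_bounds.
Context {R : realType}.
Implicit Types a b x : R.

Lemma MVT0 (f df : R -> R) x : f 0 = 0 ->
  (forall y, is_derive y (1 : R) f (df y)) ->
  exists2 c, `|c| <= `|x| & f x = df c * x.
Proof.
move=> f0 fdf.
have cf a b : {within `[a, b], continuous f}.
  apply: continuous_subspaceT => y; apply/differentiable_continuous/derivable1_diffP.
  by have [] := fdf y.
have [x0|x0] := leP 0 x.
  have [c] := @MVT_segment R f df 0 x x0 (fun y _ => fdf y) (cf 0 x).
  rewrite in_itv/= => /andP[c0 cx]; rewrite f0 !subr0 => fE.
  by exists c => //; rewrite !ger0_norm.
have [c] := @MVT_segment R f df x 0 (ltW x0) (fun y _ => fdf y) (cf x 0).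
rewrite in_itv/= => /andP[cx c0]; rewrite f0 !sub0r => fE.
exists c; first by rewrite (ltr0_norm x0) ler0_norm// lerN2.
by apply: oppr_inj; rewrite fE mulrN.
Qed.

Lemma norm_sin_le x : `|sin x| <= `|x|.
Proof.
have [c _ ->] := MVT0 x (@sin0 R) (@is_derive_sin R).
by rewrite normrM ler_piMl// cos_max.
Qed.

Lemma norm_cos_sub1_le x : `|cos x - 1| <= `|x|.
Proof.
have d y : is_derive y (1 : R) (fun z => cos z - 1) (- sin y).
  by apply: is_derive_eq; rewrite subr0.
have z : cos 0 - 1 = 0 :> R by rewrite cos0 subrr.
have [c _ ->] := @MVT0 (fun z => cos z - 1) (fun y => - sin y) x z d.
by rewrite normrM normrN ler_piMl// sin_max.
Qed.

Lemma norm_sin_sub_le x : `|sin x - x| <= x ^+ 2.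
Proof.
have d y : is_derive y (1 : R) (fun z => sin z - z) (cos y - 1).
  by apply: is_derive_eq.
have z : sin 0 - 0 = 0 :> R by rewrite sin0 subrr.
have [c cx ->] := @MVT0 (fun z => sin z - z) (fun y => cos y - 1) x z d.
rewrite normrM -[x ^+ 2]ger0_norm ?sqr_ge0// expr2 normrM ler_wpM2r//.
exact: le_trans (norm_cos_sub1_le c) cx.
Qed.

Lemma cos_sub_prod a b :
  cos a - cos b = - 2 * (sin ((a + b) / 2) * sin ((a - b) / 2)).
Proof.
have -> : cos a = cos ((a + b) / 2 + (a - b) / 2) by congr cos; field.
have -> : cos b = cos ((a + b) / 2 - (a - b) / 2) by congr cos; field.
by rewrite cosD cosB; ring.
Qed.

Lemma sin_sub_prod a b :
  sin a - sin b = 2 * (cos ((a + b) / 2) * sin ((a - b) / 2)).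
Proof.
have -> : sin a = sin ((a + b) / 2 + (a - b) / 2) by congr sin; field.
have -> : sin b = sin ((a + b) / 2 - (a - b) / 2) by congr sin; field.
by rewrite sinD sinB; ring.
Qed.

Lemma cos_lipschitz a b : `|cos a - cos b| <= `|a - b|.
Proof.
rewrite cos_sub_prod !normrM normrN [`|2|]ger0_norm//.
have := norm_sin_le ((a - b) / 2); have := sin_max ((a + b) / 2).
rewrite normrM [`|2^-1|]ger0_norm//.
set u := `|sin _|; set v := `|sin _| => u1 v1.
have u0 : 0 <= u := normr_ge0 _; have v0 : 0 <= v := normr_ge0 _.
by nra.
Qed.

Lemma sin_lipschitz a b : `|sin a - sin b| <= `|a - b|.
Proof.
rewrite sin_sub_prod !normrM [`|2|]ger0_norm//.
have := norm_sin_le ((a - b) / 2); have := cos_max ((a + b) / 2).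
rewrite normrM [`|2^-1|]ger0_norm//.
set u := `|cos _|; set v := `|sin _| => u1 v1.
have u0 : 0 <= u := normr_ge0 _; have v0 : 0 <= v := normr_ge0 _.
by nra.
Qed.

Let half_sum_prod a b : `|a + b| * `|a - b| <= (a - b) ^+ 2 + 2 * (`|b| * `|a - b|).
Proof.
rewrite -[(a - b) ^+ 2]ger0_norm ?sqr_ge0// expr2 normrM mulrA -mulrDl.
rewrite ler_wpM2r//.
have -> : a + b = (a - b) + 2 * b by ring.
by rewrite (le_trans (ler_normD _ _))// normrM [`|2|]ger0_norm.
Qed.

(** Over an infinite measure [|a - b|] need not be integrable, so a plain Lipschitz bound is
    useless; both terms here are integrable as soon as [a - b] and [b] are square-integrable. *)
Lemma pcos_lipschitz a b :
  `|(cos a - 1) - (cos b - 1)| <= (a - b) ^+ 2 + `|b| * `|a - b|.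
Proof.
have -> : (cos a - 1) - (cos b - 1) = cos a - cos b by ring.
rewrite cos_sub_prod !normrM normrN [`|2|]ger0_norm//.
have := norm_sin_le ((a - b) / 2); have := norm_sin_le ((a + b) / 2).
rewrite !normrM [`|2^-1|]ger0_norm//.
have := half_sum_prod a b; have := sqr_ge0 (a - b).
have : 0 <= `|b| * `|a - b| by rewrite mulr_ge0.
set u := `|sin _|; set v := `|sin _| => h1 h2 h3 u1 v1.
have u0 : 0 <= u := normr_ge0 _; have v0 : 0 <= v := normr_ge0 _.
have : u * v <= `|a + b| / 2 * (`|a - b| / 2) by rewrite ler_pM.
lra.
Qed.

Lemma psin_lipschitz a b :
  `|(sin a - a) - (sin b - b)| <= (a - b) ^+ 2 + `|b| * `|a - b|.
Proof.
have -> : (sin a - a) - (sin b - b) = (sin a - sin b) - (a - b) by ring.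
rewrite sin_sub_prod; set h := (a - b) / 2; set m := (a + b) / 2.
(* Both resulting terms are of second order: the first is at most [2 |m| |h|], the second at most
   [2 h^2]. *)
have -> : 2 * (cos m * sin h) - (a - b) =
    2 * ((cos m - 1) * sin h) + 2 * (sin h - h) by rewrite /h; field.
apply: (le_trans (ler_normD _ _)); rewrite !normrM [`|2|]ger0_norm//.
have := norm_sin_sub_le h; have := norm_cos_sub1_le m; have := norm_sin_le h.
have := half_sum_prod a b.
have -> : `|h| = `|a - b| / 2 by rewrite /h normrM [`|2^-1|]ger0_norm.
have -> : `|m| = `|a + b| / 2 by rewrite /m normrM [`|2^-1|]ger0_norm.
have -> : h ^+ 2 = (a - b) ^+ 2 / 4 by rewrite /h; field.
set u := `|cos _ - 1|; set v := `|sin h|; set w := `|sin h - h| => h1 v1 u1 w1.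
have u0 : 0 <= u := normr_ge0 _; have v0 : 0 <= v := normr_ge0 _.
have : u * v <= `|a + b| / 2 * (`|a - b| / 2) by rewrite ler_pM.
lra.
Qed.

Lemma pcos_le x : `|cos x - 1| <= x ^+ 2.
Proof.
by have := pcos_lipschitz x 0; rewrite cos0 subrr !subr0 normr0 mul0r addr0.
Qed.

End trigonometric_bounds.

(** * The scalar compensated integral *)

Section square_integrable_continuity.
Context {R : realType} {d : measure_display} {T : measurableType d}.
Variable m : {measure set T -> \bar R}.
Implicit Types f g h k : T -> R.

Definition sqint f : \bar R := (\int[m]_x (f x ^+ 2)%:E)%E.

Lemma sqint_ge0 f : (0 <= sqint f)%E.
Proof. by apply: integral_ge0 => x _; rewrite lee_fin sqr_ge0. Qed.

Lemma measurable_sqr f : measurable_fun setT f ->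
  measurable_fun setT (fun x => (f x ^+ 2)%:E).
Proof. by move=> mf; apply/measurable_EFinP; exact: measurable_funX. Qed.

(** Stands in for the triangle inequality, in the form [(u + v)^2 <= 2 u^2 + 2 v^2]. *)
Lemma sqint_le_lin f g h (a b : R) : 0 <= a -> 0 <= b ->
  measurable_fun setT f -> measurable_fun setT g -> measurable_fun setT h ->
  (forall x, f x ^+ 2 <= a * g x ^+ 2 + b * h x ^+ 2) ->
  (sqint f <= a%:E * sqint g + b%:E * sqint h)%E.
Proof.
move=> a0 b0 mf mg mh fgh; rewrite /sqint.
rewrite -!ge0_integralZl//; last 4 first.
- exact: measurable_sqr.
- by move=> x _; rewrite lee_fin sqr_ge0.
- exact: measurable_sqr.
- by move=> x _; rewrite lee_fin sqr_ge0.
rewrite -ge0_integralD//; last 4 first.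
- by move=> x _; rewrite mule_ge0// lee_fin sqr_ge0.
- by apply: measurable_funeM; exact: measurable_sqr.
- by move=> x _; rewrite mule_ge0// lee_fin sqr_ge0.
- by apply: measurable_funeM; exact: measurable_sqr.
apply: ge0_le_integral => //.
- by move=> x _; rewrite lee_fin sqr_ge0.
- exact: measurable_sqr.
- by apply: emeasurable_funD; apply: measurable_funeM; exact: measurable_sqr.
- by move=> x _; rewrite -!EFinM -EFinD lee_fin.
Qed.

Lemma sqint_integrable f : measurable_fun setT f -> (sqint f < +oo)%E ->
  m.-integrable setT (EFin \o (fun x => f x ^+ 2)).
Proof.
move=> mf fi; apply/integrableP; split; first exact: measurable_sqr.
rewrite (eq_integral (fun x => (f x ^+ 2)%:E))// => x _.
by rewrite /= ger0_norm// sqr_ge0.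
Qed.

(* [|k h| <= eta k^2 + h^2 / eta], so the bound is small with [sqint h]. *)
Lemma Rintegral_small k (D h : T -> R) (eta e1 : R) : 0 < eta ->
  measurable_fun setT k -> measurable_fun setT h -> (sqint k < +oo)%E ->
  (sqint h <= e1%:E)%E -> m.-integrable setT (EFin \o D) ->
  (forall x, `|D x| <= h x ^+ 2 + `|k x| * `|h x|) ->
  `|\int[m]_x D x| <= (1 + eta^-1) * e1 + eta * fine (sqint k).
Proof.
move=> eta0 mk mh fk he iD DB.
have fh : (sqint h < +oo)%E by apply: le_lt_trans he _; rewrite ltry.
have ih := sqint_integrable mh fh; have ik := sqint_integrable mk fk.
apply: (le_trans (le_normr_Rintegral _ iD)) => //.
have iR1 : m.-integrable setT (EFin \o (fun x => (1 + eta^-1) * h x ^+ 2)).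
  rewrite (_ : EFin \o _ = (fun x => (1 + eta^-1)%:E * (EFin \o (fun x => h x ^+ 2)%R) x)%E)//.
  exact: integrableZl.
have iR2 : m.-integrable setT (EFin \o (fun x => eta * k x ^+ 2)).
  rewrite (_ : EFin \o _ = (fun x => eta%:E * (EFin \o (fun x => k x ^+ 2)%R) x)%E)//.
  exact: integrableZl.
apply: (@le_trans _ _ (\int[m]_x ((1 + eta^-1) * h x ^+ 2 + eta * k x ^+ 2))).
  apply: le_Rintegral => //.
  - exact: integrable_norm.
  - by have := integrableD measurableT iR1 iR2; apply: eq_integrable.
  - move=> x _; apply: (le_trans (DB x)).
    rewrite mulrDl mul1r -addrA lerD2l.
    rewrite -[h x ^+ 2]ger0_norm ?sqr_ge0// -[k x ^+ 2]ger0_norm ?sqr_ge0// !normrX.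
    move: `|k x| `|h x| => u v.
    rewrite -subr_ge0.
    have -> : eta^-1 * v ^+ 2 + eta * u ^+ 2 - u * v =
      eta^-1 * ((v - eta * u / 2) ^+ 2 + 3 / 4 * (eta * u) ^+ 2).
      by field; rewrite gt_eqF.
    rewrite mulr_ge0 ?invr_ge0 ?(ltW eta0)// addr_ge0 ?sqr_ge0//.
    by rewrite mulr_ge0// sqr_ge0.
rewrite RintegralD// !RintegralZl// lerD2r ler_wpM2l//.
  by rewrite addr_ge0// invr_ge0 ltW.
rewrite -lee_fin fineK//.
by rewrite ge0_fin_numE// sqint_ge0.
Qed.

End square_integrable_continuity.

Section compensated_char.
Context {R : realType} {dE : measure_display} {E : measurableType dE}.
Context {d : measure_display} {Omega : measurableType d}.
Variables (P : probability Omega R) (kappa : {measure set E -> \bar R}).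
Variable N : Omega -> {measure set E -> \bar R}.
Hypothesis hN : poisson_random_measure P kappa N.

(** Indexed by an arbitrary finite type, so that a sum of two such functions lives on the disjoint
    sum of the index types. *)
Record scalar_elementary := ScalarElementary {
  se_index : finType;
  se_set : se_index -> set E;
  se_val : se_index -> R;
  se_measurable : forall i, measurable (se_set i);
  se_finite : forall i, (kappa (se_set i) < +oo)%E }.

Definition se_eval (e : scalar_elementary) x : R :=
  \sum_i se_val i * \1_(se_set (s := e) i) x.

Definition se_int (e : scalar_elementary) w : R :=
  \sum_i se_val i * (fine (N w (se_set (s := e) i)) - fine (kappa (se_set i))).

Lemma measurable_se_eval e : measurable_fun setT (se_eval e).
Proof.
apply: measurable_sum => i; apply: measurable_funM => //.
by apply: measurable_indic; exact: se_measurable.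
Qed.

Lemma measurable_se_int e : measurable_fun setT (se_int e).
Proof. by apply: (measurable_elementary_prm hN) => i; exact: se_measurable. Qed.

Lemma sqint_se_eval e : (sqint kappa (se_eval e) < +oo)%E.
Proof.
have [i1 _] := elementary_comp_int (m := kappa) (phi := fun y => y ^+ 2) (@se_val e)
  (@se_measurable e) (@se_finite e) (expr0n _ 2).
exact: integrable_lty i1.
Qed.

(* [Z] is the integral of [L] against the compensated measure. *)
Definition scalar_integral (L : E -> R) (Z : Omega -> R) :=
  [/\ measurable_fun setT L, measurable_fun setT Z &
    forall eps : R, 0 < eps -> exists e : scalar_elementary,
      (sqint kappa (fun x => (se_eval e x - L x)%R) <= eps%:E)%E /\
      (sqint P (fun w => (se_int e w - Z w)%R) <= eps%:E)%E].

(** An elementary function is square-integrable, and [L] lies at finite distance from one. *)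
Lemma scalar_integral_sqint L Z : scalar_integral L Z -> (sqint kappa L < +oo)%E.
Proof.
move=> [mL mZ /(_ 1 ltr01)[e [eL _]]].
have me := measurable_se_eval e.
have mB : measurable_fun setT (fun x => se_eval e x - L x) by exact: measurable_funB.
have LB x : L x ^+ 2 <= 2 * se_eval e x ^+ 2 + 2 * (se_eval e x - L x) ^+ 2.
  by have := sqr_ge0 (se_eval e x + (se_eval e x - L x)); nra.
apply: le_lt_trans (sqint_le_lin kappa (ler0n _ 2) (ler0n _ 2) mL me mB LB) _.
rewrite lte_add_pinfty// lte_mul_pinfty//; first exact: sqint_se_eval.
by apply: le_lt_trans eL _; rewrite ltry.
Qed.

Lemma scalar_integral_trig_integrable L Z : scalar_integral L Z ->
  kappa.-integrable setT (EFin \o (fun x => cos (L x) - 1)) /\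
  kappa.-integrable setT (EFin \o (fun x => sin (L x) - L x)).
Proof.
move=> hL; have [mL _ _] := hL.
have iL2 := sqint_integrable mL (scalar_integral_sqint hL).
have [mcos msin] := (@measurable_cos R, @measurable_sin R).
split; apply: le_integrable iL2 => //.
- apply/measurable_EFinP; apply: measurable_funB => //.
  exact: (measurableT_comp mcos mL).
- by move=> x _; rewrite lee_fin [leRHS]ger0_norm ?sqr_ge0// pcos_le.
- apply/measurable_EFinP; apply: measurable_funB => //.
  exact: (measurableT_comp msin mL).
- by move=> x _; rewrite lee_fin [leRHS]ger0_norm ?sqr_ge0// norm_sin_sub_le.
Qed.

(** The function [k] controls the linear part of the estimate: it is [L] for [kappa], and the
    constant [1] for [P], where the total mass is finite. *)
Let trig_cvg dT (S : measurableType dT) (m : {measure set S -> \bar R})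
    (k : S -> R) (phi : R -> R) (f : nat -> S -> R) (g : S -> R) :
  measurable_fun setT k -> (sqint m k < +oo)%E ->
  (forall n, measurable_fun setT (f n)) -> measurable_fun setT g ->
  (forall n, m.-integrable setT (EFin \o (phi \o f n))) ->
  m.-integrable setT (EFin \o (phi \o g)) ->
  (forall n, (sqint m (fun x => (f n x - g x)%R) <= (n.+1%:R^-1)%:E)%E) ->
  (forall n x, `|phi (f n x) - phi (g x)| <=
    (f n x - g x) ^+ 2 + `|k x| * `|f n x - g x|) ->
  \int[m]_x phi (f n x) @[n --> \oo] --> \int[m]_x phi (g x).
Proof.
move=> mk fk mf mg imf ig fg bnd; apply/cvgrPdist_le => e e0.
pose C := fine (sqint m k); have C0 : 0 <= C by rewrite fine_ge0// sqint_ge0.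
(* Chosen so that [eta * C] takes at most half of [e]; adding [1] covers [C = 0]. *)
pose eta := e / (2 * (C + 1)).
have C1 : 0 < C + 1 by lra.
have eta0 : 0 < eta by rewrite divr_gt0// mulr_gt0.
have c0 : 0 < 1 + eta^-1 by rewrite addr_gt0// invr_gt0.
have := @cvg_harmonic R => /cvgrPdist_le/(_ (e / 2 / (1 + eta^-1))).
rewrite divr_gt0 ?divr_gt0// => /(_ isT); apply: filterS => n.
rewrite sub0r normrN ger0_norm ?harmonic_ge0// ler_pdivlMr// => hn.
have imfn : m.-integrable setT (EFin \o (fun x => phi (f n x))) := imf n.
rewrite distrC -RintegralB//.
have iD : m.-integrable setT (EFin \o (fun x => phi (f n x) - phi (g x))).
  have := integrableB measurableT (imf n) ig.
  by apply: eq_integrable => // x _ /=; rewrite EFinB.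
have mfg : measurable_fun setT (fun x => f n x - g x) by exact: measurable_funB.
apply: (le_trans (Rintegral_small eta0 mk mfg fk (fg n) iD (bnd n))).
rewrite -/C (splitr e) lerD//; first by rewrite mulrC.
rewrite /eta; have -> : e / (2 * (C + 1)) * C = e / 2 * (C / (C + 1)).
  by field; rewrite gt_eqF.
by rewrite ler_piMr ?divr_ge0 ?(ltW e0)// ler_pdivrMr// mul1r lerDl.
Qed.

Lemma scalar_integral_char L Z : scalar_integral L Z ->
  (\int[P]_w cos (Z w) = expR (\int[kappa]_x (cos (L x) - 1)) *
                         cos (\int[kappa]_x (sin (L x) - L x))) /\
  (\int[P]_w sin (Z w) = expR (\int[kappa]_x (cos (L x) - 1)) *
                         sin (\int[kappa]_x (sin (L x) - L x))).
Proof.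
move=> hL; have [mL mZ hLe] := hL.
have /choice[e he] : forall n : nat, exists e : scalar_elementary,
    (sqint kappa (fun x => (se_eval e x - L x)%R) <= (n.+1%:R^-1)%:E)%E /\
    (sqint P (fun w => (se_int e w - Z w)%R) <= (n.+1%:R^-1)%:E)%E.
  by move=> n; apply: hLe; rewrite invr_gt0.
have [icL isL] := scalar_integral_trig_integrable hL.
have sL := scalar_integral_sqint hL.
have c1 : cos 0 - 1 = 0 :> R by rewrite cos0 subrr.
have s1 : sin 0 - 0 = 0 :> R by rewrite sin0 subrr.
have ca : \int[kappa]_x (cos (se_eval (e n) x) - 1) @[n --> \oo] -->
    \int[kappa]_x (cos (L x) - 1).
  apply: (trig_cvg (k := L) (phi := fun y => cos y - 1) (f := fun n => se_eval (e n))) => //.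
  - by move=> n; exact: measurable_se_eval.
  - move=> n; have [] := @elementary_comp_int _ _ _ _ _ (@se_val (e n)) (@se_measurable (e n))
      kappa (fun y => cos y - 1) (@se_finite (e n)) c1; by [].
  - by move=> n; have [] := he n.
  - by move=> n x; exact: pcos_lipschitz.
have cb : \int[kappa]_x (sin (se_eval (e n) x) - se_eval (e n) x) @[n --> \oo] -->
    \int[kappa]_x (sin (L x) - L x).
  apply: (trig_cvg (k := L) (phi := fun y => sin y - y) (f := fun n => se_eval (e n))) => //.
  - by move=> n; exact: measurable_se_eval.
  - move=> n; have [] := @elementary_comp_int _ _ _ _ _ (@se_val (e n)) (@se_measurable (e n))
      kappa (fun y => sin y - y) (@se_finite (e n)) s1; by [].
  - by move=> n; have [] := he n.
  - by move=> n x; exact: psin_lipschitz.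
have [mcos msin] := (@measurable_cos R, @measurable_sin R).
have bd := @bounded_probability_integrable _ _ _ P.
have P1 : (sqint P (fun=> 1%R) < +oo)%E.
  by apply: (integrable_lty _ (f := fun=> (1 ^+ 2)%:E)) => //; exact: finite_measure_integrable_cst.
have cc : \int[P]_w cos (se_int (e n) w) @[n --> \oo] --> \int[P]_w cos (Z w).
  apply: (trig_cvg (k := fun=> 1) (phi := cos) (f := fun n => se_int (e n))) => //.
  - by move=> n; exact: measurable_se_int.
  - move=> n; apply: bd; last by move=> w; exact: cos_max.
    by apply: measurableT_comp => //; exact: measurable_se_int.
  - by apply: bd; [exact: measurableT_comp|move=> w; exact: cos_max].
  - by move=> n; have [] := he n.
  - move=> n x; rewrite normr1 mul1r.
    by apply: (le_trans (cos_lipschitz _ _)); rewrite lerDr sqr_ge0.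
have cs : \int[P]_w sin (se_int (e n) w) @[n --> \oo] --> \int[P]_w sin (Z w).
  apply: (trig_cvg (k := fun=> 1) (phi := sin) (f := fun n => se_int (e n))) => //.
  - by move=> n; exact: measurable_se_int.
  - move=> n; apply: bd; last by move=> w; exact: sin_max.
    by apply: measurableT_comp => //; exact: measurable_se_int.
  - by apply: bd; [exact: measurableT_comp|move=> w; exact: sin_max].
  - by move=> n; have [] := he n.
  - move=> n x; rewrite normr1 mul1r.
    by apply: (le_trans (sin_lipschitz _ _)); rewrite lerDr sqr_ge0.
have chE n := elementary_char hN (@se_val (e n)) (@se_measurable (e n)) (@se_finite (e n)).
have cexp : expR (\int[kappa]_x (cos (se_eval (e n) x) - 1)) @[n --> \oo] -->
    expR (\int[kappa]_x (cos (L x) - 1)).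
  by apply: continuous_cvg ca; exact: continuous_expR.
split.
- rewrite -(cvg_lim _ cc)//; apply: cvg_lim => //.
  rewrite (_ : (fun _ => _) = (fun n => expR (\int[kappa]_x (cos (se_eval (e n) x) - 1)) *
     cos (\int[kappa]_x (sin (se_eval (e n) x) - se_eval (e n) x)))).
    by apply: cvgM => //; apply: continuous_cvg cb; exact: continuous_cos.
  by apply/funext => n; have [-> _] := chE n.
- rewrite -(cvg_lim _ cs)//; apply: cvg_lim => //.
  rewrite (_ : (fun _ => _) = (fun n => expR (\int[kappa]_x (cos (se_eval (e n) x) - 1)) *
     sin (\int[kappa]_x (sin (se_eval (e n) x) - se_eval (e n) x)))).
    by apply: cvgM => //; apply: continuous_cvg cb; exact: continuous_sin.
  by apply/funext => n; have [_ ->] := chE n.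
Qed.

End compensated_char.

Section scalar_integral_closure.
Context {R : realType} {dE : measure_display} {E : measurableType dE}.
Context {d : measure_display} {Omega : measurableType d}.
Variables (P : probability Omega R) (kappa : {measure set E -> \bar R}).
Variable N : Omega -> {measure set E -> \bar R}.
Hypothesis hN : poisson_random_measure P kappa N.

Lemma scalar_integralD L Z L' Z' :
  scalar_integral P kappa N L Z -> scalar_integral P kappa N L' Z' ->
  scalar_integral P kappa N (fun x => L x + L' x) (fun w => Z w + Z' w).
Proof.
move=> [mL mZ h] [mL' mZ' h']; split; [exact: measurable_funD..|].
(* The square of a sum costs a factor [2] on each of the two terms, hence a quarter. *)
move=> eps eps0; have e4 : 0 < eps / 4 by rewrite divr_gt0.
have [[I A c mA fA] [e1 e2]] := h _ e4; have [[I' A' c' mA' fA'] [e1' e2']] := h' _ e4.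
pose A2 (i : I + I') := match i with inl i => A i | inr i => A' i end.
pose c2 (i : I + I') := match i with inl i => c i | inr i => c' i end.
have mA2 i : measurable (A2 i) by case: i.
have fA2 i : (kappa (A2 i) < +oo)%E by case: i.
exists (@ScalarElementary _ _ _ kappa _ A2 c2 mA2 fA2).
have eps2 : ((2%:R * (eps / 4))%:E + (2%:R * (eps / 4))%:E = eps%:E :> \bar R)%E.
  by rewrite -EFinD; congr EFin; field.
have comb dT (T : measurableType dT) (m : {measure set T -> \bar R}) (f g h0 : T -> R) :
    measurable_fun setT f -> measurable_fun setT g -> measurable_fun setT h0 ->
    (forall x, f x = g x + h0 x) ->
    (sqint m g <= (eps / 4)%:E)%E -> (sqint m h0 <= (eps / 4)%:E)%E ->
    (sqint m f <= eps%:E)%E.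
  move=> mf mg mh fE hg hh.
  have H x : f x ^+ 2 <= 2 * g x ^+ 2 + 2 * h0 x ^+ 2.
    by rewrite fE; have := sqr_ge0 (g x - h0 x); nra.
  apply: (le_trans (sqint_le_lin m (ler0n _ 2) (ler0n _ 2) mf mg mh H)).
  by rewrite -eps2; apply: leeD; rewrite EFinM; exact: lee_wpmul2l.
split.
- apply: comb e1 e1'.
  + by apply: measurable_funB; [exact: measurable_se_eval|exact: measurable_funD].
  + by apply: measurable_funB => //; exact: measurable_se_eval.
  + by apply: measurable_funB => //; exact: measurable_se_eval.
  + by move=> x; rewrite /se_eval big_sumType /=; ring.
- apply: comb e2 e2'.
  + by apply: measurable_funB; [exact: (measurable_se_int hN)|exact: measurable_funD].
  + by apply: measurable_funB => //; exact: (measurable_se_int hN).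
  + by apply: measurable_funB => //; exact: (measurable_se_int hN).
  + by move=> w; rewrite /se_int big_sumType /=; ring.
Qed.

Lemma scalar_integralZ a L Z : scalar_integral P kappa N L Z ->
  scalar_integral P kappa N (fun x => a * L x) (fun w => a * Z w).
Proof.
move=> [mL mZ h]; split; [exact: measurable_funM..|].
(* The summand [1] keeps [b] positive when [a = 0]. *)
move=> eps eps0; pose b := a ^+ 2 + 1.
have b0 : 0 < b by rewrite /b; have := sqr_ge0 a; lra.
have e0 : 0 < eps / b by rewrite divr_gt0.
have [[I A c mA fA] [e1 e2]] := h _ e0.
exists (@ScalarElementary _ _ _ kappa _ A (fun i => a * c i) mA fA).
have comb dT (T : measurableType dT) (m : {measure set T -> \bar R}) (f g : T -> R) :
    measurable_fun setT f -> measurable_fun setT g -> (forall x, f x = a * g x) ->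
    (sqint m g <= (eps / b)%:E)%E -> (sqint m f <= eps%:E)%E.
  move=> mf mg fE hg.
  have H x : f x ^+ 2 <= b * g x ^+ 2 + 0 * g x ^+ 2.
    by rewrite fE exprMn mul0r addr0 ler_wpM2r ?sqr_ge0// lerDl.
  apply: (le_trans (sqint_le_lin m (ltW b0) (lexx 0) mf mg mg H)).
  have -> : eps = b * (eps / b) by field; rewrite gt_eqF.
  by rewrite mul0e adde0 EFinM; apply: lee_wpmul2l => //; rewrite lee_fin ltW.
split.
- apply: comb e1.
  + by apply: measurable_funB; [exact: measurable_se_eval|exact: measurable_funM].
  + by apply: measurable_funB => //; exact: measurable_se_eval.
  + move=> x; rewrite /se_eval /=; under eq_bigr do rewrite -mulrA.
    by rewrite -mulr_sumr -mulrBr.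
- apply: comb e2.
  + by apply: measurable_funB; [exact: (measurable_se_int hN)|exact: measurable_funM].
  + by apply: measurable_funB => //; exact: (measurable_se_int hN).
  + move=> x; rewrite /se_int /=; under eq_bigr do rewrite -mulrA.
    by rewrite -mulr_sumr -mulrBr.
Qed.

Lemma scalar_integral_sum (I : Type) (r : seq I) (L : I -> E -> R) (Z : I -> Omega -> R) :
  (forall i, scalar_integral P kappa N (L i) (Z i)) ->
  scalar_integral P kappa N (fun x => \sum_(i <- r) L i x) (fun w => \sum_(i <- r) Z i w).
Proof.
move=> h; elim: r => [|i r IH].
  under eq_fun do rewrite big_nil; under [X in scalar_integral _ _ _ _ X]eq_fun do rewrite big_nil.
  split => // eps eps0.
  have A0 (i : void) : measurable (set0 : set E) by case: i.
  have f0 (i : void) : (kappa (set0 : set E) < +oo)%E by case: i.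
  exists (@ScalarElementary _ _ _ kappa void (fun=> set0) (fun=> 0) A0 f0).
  have z d' (T : measurableType d') (m : {measure set T -> \bar R}) (f : T -> R) :
      (forall x, f x = 0) -> (sqint m f <= eps%:E)%E.
    move=> fz; rewrite /sqint integral0_eq ?lee_fin ?ltW// => x _.
    by rewrite fz expr0n.
  by split; apply: z => x; rewrite /se_eval /se_int big1 ?subrr//; case.
under eq_fun do rewrite big_cons; under [X in scalar_integral _ _ _ _ X]eq_fun do rewrite big_cons.
exact: scalar_integralD.
Qed.

Variable p : nat.

Lemma sqnormE (v : 'cV[R]_p) : sqnorm v = \sum_i v i ord0 ^+ 2.
Proof. by rewrite /sqnorm mxE; apply: eq_bigr => i _; rewrite mxE expr2. Qed.

Lemma sqr_entry_le_sqnorm (v : 'cV[R]_p) i : v i ord0 ^+ 2 <= sqnorm v.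
Proof.
rewrite sqnormE (bigD1 i)//= lerDl; apply: sumr_ge0 => j _; exact: sqr_ge0.
Qed.

Let eventually_le (u : nat -> \bar R) (eps : R) : 0 < eps -> u @ \oo --> 0%E ->
  \forall n \near \oo, (u n <= eps%:E)%E.
Proof.
move=> eps0 /fine_cvgP[fu /cvgrPdist_le/(_ _ eps0)].
apply: filterS2 fu => n fn; rewrite sub0r normrN => h.
by rewrite -(fineK fn) lee_fin (le_trans (ler_norm _)).
Qed.

Let sqint_entry_le d' (T : measurableType d') (m : {measure set T -> \bar R})
    (v : T -> 'cV[R]_p) i :
  (forall j, measurable_fun setT (fun x => v x j ord0)) ->
  (sqint m (fun x => v x i ord0) <= \int[m]_x (sqnorm (v x))%:E)%E.
Proof.
move=> mv; apply: ge0_le_integral => //.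
- by move=> x _; rewrite lee_fin sqr_ge0.
- exact: measurable_sqr.
- apply/measurable_EFinP; under eq_fun do rewrite sqnormE.
  by apply: measurable_sum => j; exact: measurable_funX.
- by move=> x _; rewrite lee_fin sqr_entry_le_sqnorm.
Qed.

Lemma compensated_integral_entry (f : E -> 'cV[R]_p) (Y : Omega -> 'cV[R]_p) i :
  (forall j, measurable_fun setT (fun x => f x j ord0)) ->
  (forall j, measurable_fun setT (fun w => Y w j ord0)) ->
  is_compensated_integral P kappa N f Y ->
  scalar_integral P kappa N (fun x => f x i ord0) (fun w => Y w i ord0).
Proof.
move=> mf mY [e [h1 h2]]; split=> // eps eps0.
near \oo => n.
have : (\int[kappa]_x (sqnorm (ef_eval (e n) x - f x))%:E <= eps%:E)%E.
  near: n; exact: eventually_le.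
have : (\int[P]_w (sqnorm (ef_integral N (e n) w - Y w))%:E <= eps%:E)%E.
  near: n; exact: eventually_le.
case: (e n) => k A v mA fA H2 H1.
pose se j := @ScalarElementary _ _ _ kappa _ A (fun l => v l j ord0) mA fA.
have E1 j x : ef_eval (ElementaryFun v mA fA) x j ord0 = se_eval (se j) x.
  by rewrite /ef_eval /se_eval summxE; apply: eq_bigr => l _; rewrite mxE mulrC.
have E2 j w : ef_integral N (ElementaryFun v mA fA) w j ord0 = se_int N (se j) w.
  by rewrite /ef_integral /se_int summxE; apply: eq_bigr => l _; rewrite mxE mulrC.
exists (se i); split.
- apply: le_trans H1.
  rewrite (_ : (fun x => _) = (fun x => (ef_eval (ElementaryFun v mA fA) x - f x) i ord0)).
    apply: sqint_entry_le => j.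
    rewrite (_ : (fun x => _) = (fun x => se_eval (se j) x - f x j ord0)).
      by apply: measurable_funB => //; exact: measurable_se_eval.
    by apply/funext => x; rewrite !mxE -/(ef_eval _ _) E1.
  by apply/funext => x; rewrite -E1 [in RHS]mxE [X in _ = _ + X]mxE.
- apply: le_trans H2.
  rewrite (_ : (fun x => _) = (fun x => (ef_integral N (ElementaryFun v mA fA) x - Y x) i ord0)).
    apply: sqint_entry_le => j.
    rewrite (_ : (fun x => _) = (fun x => se_int N (se j) x - Y x j ord0)).
      by apply: measurable_funB => //; exact: (measurable_se_int hN).
    by apply/funext => x; rewrite -E2 [in LHS]mxE [X in _ + X = _]mxE.
  by apply/funext => x; rewrite -E2 [in RHS]mxE [X in _ = _ + X]mxE.
Unshelve. all: by end_near. Qed.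

End scalar_integral_closure.

(** * Recovering the exponent from the characteristic function *)

Section exponent_identification.
Context {R : realType} {dE : measure_display} {E : measurableType dE}.
Context {d : measure_display} {Omega : measurableType d}.
Variables (P : probability Omega R) (kappa : {measure set E -> \bar R}).
Variable N : Omega -> {measure set E -> \bar R}.
Hypothesis hN : poisson_random_measure P kappa N.

(** Equality of complex numbers in polar form; the phases agree modulo [2 pi], recorded as a cosine
    equal to [1]. *)
Lemma expR_cos_sin_inj (a1 a2 b1 b2 : R) :
  expR a1 * cos b1 = expR a2 * cos b2 -> expR a1 * sin b1 = expR a2 * sin b2 ->
  a1 = a2 /\ cos (b1 - b2) = 1.
Proof.
move=> hc hs.
have sq (a b : R) : (expR a * cos b) ^+ 2 + (expR a * sin b) ^+ 2 = expR a ^+ 2.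
  by rewrite !exprMn -mulrDr cos2Dsin2 mulr1.
have E12 : expR a1 ^+ 2 = expR a2 ^+ 2 by rewrite -(sq a1 b1) -(sq a2 b2) hc hs.
have a12 : a1 = a2.
  by apply/expR_inj/eqP; rewrite -(@eqrXn2 _ 2) ?expR_ge0 ?E12.
split => //; subst a2; have ne : expR a1 != 0 by rewrite gt_eqF// expR_gt0.
by rewrite cosB (mulfI ne hc) (mulfI ne hs) -!expr2 cos2Dsin2.
Qed.

Lemma cos_eq1_pi (v : R) : `|v| <= pi -> cos v = 1 -> v = 0.
Proof.
move=> vpi cv; apply/normr0_eq0/(@cos_inj R); rewrite ?in_itv/= ?normr_ge0 ?vpi ?lexx ?pi_ge0//.
by rewrite cos_norm cv cos0.
Qed.

(* Removes the ambiguity of the phase modulo [2 pi] in a characteristic function. *)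
Lemma continuous_cos_eq1 (D : R -> R) : continuous D -> D 0 = 0 ->
  (forall r, cos (D r) = 1) -> D 1 = 0.
Proof.
move=> cD D0 cosD1; apply: contrapT => /eqP D1.
(* [D 1] clipped to [[-pi, pi]]. The intermediate value theorem makes it a value of [D], and [0] is
   the only point of that interval where the cosine is [1]. *)
pose v := if 0 <= D 1 then Num.min (D 1) pi else Num.max (D 1) (- pi).
have [r _ rv] : exists2 r, r \in `[0, 1] & D r = v.
  apply: IVT => //; first exact: continuous_subspaceT.
  rewrite D0 /v; have p0 := @pi_ge0 R; case: (leP 0 (D 1)) => h.
    by rewrite le_min p0 h/= ge_min lexx.
  by rewrite le_max lexx/= ge_max (ltW h) oppr_le0 p0.
have v0 : v = 0.
  apply: cos_eq1_pi; last by rewrite -rv cosD1.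
  rewrite /v; have p0 := @pi_ge0 R; case: (leP 0 (D 1)) => h.
    rewrite ger0_norm; first by rewrite ge_min lexx orbT.
    by rewrite le_min h p0.
  rewrite ler0_norm; first by rewrite lerNl le_max lexx orbT.
  by rewrite ge_max (ltW h) oppr_le0.
move: v0; rewrite /v; have p0 := @pi_gt0 R; case: (leP 0 (D 1)) => h.
  rewrite minEle; case: ifP => _ /eqP; first by rewrite (negbTE D1).
  by rewrite gt_eqF.
rewrite maxEle; case: ifP => _ /eqP; last by rewrite (negbTE D1).
by rewrite oppr_eq0 gt_eqF.
Qed.

Lemma continuous_psin_exponent L Z : scalar_integral P kappa N L Z ->
  continuous (fun r : R => \int[kappa]_x (sin (r * L x) - r * L x)).
Proof.
move=> hL s; have [mL _ _] := hL.
have ir r : kappa.-integrable setT (EFin \o (fun x => sin (r * L x) - r * L x)).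
  by have [_] := scalar_integral_trig_integrable (scalar_integralZ hN r hL).
have sL := scalar_integral_sqint hL.
pose C := fine (sqint kappa L).
have bnd r : `|\int[kappa]_x (sin (s * L x) - s * L x) -
               \int[kappa]_x (sin (r * L x) - r * L x)| <=
    ((s - r) ^+ 2 + `|r| * `|s - r|) * C.
  rewrite -RintegralB//.
  have iD : kappa.-integrable setT (EFin \o (fun x => (sin (s * L x) - s * L x) -
      (sin (r * L x) - r * L x))).
    have := integrableB measurableT (ir s) (ir r).
    by apply: eq_integrable => // x _ /=; rewrite EFinB.
  apply: (le_trans (le_normr_Rintegral _ iD)) => //.
  have iL2 := sqint_integrable mL sL.
  rewrite /C -RintegralZl//; apply: le_Rintegral => //.
  - exact: integrable_norm.
  - have := integrableZl measurableT ((s - r) ^+ 2 + `|r| * `|s - r|) iL2.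
    by apply: eq_integrable.
  - move=> x _; apply: (le_trans (psin_lipschitz _ _)).
    rewrite -mulrBl exprMn !normrM -[L x ^+ 2]ger0_norm ?sqr_ge0// normrX.
    by rewrite le_eqVlt; apply/orP; left; apply/eqP; ring.
apply/cvgrPdist_le => e e0.
have : ((s - r) ^+ 2 + `|r| * `|s - r|) * C @[r --> s] --> ((s - s) ^+ 2 + `|s| * `|s - s|) * C.
  have c1 : s - r @[r --> s] --> s - s by apply: cvgB; [exact: cvg_cst|exact: cvg_id].
  apply: cvgM; last exact: cvg_cst.
  apply: cvgD; first by rewrite expr2; under eq_fun do rewrite expr2; exact: cvgM.
  by apply: cvgM; apply: cvg_norm; [exact: cvg_id|exact: c1].
rewrite subrr expr0n/= normr0 mulr0 addr0 mul0r => /cvgrPdist_le/(_ _ e0).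
apply: filterS => r; rewrite sub0r normrN => h.
by apply: (le_trans (bnd r)); apply: (le_trans _ h); rewrite ler_norm.
Qed.

Lemma scalar_integral_exponent_eq L1 Z1 L2 Z2 :
  scalar_integral P kappa N L1 Z1 -> scalar_integral P kappa N L2 Z2 ->
  (forall r, \int[P]_w cos (r * Z1 w) = \int[P]_w cos (r * Z2 w)) ->
  (forall r, \int[P]_w sin (r * Z1 w) = \int[P]_w sin (r * Z2 w)) ->
  \int[kappa]_x (cos (L1 x) - 1) = \int[kappa]_x (cos (L2 x) - 1) /\
  \int[kappa]_x (sin (L1 x) - L1 x) = \int[kappa]_x (sin (L2 x) - L2 x).
Proof.
move=> h1 h2 hc hs.
pose A L r := \int[kappa]_x (cos (r * L x) - 1).
pose B L r := \int[kappa]_x (sin (r * L x) - r * L x).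
(* Scaling by [r] places the phase difference in a continuous family that vanishes at [r = 0]. *)
have AB r : A L1 r = A L2 r /\ cos (B L1 r - B L2 r) = 1.
  have [c1 s1] := scalar_integral_char hN (scalar_integralZ hN r h1).
  have [c2 s2] := scalar_integral_char hN (scalar_integralZ hN r h2).
  by apply: expR_cos_sin_inj; rewrite /A /B -?c1 -?c2 -?s1 -?s2.
have [A1 _] := AB 1; split.
  move: A1; rewrite /A; under eq_Rintegral do rewrite mul1r.
  by under [X in _ = X -> _]eq_Rintegral do rewrite mul1r.
have : B L1 1 - B L2 1 = 0.
  apply: (@continuous_cos_eq1 (fun r => B L1 r - B L2 r)).
  - by move=> r; apply: cvgB; [exact: (continuous_psin_exponent h1)|exact: (continuous_psin_exponent h2)].
  - have z L : B L 0 = 0.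
      rewrite /B; under eq_Rintegral do rewrite !mul0r sin0 subrr.
      by rewrite /Rintegral integral0.
    by rewrite !z subrr.
  - by move=> r; have [] := AB r.
move=> /eqP; rewrite subr_eq0 => /eqP; rewrite /B; under eq_Rintegral do rewrite !mul1r.
by under [X in _ = X -> _]eq_Rintegral do rewrite !mul1r.
Qed.

End exponent_identification.

(** * Laws of the integrands *)

Section linear_forms.
Context {R : realType} {J : Type}.

(** A list allows repeated indices, so addition of forms is concatenation. *)
Definition lin_comb (r : seq (R * J)) (v : J -> R) : R :=
  \sum_(q <- r) q.1 * v q.2.

Lemma lin_comb_cat r r' v : lin_comb (r ++ r') v = lin_comb r v + lin_comb r' v.
Proof. by rewrite /lin_comb big_cat. Qed.

Definition lin_comb_scale a (r : seq (R * J)) := [seq (a * q.1, q.2) | q <- r].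

Lemma lin_comb_scaleE a r v : lin_comb (lin_comb_scale a r) v = a * lin_comb r v.
Proof.
by rewrite /lin_comb big_map mulr_sumr; apply: eq_bigr => q _; rewrite mulrA.
Qed.

Lemma lin_comb1 a j v : lin_comb [:: (a, j)] v = a * v j.
Proof. by rewrite /lin_comb big_seq1. Qed.

Variables (S : Type) (ev : S -> J -> R).

Definition lin_forms : set (S -> R) := [set l | exists r, l = fun x => lin_comb r (ev x)].

Lemma lin_formsD l l' : lin_forms l -> lin_forms l' -> lin_forms (fun x => l x + l' x).
Proof.
move=> [r ->] [r' ->]; exists (r ++ r').
by apply/funext => x; rewrite lin_comb_cat.
Qed.

Lemma lin_formsZ a l : lin_forms l -> lin_forms (fun x => a * l x).
Proof.
move=> [r ->]; exists (lin_comb_scale a r).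
by apply/funext => x; rewrite lin_comb_scaleE.
Qed.

Lemma lin_forms_coord a j : lin_forms (fun x => a * ev x j).
Proof. by exists [:: (a, j)]; apply/funext => x; rewrite lin_comb1. Qed.

End linear_forms.

Lemma measurable_lin_forms {R : realType} {J : Type} {d : measure_display}
    {S : measurableType d} (ev : S -> J -> R) :
  (forall j, measurable_fun setT (ev^~ j)) ->
  forall l, lin_forms ev l -> measurable_fun setT l.
Proof.
move=> mev l [r ->]; apply: measurable_sum => q.
exact: measurable_funM.
Qed.

Section weighted_characteristic.
Context {R : realType} {d : measure_display} {E : measurableType d}.
Variable k : {measure set E -> \bar R}.
Implicit Types u v : E -> R.

Definition trig_integrable u :=
  k.-integrable setT (EFin \o (fun x => cos (u x) - 1)) /\
  k.-integrable setT (EFin \o (fun x => sin (u x) - u x)).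

Let A u := \int[k]_x (cos (u x) - 1).
Let B u := \int[k]_x (sin (u x) - u x).

(* The weight [1 - cos v] makes [cos (u + c)] integrable against a measure for
   which only [cos - 1] and [sin - id] are; product formulas reduce it to those. *)
Lemma Rintegral_weighted_cos u v c :
  trig_integrable u -> trig_integrable (fun x => u x + v x) ->
  trig_integrable (fun x => u x - v x) ->
  \int[k]_x (cos (u x + c) * (1 - cos (v x))) =
  cos c * (A u - 2^-1 * (A (fun x => u x + v x) + A (fun x => u x - v x))) -
  sin c * (B u - 2^-1 * (B (fun x => u x + v x) + B (fun x => u x - v x))).
Proof.
move=> [cu su] [cp sp] [cm sm].
have iZ a (f : E -> R) : k.-integrable setT (EFin \o f) ->
    k.-integrable setT (EFin \o (fun x => a * f x)).
  by move=> fi; have := integrableZl measurableT a fi; apply: eq_integrable.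
have iD (f g : E -> R) : k.-integrable setT (EFin \o f) -> k.-integrable setT (EFin \o g) ->
    k.-integrable setT (EFin \o (fun x => f x + g x)).
  by move=> fi gi; have := integrableD measurableT fi gi; apply: eq_integrable.
have comb (f g h : E -> R) : k.-integrable setT (EFin \o f) ->
    k.-integrable setT (EFin \o g) -> k.-integrable setT (EFin \o h) ->
    k.-integrable setT (EFin \o (fun x => f x + - 2^-1 * (g x + h x))) /\
    \int[k]_x (f x + - 2^-1 * (g x + h x)) =
    \int[k]_x f x - 2^-1 * (\int[k]_x g x + \int[k]_x h x).
  move=> fi gi hi; have igh := iD _ _ gi hi; have iZgh := iZ (- 2^-1) _ igh.
  split; first exact: (iD _ _ fi iZgh).
  by rewrite (RintegralD _ fi iZgh)// RintegralZl// mulNr RintegralD.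
have [iC EC] := comb _ _ _ cu cp cm; have [iS ES] := comb _ _ _ su sp sm.
have iC' := iZ (cos c) _ iC; have iS' := iZ (- sin c) _ iS.
rewrite -EC -ES -[in RHS]mulNr -!RintegralZl// -RintegralD//.
apply: eq_Rintegral => x _.
by rewrite /= !(cosB, sinB, cosD, sinD); field.
Qed.

Lemma trig_integrable_weight v : trig_integrable v ->
  k.-integrable setT (fun x => (1 - cos (v x))%:E).
Proof.
move=> [/(integrableN) + _]; apply: eq_integrable => // x _ /=.
by rewrite opprB.
Qed.

End weighted_characteristic.

Lemma scalar_integral_lin_comb {R : realType} {dE : measure_display}
    {E : measurableType dE} {d : measure_display} {Omega : measurableType d}
    (P : probability Omega R) (kappa : {measure set E -> \bar R})
    (N : Omega -> {measure set E -> \bar R}) (J : Type) (g : E -> J -> R)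
    (Z : Omega -> J -> R) r :
  poisson_random_measure P kappa N ->
  (forall j, scalar_integral P kappa N (g^~ j) (Z^~ j)) ->
  scalar_integral P kappa N (fun x => lin_comb r (g x)) (fun w => lin_comb r (Z w)).
Proof.
move=> hN hZ; apply: (scalar_integral_sum hN r
  (L := fun q x => q.1 * g x q.2) (Z := fun q w => q.1 * Z w q.2)) => q.
exact: (scalar_integralZ hN).
Qed.

Section integrand_law.
Context {R : realType} {dE : measure_display} {E : measurableType dE}.
Context {d : measure_display} {Omega : measurableType d}.
Variables (P : probability Omega R) (kappa : {measure set E -> \bar R}).
Variable N : Omega -> {measure set E -> \bar R}.
Hypothesis hN : poisson_random_measure P kappa N.
Context {dS : measure_display} {S : measurableType dS} {J : Type}.
Variables (F1 F2 : E -> S) (ev : S -> J -> R) (Z1 Z2 : Omega -> J -> R).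
Hypotheses (mF1 : measurable_fun setT F1) (mF2 : measurable_fun setT F2).
Hypothesis mev : forall j, measurable_fun setT (ev^~ j).
Hypothesis hZ1 : forall j, scalar_integral P kappa N (fun x => ev (F1 x) j) (Z1^~ j).
Hypothesis hZ2 : forall j, scalar_integral P kappa N (fun x => ev (F2 x) j) (Z2^~ j).
Hypothesis hcos : forall r,
  \int[P]_w cos (lin_comb r (Z1 w)) = \int[P]_w cos (lin_comb r (Z2 w)).
Hypothesis hsin : forall r,
  \int[P]_w sin (lin_comb r (Z1 w)) = \int[P]_w sin (lin_comb r (Z2 w)).

Let lin_integral (F : E -> S) (Z : Omega -> J -> R) :
  (forall j, scalar_integral P kappa N (fun x => ev (F x) j) (Z^~ j)) ->
  forall r, scalar_integral P kappa N (fun x => lin_comb r (ev (F x)))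
    (fun w => lin_comb r (Z w)).
Proof.
move=> hZ r.
exact: (scalar_integral_lin_comb (g := fun x => ev (F x)) r hN hZ).
Qed.

Let exponent_eq r :
  \int[kappa]_x (cos (lin_comb r (ev (F1 x))) - 1) =
  \int[kappa]_x (cos (lin_comb r (ev (F2 x))) - 1) /\
  \int[kappa]_x (sin (lin_comb r (ev (F1 x))) - lin_comb r (ev (F1 x))) =
  \int[kappa]_x (sin (lin_comb r (ev (F2 x))) - lin_comb r (ev (F2 x))).
Proof.
apply: (scalar_integral_exponent_eq hN (lin_integral hZ1 r) (lin_integral hZ2 r)) => a.
- have := hcos (lin_comb_scale a r).
  under eq_Rintegral do rewrite lin_comb_scaleE.
  by under [X in _ = X -> _]eq_Rintegral do rewrite lin_comb_scaleE.
- have := hsin (lin_comb_scale a r).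
  under eq_Rintegral do rewrite lin_comb_scaleE.
  by under [X in _ = X -> _]eq_Rintegral do rewrite lin_comb_scaleE.
Qed.

(** The weighted integrals involve only the exponents of the forms [r], [r + r0] and [r - r0], which
    agree for both families. *)
Lemma integrand_law_weighted l0 B : lin_forms ev l0 ->
  <<s half_spaces (lin_forms ev) >> B ->
  kappa (F1 @^-1` (B `&` [set x | cos (l0 x) != 1])) =
  kappa (F2 @^-1` (B `&` [set x | cos (l0 x) != 1])).
Proof.
move=> Ll0 sB; have [r0 r0E] := Ll0.
have ti F Z r : (forall j, scalar_integral P kappa N (fun x => ev (F x) j) (Z^~ j)) ->
    trig_integrable kappa (fun x => lin_comb r (ev (F x))).
  by move=> hZ; exact: scalar_integral_trig_integrable (lin_integral hZ r).
apply: (eq_cos_weighted mF1 mF2 (measurable_lin_forms mev)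
  (@lin_formsD _ _ _ ev) (@lin_formsZ _ _ _ ev) Ll0) => //.
- by rewrite r0E; exact: trig_integrable_weight (ti _ _ r0 hZ1).
- by rewrite r0E; exact: trig_integrable_weight (ti _ _ r0 hZ2).
move=> l c [r rE]; rewrite rE r0E.
pose rp := r ++ r0; pose rm := r ++ lin_comb_scale (- 1) r0.
have pE x : lin_comb r (ev x) + lin_comb r0 (ev x) = lin_comb rp (ev x).
  by rewrite lin_comb_cat.
have mE x : lin_comb r (ev x) - lin_comb r0 (ev x) = lin_comb rm (ev x).
  by rewrite lin_comb_cat lin_comb_scaleE mulN1r.
have tp F Z : (forall j, scalar_integral P kappa N (fun x => ev (F x) j) (Z^~ j)) ->
    trig_integrable kappa (fun x => lin_comb r (ev (F x)) + lin_comb r0 (ev (F x))).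
  by move=> hZ; under eq_fun do rewrite pE; exact: ti hZ.
have tm F Z : (forall j, scalar_integral P kappa N (fun x => ev (F x) j) (Z^~ j)) ->
    trig_integrable kappa (fun x => lin_comb r (ev (F x)) - lin_comb r0 (ev (F x))).
  by move=> hZ; under eq_fun do rewrite mE; exact: ti hZ.
rewrite (Rintegral_weighted_cos c (ti _ _ r hZ1) (tp _ _ hZ1) (tm _ _ hZ1)).
rewrite (Rintegral_weighted_cos c (ti _ _ r hZ2) (tp _ _ hZ2) (tm _ _ hZ2)).
have [-> ->] := exponent_eq r.
have [Ep Sp] := exponent_eq rp; have [Em Sm] := exponent_eq rm.
have ext (phi : R -> R) (F : E -> S) (g : S -> R) s :
    (forall x, g x = lin_comb s (ev x)) ->
    \int[kappa]_x phi (g (F x)) = \int[kappa]_x phi (lin_comb s (ev (F x))).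
  by move=> gE; apply: eq_Rintegral => x _; rewrite gE.
rewrite (ext (fun y => cos y - 1) F1 _ _ pE) (ext (fun y => cos y - 1) F1 _ _ mE).
rewrite (ext (fun y => sin y - y) F1 _ _ pE) (ext (fun y => sin y - y) F1 _ _ mE).
rewrite (ext (fun y => cos y - 1) F2 _ _ pE) (ext (fun y => cos y - 1) F2 _ _ mE).
rewrite (ext (fun y => sin y - y) F2 _ _ pE) (ext (fun y => sin y - y) F2 _ _ mE).
by rewrite Ep Em Sp Sm.
Qed.

End integrand_law.

Section half_space_generation.
Context {R : realType}.

Lemma half_spaces_measurable_id {d : measure_display} {S : measurableType d}
    {J : Type} (ev : S -> J -> R) j :
  measurable_fun [set: g_sigma_algebraType (half_spaces (lin_forms ev))]
    (fun x : g_sigma_algebraType (half_spaces (lin_forms ev)) => ev x j).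
Proof.
apply: (measurability _ (RGenOInfty.measurableE R)).
move=> _ [_ [c ->] <-]; rewrite setTI; apply: sub_sigma_algebra.
exists (fun x => 1 * ev x j), c; split; first exact: lin_forms_coord.
by apply/seteqP; split=> x /=; rewrite in_itv/= andbT mul1r.
Qed.

Definition tuple_coord {p n} (x : n.-tuple (borel_cV R p)) (j : 'I_n * 'I_p) : R :=
  (tnth x j.1 : 'cV[R]_p) j.2 ord0.

Lemma measurable_tuple_coord {p n} (j : 'I_n * 'I_p) :
  measurable_fun setT ((@tuple_coord p n)^~ j).
Proof.
exact: (measurableT_comp (measurable_cV_coord j.2) (measurable_tnth j.1)).
Qed.

(** Measurability of the identity out of the half-space sigma-algebra is the inclusion of
    sigma-algebras, and it can be checked on coordinates. *)
Lemma half_spaces_tuple {p n} (B : set (n.-tuple (borel_cV R p))) :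
  measurable B -> <<s half_spaces (lin_forms (@tuple_coord p n)) >> B.
Proof.
pose S' := g_sigma_algebraType (half_spaces (lin_forms (@tuple_coord p n))).
have mid : measurable_fun [set: S'] (id : S' -> n.-tuple (borel_cV R p)).
  apply/measurable_fun_tnthP => k; apply: measurable_cV_coordP => i.
  have H := (@half_spaces_measurable_id _ _ _ (@tuple_coord p n) (k, i)).
  exact: H.
by move=> mB; have := mid measurableT _ mB; rewrite setTI.
Qed.

(** Cylinders over all real times: their preimages under the path map are exactly the generators in
    the minimality condition. *)
Definition path_gen (p : nat) : set (set (R -> borel_cV R p)) :=
  [set A | exists t, exists2 B, measurable B & A = (fun pi => pi t) @^-1` B].

Definition path_space (p : nat) := g_sigma_algebraType (@path_gen p).

Lemma measurable_path_eval {p} t :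
  measurable_fun setT (fun pi : path_space p => pi t).
Proof. by move=> _ B mB; rewrite setTI; apply: sub_sigma_algebra; exists t, B. Qed.

Lemma measurable_pathP {p d} {E : measurableType d} (F : E -> path_space p) :
  (forall t, measurable_fun setT (fun x => F x t)) -> measurable_fun setT F.
Proof.
move=> mF; apply: (@measurability _ _ E (path_space p) setT F (@path_gen p) erefl).
move=> _ [_ [t [B mB ->]] <-]; rewrite -comp_preimage; exact: mF.
Qed.

Definition path_coord {p} (pi : path_space p) (j : R * 'I_p) : R :=
  (pi j.1 : 'cV[R]_p) j.2 ord0.

Lemma measurable_path_coord {p} (j : R * 'I_p) :
  measurable_fun setT ((@path_coord p)^~ j).
Proof.
exact: (measurableT_comp (measurable_cV_coord j.2) (measurable_path_eval j.1)).
Qed.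

Lemma half_spaces_path {p} (B : set (path_space p)) :
  measurable B -> <<s half_spaces (lin_forms (@path_coord p)) >> B.
Proof.
pose S' := g_sigma_algebraType (half_spaces (lin_forms (@path_coord p))).
have mid : measurable_fun [set: S'] (id : S' -> path_space p).
  apply: measurable_pathP => t; apply: measurable_cV_coordP => i.
  have H := (@half_spaces_measurable_id _ _ _ (@path_coord p) (t, i)).
  exact: H.
by move=> mB; have := mid measurableT _ mB; rewrite setTI.
Qed.

End half_space_generation.

Section countable_cover.
Context {R : realType} {dE : measure_display} {E : measurableType dE}.
Context {dS : measure_display} {S : measurableType dS}.
Variable kappa : {measure set E -> \bar R}.
Variables (F1 F2 : E -> S) (C : nat -> set S).
Hypotheses (mF1 : measurable_fun setT F1) (mF2 : measurable_fun setT F2).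
Hypothesis mC : forall k, measurable (C k).
Hypothesis C1 : {ae kappa, forall x, exists k, C k (F1 x)}.
Hypothesis C2 : {ae kappa, forall x, exists k, C k (F2 x)}.

(** The cover is made disjoint. Each disjoint piece of [B] is the part of a smaller measurable set
    in a single [C k], so the hypothesis applies to it. *)
Lemma eq_measure_countable_cover :
  (forall k B, measurable B ->
    kappa (F1 @^-1` (B `&` C k)) = kappa (F2 @^-1` (B `&` C k))) ->
  forall B, measurable B -> kappa (F1 @^-1` B) = kappa (F2 @^-1` B).
Proof.
move=> hC B mB.
have mD k : measurable (seqDU C k).
  by apply: measurableD => //; exact: bigsetU_measurable.
have H (F : E -> S) : measurable_fun setT F -> {ae kappa, forall x, exists k, C k (F x)} ->
    kappa (F @^-1` B) = (\sum_(k <oo) kappa (F @^-1` (B `&` seqDU C k)))%E.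
  move=> mF CF; have mF' A : measurable A -> measurable (F @^-1` A).
    by move=> mA; rewrite -[_ @^-1` _]setTI; exact: mF.
  rewrite -measure_semi_bigcup//; last 3 first.
  - by move=> k; apply: mF'; exact: measurableI.
  - move=> i j _ _ [x [[_ Di] [_ Dj]]].
    by apply: (@trivIset_seqDU _ C i j) => //; exists (F x).
  - by apply: bigcupT_measurable => k; apply: mF'; exact: measurableI.
  have [U [mU U0 CU]] := CF.
  apply/eqP; rewrite eq_le; apply/andP; split.
    rewrite -[leRHS]adde0 -U0.
    apply: (le_trans _ (measureU2 _ _ _)) => //; last first.
      by apply: bigcupT_measurable => k; apply: mF'; exact: measurableI.
    apply: le_measure; rewrite ?inE//; first exact: mF'.
      apply: measurableU => //.
      by apply: bigcupT_measurable => k; apply: mF'; exact: measurableI.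
    move=> x Bx; have [[k Ck]|nC] := pselect (exists k, C k (F x)); last first.
      by right; apply: CU.
    left; have : (\bigcup_k C k) (F x) by exists k.
    rewrite seqDU_bigcup_eq => -[j _ Dj]; exists j => //; split => //.
  apply: le_measure; rewrite ?inE; [|exact: mF'|by move=> x [k _ []]].
  by apply: bigcupT_measurable => k; apply: mF'; exact: measurableI.
rewrite (H _ mF1 C1) (H _ mF2 C2); apply: eq_eseriesr => k _.
have -> : B `&` seqDU C k = (B `\` \big[setU/set0]_(j < k) C j) `&` C k.
  by apply/seteqP; split=> x /=; rewrite /seqDU /=; tauto.
by apply: hC; apply: measurableD => //; exact: bigsetU_measurable.
Qed.

End countable_cover.

(** * Image measures and factorization *)

Section law_lemmas.
Context {R : realType}.

Lemma eq_law_Rintegral {dS : measure_display} {S : measurableType dS}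
    {d1 : measure_display} {E1 : measurableType d1} {d2 : measure_display}
    {E2 : measurableType d2} (k1 : {measure set E1 -> \bar R})
    (k2 : {measure set E2 -> \bar R}) (F1 : E1 -> S) (F2 : E2 -> S) (h : S -> R) :
  measurable_fun setT F1 -> measurable_fun setT F2 -> measurable_fun setT h ->
  (forall B, measurable B -> k1 (F1 @^-1` B) = k2 (F2 @^-1` B)) ->
  k1.-integrable setT (EFin \o (h \o F1)) -> k2.-integrable setT (EFin \o (h \o F2)) ->
  \int[k1]_x h (F1 x) = \int[k2]_x h (F2 x).
Proof.
move=> mF1 mF2 mh hk i1 i2; rewrite /Rintegral; congr fine.
have mEh : measurable_fun setT (EFin \o h) by exact/measurable_EFinP.
have := @integral_pushforward _ _ _ _ R F1 mF1 k1 setT (EFin \o h) mEh i1 measurableT.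
have := @integral_pushforward _ _ _ _ R F2 mF2 k2 setT (EFin \o h) mEh i2 measurableT.
rewrite !preimage_setT => <- <-.
by apply: eq_measure_integral => A mA _; exact: hk.
Qed.

Lemma ae_countable {d : measure_display} {T : measurableType d} (J : countType)
    (m : {measure set T -> \bar R}) (Q : J -> T -> Prop) :
  (forall j, {ae m, forall x, Q j x}) -> {ae m, forall x, forall j, Q j x}.
Proof.
move=> hQ.
have : {ae m, forall x, forall n : nat, forall j, unpickle n = Some j -> Q j x}.
  apply: ae_foralln => n; case: (unpickle n) => [j|].
    by have := hQ j; apply: filterS => x Qx j' [<-].
  exact: aeW.
by apply: filterS => x H j; apply: (H (pickle j)); exact: pickleK.
Qed.

(* A function measurable modulo null sets for the sigma-algebra generated by [F]
   factors through [F]: take [h pi] to be the infimum of the rationals [q] such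
   that [pi] lies in the set representing [y < q]. *)
Lemma ae_factor {d : measure_display} {E : measurableType d} {dS : measure_display}
    {S : measurableType dS} (k : {measure set E -> \bar R}) (F : E -> S) (y : E -> R) :
  measurable_fun setT F -> measurable_fun setT y ->
  (forall C, measurable C -> exists2 B, measurable B & k (C `+` F @^-1` B) = 0%E) ->
  exists2 h : S -> R, measurable_fun setT h & {ae k, forall x, h (F x) = y x}.
Proof.
move=> mF my hF; pose C (q : rat) := [set x | y x < ratr q].
have mC q : measurable (C q).
  rewrite -[X in measurable X]setTI (_ : C q = y @^-1` `]-oo, ratr q[).
    exact: my.
  by apply/seteqP; split => x /=; rewrite in_itv.
have /choice[B hB] : forall q, exists B, measurable B /\ k (C q `+` F @^-1` B) = 0%E.
  by move=> q; have [B ? ?] := hF _ (mC q); exists B.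
pose g (n : nat) (pi : S) : \bar R :=
  if unpickle n is Some q then if pi \in B q then (ratr q)%:E else +oo%E else +oo%E.
have mg n : measurable_fun setT (g n).
  rewrite /g; case: (unpickle n) => [q|]; last exact: measurable_cst.
  apply: measurable_fun_ifT => //; apply: (@measurable_fun_bool _ _ _ _ true).
  rewrite setTI (_ : _ @^-1` _ = B q); first by have [] := hB q.
  by apply/seteqP; split => x /=; [move/set_mem|move/mem_set].
pose H pi := einfs (g^~ pi) 0%N.
exists (fine \o H).
  exact: (measurableT_comp (@fine_measurable _ _ measurableT) (measurable_fun_einfs mg 0)).
have : {ae k, forall x, forall q, C q x <-> B q (F x)}.
  apply: ae_countable => q; have [mB kB] := hB q.
  exists (C q `+` F @^-1` B q); split => //.
    have mFB : measurable (F @^-1` B q) by rewrite -[_ @^-1` _]setTI; exact: mF.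
    by rewrite setY_def; apply: measurableU; exact: measurableD.
  rewrite setY_def => x /= nCB.
  have [Cx|nCx] := pselect (C q x); have [Bx|nBx] := pselect (B q (F x)).
  - by exfalso; apply: nCB.
  - by left.
  - by right.
  - by exfalso; apply: nCB; split.
apply: filterS => x CB /=; rewrite (_ : H (F x) = (y x)%:E)//.
apply/eqP; rewrite eq_le; apply/andP; split.
- apply/lee_addgt0Pr => e e0.
  have ye : y x < y x + e by rewrite ltrDl.
  have [q] := rat_in_itvoo ye; rewrite in_itv/= => /andP[yq qe].
  apply: (@le_trans _ _ (ratr q)%:E); last by rewrite -EFinD lee_fin ltW.
  apply: ereal_inf_lbound; exists (pickle q) => //=.
  by rewrite /g pickleK mem_set//; apply/CB.
- apply: le_ereal_inf_tmp => _ [n _ <-]; rewrite /g; case: (unpickle n) => [q|]; last exact: leey.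
  by case: ifPn => [/set_mem/CB Cq|_]; [rewrite lee_fin ltW|exact: leey].
Qed.

(** Carries to reversed paths a property that almost every path has, here that of being reproduced
    by the left inverse at a given time. *)
Lemma ae_law {d : measure_display} {E : measurableType d} {dS : measure_display}
    {S : measurableType dS} (k : {measure set E -> \bar R}) (F1 F2 : E -> S) (T : set S) :
  measurable_fun setT F1 -> measurable_fun setT F2 ->
  (forall B, measurable B -> k (F1 @^-1` B) = k (F2 @^-1` B)) ->
  measurable T -> {ae k, forall x, T (F1 x)} -> {ae k, forall x, T (F2 x)}.
Proof.
move=> mF1 mF2 law mT [U [mU U0 TU]]; have mTC := measurableC mT.
have mpre (F : E -> S) : measurable_fun setT F -> measurable (F @^-1` (~` T)).
  by move=> mF; rewrite -[_ @^-1` _]setTI; exact: mF.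
exists (F2 @^-1` (~` T)); split => //; first exact: mpre.
rewrite -law//; apply/eqP; rewrite eq_le measure_ge0 andbT -U0.
by apply: le_measure; rewrite ?inE//; exact: mpre.
Qed.

Lemma ae_eq_measure {d : measure_display} {E : measurableType d}
    (k : {measure set E -> \bar R}) (A B : set E) : measurable A -> measurable B ->
  {ae k, forall x, A x <-> B x} -> k A = k B.
Proof.
move=> mA mB AB; rewrite -[A]setIT -[B]setIT -!integral_indic//.
apply: ae_eq_integral => //; try exact/measurable_EFinP.
apply: filterS AB => x xAB _; rewrite !indicE.
suff -> : (x \in A) = (x \in B) by [].
by apply/idP/idP => /set_mem h; apply/mem_set/xAB.
Qed.

End law_lemmas.

Section intensity_lemmas.
Context {R : realType} {p : nat} (mu : {measure set (borel_cV R p) -> \bar R}).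

Lemma intensity_setX (A : set (measurableTypeR R)) (B : set (borel_cV R p)) :
  measurable A -> measurable B ->
  intensity mu (A `*` B) = (lebesgue_measure A * mu B)%E.
Proof. by move=> mA mB; exact: product_measure2E. Qed.

Lemma intensity_ae (Q : borel_cV R p -> Prop) :
  {ae mu, forall z, Q z} -> {ae intensity mu, forall x, Q x.2}.
Proof.
move=> [U [mU U0 QU]]; exists (setT `*` U); split.
- exact: measurableX.
- by rewrite intensity_setX// U0 mule0.
- by move=> x /= nQ; split => //; apply: QU.
Qed.

(** The line has infinite Lebesgue measure, so its product with a set is null only if that set
    is. *)
Lemma intensity_aeW (Q : borel_cV R p -> Prop) : measurable [set z | Q z] ->
  {ae intensity mu, forall x, Q x.2} -> {ae mu, forall z, Q z}.
Proof.
move=> mQ [U [mU U0 QU]]; exists (~` [set z | Q z]); split => //; first exact: measurableC.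
have mQC : measurable (~` [set z | Q z]) by exact: measurableC.
have : (intensity mu (setT `*` ~` [set z | Q z]) = 0)%E.
  apply/eqP; rewrite eq_le measure_ge0 andbT -U0; apply: le_measure; rewrite ?inE//.
    exact: measurableX.
  by move=> x [_ nQ]; apply: QU.
rewrite intensity_setX// -set_itvNyy lebesgue_measure_itv/= => h.
apply/eqP/negPn/negP => mN0; move: h => /eqP; rewrite mule_eq0/= (negbTE mN0).
by [].
Qed.

(** The product integrates over [z] the Lebesgue measure of the section at [z]; reflection is
    absorbed inside each section and [M] in the outer integral. *)
Lemma intensity_reflect (M : 'M[R]_p) :
  (forall C : set (borel_cV R p), measurable C ->
    mu ((fun z => M *m (z : 'cV[R]_p)) @^-1` C) = mu C) ->
  forall C : set (measurableTypeR R * borel_cV R p), measurable C ->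
  intensity mu [set x | C (- x.1, M *m (x.2 : 'cV[R]_p))] = intensity mu C.
Proof.
move=> hM C mC; pose g (z : borel_cV R p) : borel_cV R p := M *m (z : 'cV[R]_p).
have mg : measurable_fun setT g by exact: measurable_mulmx_cV.
rewrite /intensity/= /product_measure2.
transitivity (\int[mu]_z ((lebesgue_measure \o ysection C) \o g) z)%E.
  apply: eq_integral => z _ /=.
  rewrite -(lebesgue_measureN (measurable_ysection (g z) mC)) /pushforward.
  by congr (lebesgue_measure _); apply/seteqP; split=> s; rewrite /ysection/= !inE.
have mC' : measurable_fun setT (lebesgue_measure \o ysection C : borel_cV R p -> \bar R).
  exact: measurable_fun_ysection.
have := ge0_integral_pushforward mg mu measurableT mC'.
rewrite preimage_setT => <-; last by move=> z _; exact: measure_ge0.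
by apply: eq_measure_integral => A mA _; exact: hM.
Qed.

End intensity_lemmas.

Lemma kern0 {R : realType} {p : nat} (D : 'M[R]_p) t s : kern D t s 0 0 = 0.
Proof. by rewrite /kern [X in X + _]mulmx0 [X in _ + X]mulmx0 add0r. Qed.

(** * Time reversal *)

Section reversal.
Context {R : realType} {p : nat}.
Variables (H Mp Mm : 'M[R]_p) (mu : {measure set (borel_cV R p) -> \bar R}).
Hypothesis hH : forall x, Re_eig H x -> 0 < x < 1 /\ x != 2^-1.
Hypotheses (hMp : Mp \in unitmx) (hMm : Mm \in unitmx).

Let D := H - (2^-1)%:M.
Let E : measurableType _ := (measurableTypeR R * borel_cV R p)%type.
Let kappa := intensity mu.
Let f := maofLm_integrand H Mp Mm.

(** A kernel vector of [D] would be an eigenvector of [H] for [1/2], the excluded value. *)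
Let D0 (u : 'cV[R]_p) : D *m u = 0 -> u = 0.
Proof.
move=> Du; apply/eqP/negPn/negP => u0.
have Hu : H *m u = 2^-1 *: u.
  by apply/eqP; rewrite -subr_eq0 -mul_scalar_mx -mulmxBl -/D Du.
by have [_] := hH (Re_eig_kernel Hu u0); rewrite eqxx.
Qed.

(** A fixed vector of [D] would give [H] the eigenvalue [3/2], beyond the bound [1]. *)
Let D1 (u : 'cV[R]_p) : D *m u = u -> u = 0.
Proof.
move=> Du; apply/eqP/negPn/negP => u0.
have Hu : H *m u = (1 + 2^-1) *: u.
  rewrite scalerDl scale1r -[X in X + _]Du /D mulmxBl mul_scalar_mx.
  by rewrite subrK.
have [/andP[_]] := hH (Re_eig_kernel Hu u0).
by rewrite ltNge lerDl invr_ge0 ler0n.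
Qed.

Let fE t (x : E) : f t x = kern D t x.1 (Mp *m (x.2 : 'cV[R]_p)) (Mm *m (x.2 : 'cV[R]_p)).
Proof. exact: maofLm_kernelE. Qed.

Let mf t : measurable_fun setT (f t).
Proof. exact: measurable_maofLm_integrand. Qed.

(** With [A = Mm^-1 Mp], [Mm A z = Mp z] always holds, and the involution adds [Mp A z = Mm z]; so
    [A] realizes the exchange of coefficients that reversal produces. *)
Lemma involution_kernel_swap (z : 'cV[R]_p) :
  invmx Mm *m Mp *m z = invmx Mp *m Mm *m z ->
  forall t s : R,
  maofLm_kernel H Mp Mm (- t) s *m z =
    maofLm_kernel H Mp Mm t (- s) *m invmx Mm *m Mp *m z /\
  maofLm_kernel H Mp Mm t (- s) *m invmx Mm *m Mp *m z =
    maofLm_kernel H Mp Mm t (- s) *m invmx Mp *m Mm *m z.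
Proof.
move=> Az t s; set K := maofLm_kernel H Mp Mm t (- s).
have KA : K *m invmx Mm *m Mp *m z = K *m (invmx Mm *m Mp *m z) by rewrite !mulmxA.
have KB : K *m invmx Mp *m Mm *m z = K *m (invmx Mp *m Mm *m z) by rewrite !mulmxA.
have E1 : Mp *m (invmx Mm *m Mp *m z) = Mm *m z.
  by rewrite Az !mulmxA mulmxV// mul1mx.
have E2 : Mm *m (invmx Mm *m Mp *m z) = Mp *m z by rewrite !mulmxA mulmxV// mul1mx.
rewrite KA KB -Az; split => //.
apply: (etrans (maofLm_kernelE H Mp Mm (- t) s z)).
apply: (etrans (kernN _ t s _ _)); rewrite -E1 -[in X in kern _ _ _ _ X]E2.
exact: (esym (maofLm_kernelE H Mp Mm t (- s) _)).
Qed.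

Lemma reversal_preserves_intensity :
  (forall C : set (borel_cV R p), measurable C ->
    mu [set invmx Mm *m Mp *m z | z in (C : set 'cV[R]_p)] = mu C) ->
  forall C : set E, measurable C ->
  kappa [set x | C (- x.1, invmx Mm *m Mp *m (x.2 : 'cV[R]_p))] = kappa C.
Proof.
move=> hb C mC; apply: intensity_reflect => // B mB.
set A := invmx Mm *m Mp; have uA : A \in unitmx by rewrite unitmx_mul unitmx_inv hMm.
have mAB : measurable ((fun z : borel_cV R p => (A *m (z : 'cV[R]_p) : borel_cV R p)) @^-1` B).
  by rewrite -[_ @^-1` _]setTI; exact: measurable_mulmx_cV.
rewrite -(hb _ mAB); congr (mu _); apply/seteqP; split=> [_ [z Bz <-]//|z Bz].
by exists (invmx A *m z); rewrite /= -/A mulKVmx.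
Qed.

(** [Mm^-1 Mp] and [Mp^-1 Mm] are inverse to each other whether or not they coincide; as a preimage
    the set is visibly measurable. *)
Lemma swap_in_mu_preserving (C : set (borel_cV R p)) :
  [set invmx Mm *m Mp *m z | z in (C : set 'cV[R]_p)] =
  (fun z : borel_cV R p => (invmx Mp *m Mm *m (z : 'cV[R]_p) : borel_cV R p)) @^-1` C.
Proof.
have BA : invmx Mp *m Mm *m (invmx Mm *m Mp) = 1%:M by rewrite mulmxA mulmxK// mulVmx.
have AB : invmx Mm *m Mp *m (invmx Mp *m Mm) = 1%:M by rewrite mulmxA mulmxK// mulVmx.
apply/seteqP; split=> [_ [z Cz <-]|z Cz] /=; first by rewrite mulmxA BA mul1mx.
by exists (invmx Mp *m Mm *m z) => //; rewrite mulmxA AB mul1mx.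
Qed.

Lemma measurable_involution :
  measurable [set z : borel_cV R p |
    invmx Mm *m Mp *m (z : 'cV[R]_p) = invmx Mp *m Mm *m (z : 'cV[R]_p)].
Proof.
rewrite (_ : [set z | _] = \bigcap_(i in [set: 'I_p]) ((fun z : borel_cV R p =>
    (invmx Mm *m Mp *m (z : 'cV[R]_p)) i ord0 ==
    (invmx Mp *m Mm *m (z : 'cV[R]_p)) i ord0) @^-1` [set true])).
  apply: fin_bigcap_measurable => // i _; rewrite -[_ @^-1` _]setTI.
  apply: measurable_fun_eqr => //;
    exact: (measurableT_comp (measurable_cV_coord i) (measurable_mulmx_cV _)).
apply/seteqP; split=> [z /= zE i _|z h] /=.
  by apply/eqP; exact: (congr1 (fun v : 'cV_p => v i ord0) zE).
by apply/matrixP => i j; rewrite ord1; apply/eqP; exact: (h i Logic.I).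
Qed.

(** * Between laws of the process and laws of its paths *)

Section laws.
Context {d : measure_display} {Omega : measurableType d} (P : probability Omega R).
Variables (N : Omega -> {measure set (measurableTypeR R * borel_cV R p) -> \bar R})
  (Y : R -> {RV P >-> borel_cV R p}).
Hypothesis hN : poisson_random_measure P kappa N.
Hypothesis hY : forall t, is_compensated_integral P kappa N (f t) (Y t).

Let mY t : measurable_fun setT (Y t : Omega -> borel_cV R p).
Proof. exact: measurable_funPT. Qed.

Lemma integrand_scalar_integral t i :
  scalar_integral P kappa N (fun x => (f t x : 'cV[R]_p) i ord0)
    (fun w => (Y t w : 'cV[R]_p) i ord0).
Proof.
apply: (compensated_integral_entry hN i _ _ (hY t)) => j.
- exact: (measurableT_comp (measurable_cV_coord j) (mf t)).
- exact: (measurableT_comp (measurable_cV_coord j) (mY t)).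
Qed.

Let mcos := @measurable_cos R.
Let msin := @measurable_sin R.

Let Rintegral_cos_shift (Z : Omega -> R) c : measurable_fun setT Z ->
  \int[P]_w cos (Z w + c) = cos c * \int[P]_w cos (Z w) - sin c * \int[P]_w sin (Z w).
Proof.
move=> mZ.
have ic : P.-integrable setT (EFin \o (fun w => cos (Z w))).
  by apply: bounded_probability_integrable; [exact: (measurableT_comp mcos mZ)|move=> w; exact: cos_max].
have is_ : P.-integrable setT (EFin \o (fun w => sin (Z w))).
  by apply: bounded_probability_integrable; [exact: (measurableT_comp msin mZ)|move=> w; exact: sin_max].
have ic' : P.-integrable setT (EFin \o (fun w => cos c * cos (Z w))).
  by have := integrableZl measurableT (cos c) ic; apply: eq_integrable.
have is' : P.-integrable setT (EFin \o (fun w => sin c * sin (Z w))).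
  by have := integrableZl measurableT (sin c) is_; apply: eq_integrable.
rewrite -!RintegralZl// -RintegralB//.
by apply: eq_Rintegral => w _; rewrite cosD mulrC [X in _ - X]mulrC.
Qed.

(** Almost everywhere the integrands at [- t] are those at [t] composed with [phi], which preserves
    [kappa]; hence equal exponents, equal characteristic functions and equal laws. *)
Lemma law_reversal : (forall t, {ae kappa, forall x,
    f (- t) x = f t (- x.1, invmx Mm *m Mp *m (x.2 : 'cV[R]_p)) :> 'cV[R]_p}) ->
  (forall C : set (borel_cV R p), measurable C ->
    mu [set invmx Mm *m Mp *m z | z in (C : set 'cV[R]_p)] = mu C) ->
  forall n (t : 'I_n -> R) (B : set (n.-tuple (borel_cV R p))), measurable B ->
  P [set w | B [tuple Y (- t i) w | i < n]] = P [set w | B [tuple Y (t i) w | i < n]].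
Proof.
move=> hf hb n t B mB.
pose phi (x : E) : E := (- x.1, invmx Mm *m Mp *m (x.2 : 'cV[R]_p)).
have mphi : measurable_fun setT phi.
  apply/measurable_fun_pairP; split.
    exact: (measurableT_comp (@oppr_measurable R setT) measurable_fst).
  exact: (measurableT_comp (measurable_mulmx_cV _) measurable_snd).
pose T1 w := [tuple Y (- t i) w | i < n]; pose T2 w := [tuple Y (t i) w | i < n].
have mT (u : 'I_n -> R) : measurable_fun setT (fun w => [tuple Y (u i) w | i < n]).
  apply/measurable_fun_tnthP => i.
  rewrite (_ : _ \o _ = Y (u i)); first exact: mY.
  by apply/funext => w /=; rewrite tnth_mktuple.
pose g (u : 'I_n -> R) x (j : 'I_n * 'I_p) : R := (f (u j.1) x : 'cV[R]_p) j.2 ord0.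
pose Z (u : 'I_n -> R) w (j : 'I_n * 'I_p) : R := (Y (u j.1) w : 'cV[R]_p) j.2 ord0.
have hZ u r : scalar_integral P kappa N (fun x => lin_comb r (g u x)) (fun w => lin_comb r (Z u w)).
  by apply: scalar_integral_lin_comb => // j; exact: integrand_scalar_integral.
pose u1 i := - t i.
have aeg : {ae kappa, forall x, g u1 x = g t (phi x)}.
  have : {ae kappa, forall x, forall i, f (- t i) x = f (t i) (phi x) :> 'cV[R]_p}.
    by apply: filter_forall => i; exact: hf.
  by apply: filterS => x hx; apply/funext => j; rewrite /g hx.
have expE r (h : R -> R) : measurable_fun setT h ->
    kappa.-integrable setT (EFin \o (fun x => h (lin_comb r (g u1 x)))) ->
    kappa.-integrable setT (EFin \o (fun x => h (lin_comb r (g t x)))) ->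
    \int[kappa]_x h (lin_comb r (g u1 x)) = \int[kappa]_x h (lin_comb r (g t x)).
  move=> mh i1 i2.
  have mL u : measurable_fun setT (fun x => lin_comb r (g u x)) by have [] := hZ u r.
  have mhL u : measurable_fun setT (fun x => h (lin_comb r (g u x))).
    exact: (measurableT_comp mh (mL u)).
  have ae1 (q : R -> \bar R) : ae_eq kappa setT (fun x => q (h (lin_comb r (g u1 x))))
      (fun x => q (h (lin_comb r (g t (phi x))))).
    by apply: filterS aeg => x -> _.
  have mphiL : measurable_fun setT (fun x => h (lin_comb r (g t (phi x)))).
    exact: (measurableT_comp (mhL t) mphi).
  have i3 : kappa.-integrable setT (EFin \o (fun x => h (lin_comb r (g t (phi x))))).
    apply/integrableP; split; first exact/measurable_EFinP.
    move/integrableP: i1 => [_]; apply: le_lt_trans.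
    rewrite le_eqVlt; apply/orP; left; apply/eqP; apply: ae_eq_integral => //.
    - by apply: measurableT_comp => //; exact/measurable_EFinP.
    - by apply: measurableT_comp => //; exact/measurable_EFinP.
    - by have := ae1 (fun y => `|y%:E|%E); apply: filterS => x hx sx; have := hx sx; rewrite /= => ->.
  transitivity (\int[kappa]_x h (lin_comb r (g t (phi x)))).
    congr fine; apply: ae_eq_integral => //.
    - by apply/measurable_EFinP; exact: mhL.
    - by apply/measurable_EFinP.
  have law (C : set E) : measurable C -> kappa (phi @^-1` C) = kappa (id @^-1` C).
    by move=> mC; exact: reversal_preserves_intensity.
  exact: (@eq_law_Rintegral R _ E _ E _ E kappa kappa phi id
    (fun x => h (lin_comb r (g t x))) mphi (@measurable_id _ _ _) (mhL t) law i3 i2).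
have charE r : \int[P]_w cos (lin_comb r (Z u1 w)) = \int[P]_w cos (lin_comb r (Z t w)) /\
    \int[P]_w sin (lin_comb r (Z u1 w)) = \int[P]_w sin (lin_comb r (Z t w)).
  have [i1 i1'] := scalar_integral_trig_integrable (hZ u1 r).
  have [i2 i2'] := scalar_integral_trig_integrable (hZ t r).
  have [-> ->] := scalar_integral_char hN (hZ u1 r).
  have [-> ->] := scalar_integral_char hN (hZ t r).
  have mcos1 : measurable_fun setT (fun y : R => cos y - 1) by exact: measurable_funB.
  have msinid : measurable_fun setT (fun y : R => sin y - y) by exact: measurable_funB.
  have EC := expE r (fun y => cos y - 1) mcos1 i1 i2.
  have ES := expE r (fun y => sin y - y) msinid i1' i2'.
  have EE := congr1 expR EC; split.
    exact: (congr2 *%R EE (congr1 cos ES)).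
  exact: (congr2 *%R EE (congr1 sin ES)).
apply: (@eq_cos_probability _ _ _ _ _ _ _ T1 T2 (mT u1) (mT t) (lin_forms (@tuple_coord R p n))
  (measurable_lin_forms measurable_tuple_coord) (@lin_formsD _ _ _ _) (@lin_formsZ _ _ _ _) P P B).
- by exists (fun x => lin_comb [::] (tuple_coord x)), [::].
- move=> l c [r ->].
  have tupE u w : lin_comb r (tuple_coord [tuple Y (u i) w | i < n]) = lin_comb r (Z u w).
    by congr lin_comb; apply/funext => j; rewrite /tuple_coord tnth_mktuple.
  under eq_Rintegral do rewrite (tupE u1); under [RHS]eq_Rintegral do rewrite tupE.
  have mZ u : measurable_fun setT (fun w => lin_comb r (Z u w)) by have [] := hZ u r.
  by rewrite !Rintegral_cos_shift//; have [-> ->] := charE r.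
- exact: half_spaces_tuple.
Qed.

Hypothesis hrev : forall n (t : 'I_n -> R) (B : set (n.-tuple (borel_cV R p))),
  measurable B ->
  P [set w | B [tuple Y (- t i) w | i < n]] = P [set w | B [tuple Y (t i) w | i < n]].
Hypothesis hmin : forall C : set E, measurable C ->
  exists2 C', <<s [set A | exists t, exists2 B, measurable B & A = f t @^-1` B] >> C' &
    kappa (C `+` C') = 0%E.
Hypothesis mu0 : mu [set (0 : 'cV[R]_p)] = 0%E.

Let Z (w : Omega) (j : R * 'I_p) : R := (Y j.1 w : 'cV[R]_p) j.2 ord0.
Let Zr (w : Omega) (j : R * 'I_p) : R := (Y (- j.1) w : 'cV[R]_p) j.2 ord0.

(** The list [r] is read as a tuple of times, repetitions allowed, so that the equality of
    finite-dimensional laws applies to it. *)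
Let eq_trig (h : R -> R) r : measurable_fun setT h -> (forall x, `|h x| <= 1) ->
  \int[P]_w h (lin_comb r (Z w)) = \int[P]_w h (lin_comb r (Zr w)).
Proof.
move=> mh h1; pose n := size r; pose r_ (k : 'I_n) := tnth (in_tuple r) k.
pose G (x : n.-tuple (borel_cV R p)) : R :=
  \sum_k (r_ k).1 * tuple_coord x (k, (r_ k).2.2).
have mG : measurable_fun setT G.
  apply: measurable_sum => k; apply: measurable_funM => //.
  exact: measurable_tuple_coord.
pose T (u : R -> R) w := [tuple Y (u (r_ i).2.1) w | i < n].
have mT u : measurable_fun setT (T u).
  apply/measurable_fun_tnthP => i.
  rewrite (_ : _ \o _ = Y (u (r_ i).2.1)); first exact: mY.
  by apply/funext => w /=; rewrite tnth_mktuple.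
have GE u w : lin_comb r (fun j => (Y (u j.1) w : 'cV[R]_p) j.2 ord0) = G (T u w).
  rewrite /lin_comb big_tnth; apply: eq_bigr => k _.
  by rewrite /tuple_coord tnth_mktuple.
have mhG : measurable_fun setT (h \o G) by exact: measurableT_comp.
have ib u : P.-integrable setT (EFin \o ((h \o G) \o T u)).
  by apply: bounded_probability_integrable => [|w]; [exact: (measurableT_comp mhG (mT u))|exact: h1].
have law B : measurable B -> P (T id @^-1` B) = P (T -%R @^-1` B).
  by move=> mB; have := hrev (fun i => (r_ i).2.1) mB.
have := eq_law_Rintegral (mT id) (mT -%R) mhG law (ib id) (ib -%R).
rewrite /= => E1.
transitivity (\int[P]_w h (G (T id w))).
  by apply: eq_Rintegral => w _; rewrite -GE.
by rewrite E1; apply: eq_Rintegral => w _; rewrite -GE.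
Qed.

Let aeS (Q Q' : E -> Prop) : (forall x, Q x -> Q' x) ->
  {ae kappa, forall x, Q x} -> {ae kappa, forall x, Q' x}.
Proof. by move=> QQ' [U [mU U0 QU]]; exists U; split => // x nQ'; apply: QU => /QQ'. Qed.

Let F1 (x : E) : path_space p := fun t => f t x.
Let F2 (x : E) : path_space p := fun t => f (- t) x.

Let mF1 : measurable_fun setT F1.
Proof. by apply: measurable_pathP => t; exact: mf. Qed.

Let mF2 : measurable_fun setT F2.
Proof. by apply: measurable_pathP => t; exact: mf. Qed.

Let nonzero : {ae kappa, forall x, (x.2 : 'cV[R]_p) != 0}.
Proof.
apply: (intensity_ae (Q := fun z : borel_cV R p => (z : 'cV[R]_p) != 0)).
have m0 : measurable [set (0 : 'cV[R]_p) : borel_cV R p].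
  rewrite (_ : [set _] = \bigcap_(i in [set: 'I_p])
      ((fun z : borel_cV R p => (z : 'cV[R]_p) i ord0 == 0) @^-1` [set true])).
    apply: fin_bigcap_measurable => // i _; rewrite -[_ @^-1` _]setTI.
    by apply: measurable_fun_eqr => //; exact: measurable_cV_coord.
  apply/seteqP; split=> [z /= -> i _|z h] /=; first by rewrite mxE eqxx.
  by apply/matrixP => i j; rewrite ord1 mxE; apply/eqP; exact: (h i Logic.I).
exists [set (0 : 'cV[R]_p) : borel_cV R p]; split => //.
by move=> z /= /negP; rewrite negbK => /eqP.
Qed.

(* [cos (y / m) <> 1] for some [m] as soon as [y <> 0]. *)
Let test_set (n : nat) : set (path_space p) :=
  if unpickle n is Some (q, i, m) then
    [set pi | cos (m.+1%:R^-1 * path_coord pi (ratr (q : rat) : R, i : 'I_p)) != 1]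
  else set0.

Let test_setP (pi : path_space p) (q : rat) (i : 'I_p) :
  path_coord pi (ratr q, i) != 0 -> exists n, test_set n pi.
Proof.
set y := path_coord _ _ => y0.
(* Then [|y| < m + 1], so the scaled value stays within [1 < pi], where only [0] has cosine [1]. *)
pose m := Num.truncn (`|y|).
exists (pickle (q, i, m)); rewrite /test_set pickleK /= -/y.
have ym : `|m.+1%:R^-1 * y| <= 1.
  rewrite normrM ger0_norm// mulrC ler_pdivrMr// mul1r ltW//.
  exact: truncnS_gt.
apply/negP => /eqP /cos_eq1_pi H0.
have : m.+1%:R^-1 * y = 0.
  by apply: H0; apply: (le_trans ym); have := @pi_ge2 R; lra.
by move=> /eqP; rewrite mulf_eq0 invr_eq0 pnatr_eq0/= (negbTE y0).
Qed.

(** A path null at all rational times is the path of zero coefficients at the same singularity,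
    which forces [Mp z = 0]. *)
Let some_value_neq0 x : (x.2 : 'cV[R]_p) != 0 ->
  exists (q : rat) (i : 'I_p), (f (ratr q) x : 'cV[R]_p) i ord0 != 0.
Proof.
move=> x0; apply: contrapT => nex.
have h : kern_determined D x.1 x.1 (Mp *m (x.2 : 'cV[R]_p)) 0 (Mm *m (x.2 : 'cV[R]_p)) 0.
  move=> q; apply: (etrans (esym (fE (ratr q) x))).
  rewrite [RHS]kern0.
  apply/matrixP => i j; rewrite ord1 [RHS]mxE.
  have [//|nz] := eqVneq ((f (ratr q) x : 'cV[R]_p) i ord0) 0.
  by exfalso; apply: nex; exists q, i.
have [Mx0 _] := kern_determined_eq D0 h.
by move/eqP: x0; apply; rewrite -(mulKmx hMp x.2) Mx0 mulmx0.
Qed.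

Let path_law : forall B : set (path_space p), measurable B ->
  kappa (F1 @^-1` B) = kappa (F2 @^-1` B).
Proof.
apply: (eq_measure_countable_cover (C := test_set) mF1 mF2).
- move=> n; rewrite /test_set; case: (unpickle n) => [[[q i] m]|//].
  rewrite -[X in measurable X]setTI (_ : [set pi | _] =
    (fun pi => cos (m.+1%:R^-1 * path_coord pi (ratr q, i))) @^-1` (~` [set 1])).
    apply: (measurableT_comp mcos) => //; last exact: measurableC.
    by apply: measurable_funM => //; exact: measurable_path_coord.
  by apply/seteqP; split=> pi /= /eqP.
- apply: aeS nonzero => x /some_value_neq0[q [i nz]].
  exact: (@test_setP (F1 x) q i).
- apply: aeS nonzero => x /some_value_neq0[q [i nz]].
  (* The reversed path takes at [- q] the value that the path takes at [q]. *)
  apply: (@test_setP (F2 x) (- q) i).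
  by rewrite /path_coord /F2/= rmorphN opprK.
- move=> n B mB; rewrite /test_set; case: (unpickle n) => [[[q i] m]|]; last first.
    rewrite setI0; apply: (etrans (congr1 kappa (preimage_set0 F1))).
    exact: (esym (congr1 kappa (preimage_set0 F2))).
  apply: (integrand_law_weighted hN mF1 mF2 measurable_path_coord (Z1 := Z) (Z2 := Zr)).
  + by move=> j; exact: integrand_scalar_integral.
  + by move=> j; exact: integrand_scalar_integral.
  + by move=> r; apply: eq_trig => //; exact: cos_max.
  + by move=> r; apply: eq_trig => //; exact: sin_max.
  + exact: lin_forms_coord.
  + exact: half_spaces_path.
Qed.

(** The sigma-algebra generated by the integrands lies in the pullback of the path sigma-algebra, so
    the approximating set is a preimage under the path map. *)
Let min_preimage (C : set E) : measurable C ->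
  exists2 B : set (path_space p), measurable B & kappa (C `+` F1 @^-1` B) = 0%E.
Proof.
move=> mC; have [C' sC' k0] := hmin mC.
suff [B mB C'E] : preimage_set_system setT F1 (@measurable _ (path_space p)) C'.
  by exists B => //; rewrite -[F1 @^-1` B]setTI C'E.
rewrite -g_sigma_preimageE; apply: sub_sigma_algebra2 sC'.
move=> _ [t [B mB ->]]; exists ((fun pi : path_space p => pi t) @^-1` B).
  by exists t, B.
by rewrite setTI.
Qed.

Let factor : exists2 phi : path_space p -> E, measurable_fun setT phi &
  {ae kappa, forall x, phi (F1 x) = x}.
Proof.
have [h0 mh0 h0E] := ae_factor mF1 (measurable_fst : measurable_fun setT (fst : E -> R)) min_preimage.
have /choice[h hh] : forall i : 'I_p, exists h : path_space p -> R,
    measurable_fun setT h /\ {ae kappa, forall x, h (F1 x) = (x.2 : 'cV[R]_p) i ord0}.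
  move=> i; have mi : measurable_fun setT (fun x : E => (x.2 : 'cV[R]_p) i ord0).
    exact: (measurableT_comp (measurable_cV_coord i) measurable_snd).
  by have [h mh hE] := ae_factor mF1 mi min_preimage; exists h.
exists (fun pi => (h0 pi, (\col_i h i pi : 'cV[R]_p))).
  apply/measurable_fun_pairP; split => //=.
  apply: measurable_cV_coordP => i.
  rewrite (_ : (fun _ => _) = h i); first by have [] := hh i.
  by apply/funext => pi; rewrite /= mxE.
have : {ae kappa, forall x, forall i, h i (F1 x) = (x.2 : 'cV[R]_p) i ord0}.
  by apply: filter_forall => i; have [] := hh i.
apply: filterS2 h0E => -[s z]/= -> hz; congr pair.
by apply/matrixP => i j; rewrite mxE ord1 hz.
Qed.

(** That [phi pi] reproduces [pi] at time [q] is a measurable property of [pi] alone, so equality of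
    the path laws carries it to reversed paths; rational [q] keep the exceptional set null. *)
Let reflected_factor (phi : path_space p -> E) : measurable_fun setT phi ->
  {ae kappa, forall x, phi (F1 x) = x} ->
  {ae kappa, forall x, phi (F2 x) = (- x.1, invmx Mp *m Mm *m (x.2 : 'cV[R]_p)) /\
    invmx Mm *m Mp *m (x.2 : 'cV[R]_p) = invmx Mp *m Mm *m (x.2 : 'cV[R]_p)}.
Proof.
move=> mphi phiE.
have sec : {ae kappa, forall x, forall q : rat, f (ratr q) (phi (F2 x)) = f (- ratr q) x}.
  apply: ae_countable => q.
  apply: (ae_law mF1 mF2 path_law (T := [set pi | f (ratr q) (phi pi) = pi (ratr q)])); last first.
    by apply: aeS phiE => x xE; exact: (congr1 (f (ratr q)) xE).
  rewrite (_ : [set pi | _] = \bigcap_(i in [set: 'I_p]) ((fun pi : path_space p =>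
      (f (ratr q) (phi pi) : 'cV[R]_p) i ord0 == path_coord pi (ratr q, i)) @^-1` [set true])).
    apply: fin_bigcap_measurable => // i _; rewrite -[_ @^-1` _]setTI.
    apply: measurable_fun_eqr => //; last exact: measurable_path_coord.
    exact: (measurableT_comp (measurable_cV_coord i) (measurableT_comp (mf (ratr q)) mphi)).
  apply/seteqP; split=> [pi /= piE i _|pi h] /=.
    by apply/eqP; exact: (congr1 (fun v : 'cV_p => v i ord0) piE).
  by apply/matrixP => i j; rewrite ord1; apply/eqP; exact: (h i Logic.I).
have ae_filter := ae_filter_ringOfSetsType kappa.
apply: filterS2 nonzero sec => x x0 xE.
set y := phi (F2 x) in xE *.
(* The reversed path of [(s, z)] is a kernel path with singularity [- s] and coefficients [Mm z],
   [Mp z], compared here with the path of [y]. *)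
have det : kern_determined D (- x.1) y.1 (Mm *m (x.2 : 'cV[R]_p)) (Mp *m (y.2 : 'cV[R]_p))
    (Mp *m (x.2 : 'cV[R]_p)) (Mm *m (y.2 : 'cV[R]_p)).
  by move=> q; rewrite -kernN -!fE xE.
have M0 (M : 'M[R]_p) : M \in unitmx -> M *m (x.2 : 'cV[R]_p) != 0.
  move=> uM; apply/eqP => Mx; move/eqP: x0; apply.
  by rewrite -(mulKmx uM x.2) Mx mulmx0.
have [y1 y2 y2'] := kern_determined_id D0 D1 det (M0 _ hMm) (M0 _ hMp).
have y2p : (y.2 : 'cV[R]_p) = invmx Mp *m Mm *m (x.2 : 'cV[R]_p).
  by rewrite -mulmxA y2 mulKmx.
split; last by rewrite -y2p -mulmxA y2' mulKmx.
by rewrite [y]surjective_pairing -y1 y2p.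
Qed.

Lemma reversal_involution : {ae mu, forall z : 'cV[R]_p,
  invmx Mm *m Mp *m z = invmx Mp *m Mm *m z}.
Proof.
have [phi mphi phiE] := factor.
apply: (intensity_aeW (Q := fun z : borel_cV R p =>
  invmx Mm *m Mp *m (z : 'cV[R]_p) = invmx Mp *m Mm *m (z : 'cV[R]_p))).
  exact: measurable_involution.
by apply: aeS (reflected_factor mphi phiE) => x [].
Qed.

Lemma reversal_mu_preserving (C : set (borel_cV R p)) : measurable C ->
  mu [set invmx Mm *m Mp *m z | z in (C : set 'cV[R]_p)] = mu C.
Proof.
move=> mC; have [phi mphi phiE] := factor.
rewrite swap_in_mu_preserving; set C' := _ @^-1` C.
have mC' : measurable C'.
  by rewrite /C' -[_ @^-1` _]setTI; exact: measurable_mulmx_cV.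
(* Intervals of length one, so the intensity of a product is [mu] of its second factor; reflection
   carries [[-1, 0]] to [[0, 1]]. *)
pose I01 : set (measurableTypeR R) := [set` `[0 : R, 1]].
pose I10 : set (measurableTypeR R) := [set` `[-1 : R, 0]].
have mI01 : measurable I01 by exact: measurable_itv.
have mI10 : measurable I10 by exact: measurable_itv.
have mphiC : measurable (phi @^-1` (I01 `*` C)).
  by rewrite -[_ @^-1` _]setTI; apply: mphi => //; exact: measurableX.
have : kappa (I10 `*` C') = kappa (I01 `*` C).
  transitivity (kappa (F2 @^-1` (phi @^-1` (I01 `*` C)))).
    apply: ae_eq_measure; first exact: measurableX.
      by rewrite -[_ @^-1` _]setTI; exact: mF2.
    apply: aeS (reflected_factor mphi phiE) => x [xE _].
    change ((I10 `*` C') x <-> (I01 `*` C) (phi (F2 x))); rewrite xE.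
    by rewrite /I01 /I10 /C' /= !in_itv/= oppr_ge0 lerNl andbC.
  rewrite -path_law//; apply: ae_eq_measure; last first.
  - apply: aeS phiE => x xE.
    by change ((I01 `*` C) (phi (F1 x)) <-> (I01 `*` C) x); rewrite xE.
  - exact: measurableX.
  - by rewrite -[_ @^-1` _]setTI; exact: mF1.
rewrite !intensity_setX// !lebesgue_measure_itv/= !lte_fin ltr01 ltrN10.
by rewrite sube0 -EFinB sub0r opprK !mul1e.
Qed.

End laws.
End reversal.
Theorem theorem4p1 (R : realType) (p : nat) (hp : (0 < p)%N)
  (H Mp Mm : 'M[R]_p)
  (hH : forall x, Re_eig H x -> 0 < x < 1 /\ x != 2^-1)
  (mu : {measure set (borel_cV R p) -> \bar R}) (hmu : L2_levy_measure mu)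
  (d : measure_display) (Omega : measurableType d) (P : probability Omega R)
  (X : R -> {RV P >-> borel_cV R p})
  (hX : is_maofLm H Mp Mm mu X)
  (hMp : Mp \in unitmx) (hMm : Mm \in unitmx)
  (hmin : minimal_integrands (intensity mu) (maofLm_integrand H Mp Mm)) :
  let g := maofLm_kernel H Mp Mm in
  let i := time_reversible P X in
  let a := {ae mu, forall z : 'cV[R]_p,
             invmx Mm *m Mp *m z = invmx Mp *m Mm *m z} in
  let b := forall C : set (borel_cV R p), measurable C ->
             mu [set invmx Mm *m Mp *m z | z in (C : set 'cV[R]_p)] = mu C in
  let a' := forall t : R, {ae intensity mu, forall x,
             g (- t) x.1 *m x.2 = g t (- x.1) *m invmx Mm *m Mp *m x.2 /\
             g t (- x.1) *m invmx Mm *m Mp *m x.2 =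
               g t (- x.1) *m invmx Mp *m Mm *m x.2} in
  (i <-> a /\ b) /\ (i <-> a' /\ b).
Proof.
move=> g i a b a'.
have [[d' [W [P' [N [Y [hN hY hXY]]]]]] _] := hX.
(* [X] shares only its laws with the Poisson integral [Y], which suffices since reversibility
   depends on the laws alone. *)
have revXY : i <-> forall n (t : 'I_n -> R) (B : set (n.-tuple (borel_cV R p))),
    measurable B ->
    P' [set w | B [tuple Y (- t i) w | i < n]] = P' [set w | B [tuple Y (t i) w | i < n]].
  split=> h n t B mB.
    have E1 := hXY n (fun i => - t i) B mB; have E2 := hXY n t B mB.
    by rewrite -E1 -E2; exact: h.
  have E1 := hXY n (fun i => - t i) B mB; have E2 := hXY n t B mB.
  by rewrite [LHS]E1 [RHS]E2; exact: h.
(* Both equivalences come from one cycle: [a] and [b] give [a'] and [b], these give [i], and [i]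
   gives [a] and [b]. *)
have aa' : a -> a'.
  move=> ha t; have := intensity_ae ha; apply: filterS => x xA.
  exact: (involution_kernel_swap H hMp hMm xA t x.1).
have a'i : a' /\ b -> i.
  move=> [ha' hb]; apply/revXY; apply: (law_reversal hMp hMm hN hY) => // t.
  have ae_filter := ae_filter_ringOfSetsType (intensity mu).
  apply: filterS (ha' t) => x [xE _].
  by apply: (etrans xE); rewrite -!mulmxA.
have iab : i -> a /\ b.
  move=> /revXY hrev; have [hmin1 _] := hmin; have [mu0 _] := hmu; split.
    exact: (reversal_involution hH hMp hMm hN hY hrev hmin1 mu0).
  by move=> C mC; exact: (reversal_mu_preserving hH hMp hMm hN hY hrev hmin1 mu0).
split; split.
- exact: iab.
- by move=> [ha hb]; apply: a'i; split => //; exact: aa'.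
- by move=> /iab[ha hb]; split => //; exact: aa'.
- exact: a'i.
Qed.
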